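(* Let $(\Lambda_1,\phi_1)$ be an invertible $2$-dimensional $\mathbb{Q}$-lattice, represented up to scale by $y_1=(\rho_1,z_1)\in M_2(\widehat{\mathbb{Z}})\times\mathfrak{H}$. Let $\mathcal{V}=\mathcal{P}\mathcal{L}_{\Lambda_1}$ be the set of projective classes of lattices commensurable with $\Lambda_1$ (the vertex set of the big picture), equipped with the metric $\mathrm{d}_1=\log\delta$ given by the logarithm of the hyperdistance, and let $\nu_1\in\mathcal{V}$ be the projective class of $\Lambda_1$. Let $(\mathcal{A},\sigma_t)$ be the $\mathrm{GL}_2$-system. Then: (1) the $C^*$-algebra $\mathcal{A}$ admits a representation $\pi$ as an algebra of bounded operators acting on the Hilbert space $\mathcal{H}=\ell^2(\mathcal{V})$; (2) the time evolution $\sigma_t$ is implemented in this representation by the (unbounded, diagonal) operator $\mathrm{H}$ given by $$(\mathrm{H}\xi)(\nu)=\mathrm{d}_1(\nu_1,\nu)\,\xi(\nu),$$ in the sense that $$\pi(\sigma_t f)=e^{it\mathrm{H}}\,\pi(f)\,e^{-it\mathrm{H}}$$ for all $f\in\mathcal{A}$ and $t\in\mathbb{R}$.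
   Context: **Lattices and hyperdistance.** A lattice is a discrete co-compact subgroup $\Lambda\subset\mathbb{C}$. Two lattices $\Lambda,\Lambda'$ are commensurable if $\Lambda\cap\Lambda'$ has finite index in both. They are projectively equivalent if $\Lambda=\alpha\Lambda'$ for some $\alpha\in\mathbb{Q}^*$. $\mathcal{P}\mathcal{L}_{\Lambda_1}$ denotes the set of projective equivalence classes of lattices commensurable with $\Lambda_1$. The hyperdistance $\delta(\Lambda,\Lambda')$ between commensurable lattices is the smallest positive integer $N$ for which there exist $\alpha,\alpha'\in\mathbb{Q}^*$ with $[\Lambda:\alpha'\Lambda']=N=[\Lambda':\alpha\Lambda]$ (in particular $\alpha'\Lambda'\subset\Lambda$ and $\alpha\Lambda\subset\Lambda'$). It depends only on projective classes, and $\log\delta$ is a metric on $\mathcal{P}\mathcal{L}_{\Lambda_1}$. The big picture is the graph with vertex set $\mathcal{P}\mathcal{L}_{\Lambda_1}$ in which two vertices are joined by an edge if and only if their hyperdistance is a prime number. **$\mathbb{Q}$-lattices.** A $2$-dimensional $\mathbb{Q}$-lattice is a pair $(\Lambda,\phi)$ with $\Lambda\subset\mathbb{C}$ a lattice and $\phi:\mathbb{Q}^2/\mathbb{Z}^2\to\mathbb{Q}\Lambda/\Lambda$ a group homomorphism; it is invertible if $\phi$ is an isomorphism. Two $\mathbb{Q}$-lattices are equivalent up to scale if $(\lambda\Lambda,\lambda\phi)=(\Lambda',\phi')$ for some $\lambda\in\mathbb{C}^*$. Let $\mathfrak{H}$ be the complex upper half-plane, $\widehat{\mathbb{Z}}=\varprojlim_n\mathbb{Z}/n\mathbb{Z}$,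 and identify $\mathrm{End}(\mathbb{Q}^2/\mathbb{Z}^2)$ with $M_2(\widehat{\mathbb{Z}})$. A pair $(\rho,z)\in M_2(\widehat{\mathbb{Z}})\times\mathfrak{H}$ represents up to scale the $\mathbb{Q}$-lattice with lattice $\mathbb{Z}+z\mathbb{Z}$ and homomorphism $\phi$ obtained by composing $\rho$ with the isomorphism $\mathbb{Q}^2/\mathbb{Z}^2\to\mathbb{Q}(\mathbb{Z}+z\mathbb{Z})/(\mathbb{Z}+z\mathbb{Z})$, $(x_1,x_2)\mapsto x_1-zx_2$. This identifies $\mathbb{Q}$-lattices up to scale with $\mathrm{SL}_2(\mathbb{Z})\backslash(M_2(\widehat{\mathbb{Z}})\times\mathfrak{H})$, with action by left multiplication on the first factor and by fractional linear transformations on the second. **The $\mathrm{GL}_2$-system.** Let $\Gamma_1=\mathrm{SL}_2(\mathbb{Z})$ and $$\mathcal{Y}=\{(g,\rho,z)\in\mathrm{GL}_2^+(\mathbb{Q})\times M_2(\widehat{\mathbb{Z}})\times\mathfrak{H}\mid g\rho\in M_2(\widehat{\mathbb{Z}})\},$$ with $\mathrm{GL}_2^+(\mathbb{Q})$ acting on $\mathfrak{H}$ by fractional linear transformations and carrying the discrete topology. Let $\mathcal{A}_c$ be the set of continuous functions $f:\mathcal{Y}\to\mathbb{C}$ satisfying $f(\gamma g,\rho,z)=f(g,\rho,z)$ and $f(g\gamma,\rho,z)=f(g,\gamma\rho,\gamma z)$ for all $\gamma\in\Gamma_1$, with compact support modulo the corresponding action of $\Gamma_1\times\Gamma_1$.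 It is a $*$-algebra under $$(f_1*f_2)(g,\rho,z)=\sum_{s\in\Gamma_1\backslash\mathrm{GL}_2^+(\mathbb{Q}),\ s\rho\in M_2(\widehat{\mathbb{Z}})}f_1(gs^{-1},s\rho,sz)\,f_2(s,\rho,z),\qquad f^*(g,\rho,z)=\overline{f(g^{-1},g\rho,gz)}.$$ For $y=(\rho,z)\in M_2(\widehat{\mathbb{Z}})\times\mathfrak{H}$ put $\mathcal{Y}_y=\{g\in\mathrm{GL}_2^+(\mathbb{Q})\mid g\rho\in M_2(\widehat{\mathbb{Z}})\}$, and let $\pi_y$ be the representation of $\mathcal{A}_c$ by bounded operators on $\ell^2(\Gamma_1\backslash\mathcal{Y}_y)$ given by $$\pi_y(f)\xi(g)=\sum_{h\in\Gamma_1\backslash\mathcal{Y}_y}f(gh^{-1},h\rho,hz)\,\xi(h).$$ $\mathcal{A}$ is the $C^*$-algebra completion of $\mathcal{A}_c$ in the norm $\|f\|=\sup_y\|\pi_y(f)\|$. The time evolution is the one-parameter group of automorphisms of $\mathcal{A}$ determined by $(\sigma_tf)(g,\rho,z)=\det(g)^{it}f(g,\rho,z)$, $t\in\mathbb{R}$. The pair $(\mathcal{A},\sigma_t)$ is called the $\mathrm{GL}_2$-system. *)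

(* Defs.v *)
From HB Require Import structures.
From mathcomp Require Import all_boot all_order all_algebra.
From mathcomp Require Import complex finmap.
From mathcomp Require Import all_classical all_reals all_analysis.

Set Implicit Arguments.
Unset Strict Implicit.
Unset Printing Implicit Defensive.
Import Order.TTheory GRing.Theory Num.Theory.
Import numFieldNormedType.Exports.
Local Open Scope classical_set_scope.
Local Open Scope ring_scope.
Local Open Scope complex_scope.
Local Open Scope card_scope.

(* The usual topology and norm of the complex numbers [R[i]]; note that the
   norm [`|z|] takes its (real) values in [R[i]]. *)
HB.instance Definition _ (R : realType) := NormedModule.copy R[i] R[i]^o.

(** * The profinite integers *)

(* Inverse limit of Z/N over N >= 2 ('Z_N is Z/N only for such N, and N = 1
   contributes nothing), with the topology induced by the product. *)
Definition Zhat_fam : Type :=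
  prod_topology (fun n : nat => discrete_topology 'Z_n.+2).

Definition Zhat_compat : set Zhat_fam :=
  [set x : forall n, 'Z_n.+2 | forall m n : nat, (m.+2 %| n.+2)%N ->
     (x n : nat)%:R = x m :> 'Z_m.+2].

Definition Zhat : Type := set_type Zhat_compat.
HB.instance Definition _ := Topological.on Zhat.

Definition Zhat_proj (x : Zhat) (n : nat) : 'Z_n.+2 := set_val x n.

Lemma Zhat_projP (x : Zhat) m n : (m.+2 %| n.+2)%N ->
  (Zhat_proj x n : nat)%:R = Zhat_proj x m :> 'Z_m.+2.
Proof. exact: (set_mem (svalP x)). Qed.

Lemma Zhat_ext (x y : Zhat) :
  (forall n, Zhat_proj x n = Zhat_proj y n) -> x = y.
Proof. by move=> xy; apply: val_inj; apply: functional_extensionality_dep. Qed.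

Definition mkZhat (x : forall n, 'Z_n.+2) (hx : Zhat_compat x) : Zhat :=
  SigSub (mem_set hx).

Lemma natr_Zp_mod m n k : (m.+2 %| n.+2)%N ->
  (k %% n.+2)%:R = k%:R :> 'Z_m.+2.
Proof.
by move=> mn; apply: val_inj; rewrite /= !val_Zp_nat//= modn_dvdm.
Qed.

Section ZhatRing.

Lemma Zhat0_subproof : Zhat_compat (fun n => 0 : 'Z_n.+2).
Proof. by []. Qed.

Lemma Zhat1_subproof : Zhat_compat (fun n => 1 : 'Z_n.+2).
Proof. by []. Qed.

Lemma ZhatN_subproof (x : Zhat) : Zhat_compat (fun n => - Zhat_proj x n).
Proof.
move=> m n mn /=; rewrite natr_Zp_mod// natrB; last exact/ltnW/ltn_ord.
rewrite (Zhat_projP x mn) -[n.+2]addn0 -(@natr_Zp_mod m n)// addn0 modnn.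
by rewrite sub0r.
Qed.

Lemma ZhatD_subproof (x y : Zhat) :
  Zhat_compat (fun n => Zhat_proj x n + Zhat_proj y n).
Proof. by move=> m n mn /=; rewrite natr_Zp_mod// natrD !Zhat_projP. Qed.

Lemma ZhatM_subproof (x y : Zhat) :
  Zhat_compat (fun n => Zhat_proj x n * Zhat_proj y n).
Proof. by move=> m n mn /=; rewrite natr_Zp_mod// natrM !Zhat_projP. Qed.

Let zero := mkZhat Zhat0_subproof.
Let one := mkZhat Zhat1_subproof.
Let opp x := mkZhat (ZhatN_subproof x).
Let add x y := mkZhat (ZhatD_subproof x y).
Let mul x y := mkZhat (ZhatM_subproof x y).

Let addA : associative add.
Proof. by move=> x y z; apply: Zhat_ext => n; exact: addrA. Qed.
Let addC : commutative add.
Proof. by move=> x y; apply: Zhat_ext => n; exact: addrC. Qed.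
Let add0 : left_id zero add.
Proof. by move=> x; apply: Zhat_ext => n; exact: add0r. Qed.
Let addN : left_inverse zero opp add.
Proof. by move=> x; apply: Zhat_ext => n; exact: addNr. Qed.
Let mulA : associative mul.
Proof. by move=> x y z; apply: Zhat_ext => n; exact: mulrA. Qed.
Let mulC : commutative mul.
Proof. by move=> x y; apply: Zhat_ext => n; exact: mulrC. Qed.
Let mul1 : left_id one mul.
Proof. by move=> x; apply: Zhat_ext => n; exact: mul1r. Qed.
Let mulD : left_distributive mul add.
Proof. by move=> x y z; apply: Zhat_ext => n; exact: mulrDl. Qed.
Let one_neq0 : one != zero.
Proof. by apply/eqP => /(congr1 (fun x => Zhat_proj x 0)). Qed.

HB.instance Definition _ := GRing.isZmodule.Build Zhat addA addC add0 addN.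
HB.instance Definition _ :=
  GRing.Zmodule_isComNzRing.Build Zhat mulA mulC mul1 mulD one_neq0.

End ZhatRing.

(** * Actions of GL_2^+(Q) *)

(* Rational 2 x 2 matrices with the discrete topology. *)
Notation M2Q := (discrete_topology 'M[rat]_2).

Definition GL2p : set M2Q := [set g : 'M[rat]_2 | 0 < \det g].

Definition Gamma1 : set M2Q :=
  [set g : 'M[rat]_2 | exists2 G : 'M[int]_2, \det G = 1 & g = map_mx intr G].

(* [mulQZ g rho tau] says that the product of g and rho, computed in matrices
   over the finite adeles (the localization of Zhat at the positive integers),
   is the integral matrix tau: after clearing a denominator n of g,
   (n g) rho = n tau. As Zhat is torsion-free, tau is unique. *)
Definition mulQZ (g : M2Q) (rho tau : 'M[Zhat]_2) : Prop :=
  exists (n : nat) (G : 'M[int]_2),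
    [/\ (0 < n)%N, n%:R *: (g : 'M[rat]_2) = map_mx intr G
      & map_mx intr G *m rho = n%:R *: tau].

Definition integral_at (rho : 'M[Zhat]_2) (g : M2Q) : Prop :=
  exists tau, mulQZ g rho tau.

(* The product of g and rho; meaningful when [integral_at rho g]. *)
Definition actZ (g : M2Q) (rho : 'M[Zhat]_2) : 'M[Zhat]_2 :=
  xget 0 [set tau | mulQZ g rho tau].

(** * Complex numbers, l^2 spaces and operators *)

Section Complex.
Variable R : realType.
Local Notation C := R[i].

Definition expi (x : R) : C := cos x +i* sin x.

Definition uhp : set C := [set z | 0 < complex.Im z].

Definition mobius (g : M2Q) (z : C) : C :=
  let a i j : C := ratr ((g : 'M[rat]_2) i j) in
  (a 0 0 * z + a 0 1) / (a 1 0 * z + a 1 1).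

Section l2.
Variable T : choiceType.
Implicit Types xi eta : T -> C.

Definition l2norm xi : \bar R :=
  ((\esum_(x in [set: T]) ((complex.Re `|xi x|) ^+ 2)%:E) `^ 2^-1)%E.

Definition l2 : set (T -> C) := [set xi | (l2norm xi < +oo)%E].

(* Sums of absolutely summable families. *)
Definition rsum (u : T -> R) : R :=
  fine (\esum_(x in [set: T]) (EFin \o u)^\+ x -
        \esum_(x in [set: T]) (EFin \o u)^\- x)%E.

Definition csum (u : T -> C) : C :=
  rsum (fun x => complex.Re (u x)) +i* rsum (fun x => complex.Im (u x)).

Definition l2dot xi eta : C := csum (fun x => xi x * (eta x)^*).

(* Operators on l^2(T) are represented by maps on all functions; only their
   restriction to [l2] is meaningful. *)
Definition op := (T -> C) -> (T -> C).

Definition bounded_op (B : op) : Prop :=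
  [/\ forall xi, l2 xi -> l2 (B xi),
      forall xi eta, l2 xi -> l2 eta ->
        B (fun x => xi x + eta x) = (fun x => B xi x + B eta x),
      forall (c : C) xi, l2 xi -> B (fun x => c * xi x) = (fun x => c * B xi x)
    & exists M : R, forall xi, l2 xi -> (l2norm (B xi) <= M%:E * l2norm xi)%E].

Definition opnorm (B : op) : \bar R :=
  ereal_sup [set l2norm (B xi) | xi in [set xi | (l2norm xi <= 1)%E]].

Definition delta (v : T) : T -> C := fun x => (x == v)%:R.

(* The unitary exp(itD) for a self-adjoint operator D that is diagonal in the
   basis [delta v], with (real) eigenvalues (D (delta v)) v. *)
Definition exp_it (D : op) (t : R) : op :=
  fun xi v => expi (t * complex.Re (D (delta v) v)) * xi v.

End l2.

(** * C*-algebras and representations *)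

(* C*-algebras, not necessarily unital. *)
Record cstarAlg := CstarAlg {
  cstar_sort :> completeNormedModType C ;
  cmul : cstar_sort -> cstar_sort -> cstar_sort ;
  cstar : cstar_sort -> cstar_sort ;
  cmulA : forall a b c, cmul a (cmul b c) = cmul (cmul a b) c ;
  cmulDl : forall a b c, cmul (a + b) c = cmul a c + cmul b c ;
  cmulDr : forall a b c, cmul a (b + c) = cmul a b + cmul a c ;
  cmulZl : forall (k : C) a b, cmul (k *: a) b = k *: cmul a b ;
  cmulZr : forall (k : C) a b, cmul a (k *: b) = k *: cmul a b ;
  cnormM : forall a b, `|cmul a b| <= `|a| * `|b| ;
  cstarK : forall a, cstar (cstar a) = a ;
  cstarD : forall a b, cstar (a + b) = cstar a + cstar b ;
  cstarZ : forall (k : C) a, cstar (k *: a) = k^* *: cstar a ;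
  cstarM : forall a b, cstar (cmul a b) = cmul (cstar b) (cstar a) ;
  cstar_norm : forall a, `|cmul (cstar a) a| = `|a| ^+ 2
}.

Record star_automorphism (A : cstarAlg) (s : A -> A) : Prop := {
  aut_bij : bijective s ;
  autD : forall a b, s (a + b) = s a + s b ;
  autZ : forall (k : C) a, s (k *: a) = k *: s a ;
  autM : forall a b, s (cmul a b) = cmul (s a) (s b) ;
  aut_star : forall a, s (cstar a) = cstar (s a) ;
  aut_norm : forall a, `|s a| = `|a|
}.

Record star_representation (A : cstarAlg) (T : choiceType) (pi : A -> op T) :
    Prop := {
  repr_bounded : forall a, bounded_op (pi a) ;
  reprD : forall a b xi, l2 xi -> pi (a + b) xi = (fun x => pi a xi x + pi b xi x) ;
  reprZ : forall (k : C) a xi, l2 xi -> pi (k *: a) xi = (fun x => k * pi a xi x) ;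
  reprM : forall a b xi, l2 xi -> pi (cmul a b) xi = pi a (pi b xi) ;
  repr_star : forall a xi eta, l2 xi -> l2 eta ->
    l2dot (pi a xi) eta = l2dot xi (pi (cstar a) eta)
}.

(** * Lattices *)

Record is_lattice (L : set C) : Prop := {
  lattice0 : L 0 ;
  latticeB : forall x y, L x -> L y -> L (x - y) ;
  lattice_discrete : forall x, L x -> exists2 U, nbhs x U & U `&` L = [set x] ;
  lattice_cocompact : exists2 K : set C, compact K &
    forall z, exists x y, [/\ L x, K y & z = x + y]
}.

Definition scale (k : C) (L : set C) : set C := [set k * x | x in L].

Definition coset (L : set C) (x : C) : set C := [set x + y | y in L].

Definition cosets (L M : set C) : set (set C) := [set coset M x | x in L].

Definition has_index (L M : set C) (N : nat) : Prop :=
  M `<=` L /\ cosets L M #= `I_N.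

Definition commensurable (L L' : set C) : Prop :=
  finite_set (cosets L (L `&` L')) /\ finite_set (cosets L' (L `&` L')).

Definition proj_class (L : set C) : set (set C) :=
  [set L' | exists2 q : rat, q != 0 & L' = scale (ratr q) L].

Definition PL (L1 : set C) : set (set (set C)) :=
  [set proj_class L | L in [set L | is_lattice L /\ commensurable L1 L]].

Definition hyperdist_cand (L L' : set C) : set nat :=
  [set N | (0 < N)%N /\ exists q q' : rat,
     [/\ q != 0, q' != 0, has_index L (scale (ratr q') L') N
       & has_index L' (scale (ratr q) L) N]].

Definition hyperdist (L L' : set C) : nat :=
  xget 0%N [set N | hyperdist_cand L L' N /\
                    forall M, hyperdist_cand L L' M -> (N <= M)%N].

(* The hyperdistance only depends on the projective classes; it is computed
   on chosen representatives. *)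
Definition dist1 (c c' : set (set C)) : R :=
  ln (hyperdist (xget set0 c) (xget set0 c'))%:R.

Definition ham (L1 : set C) : op (set_type (PL L1)) :=
  fun xi nu => (dist1 (proj_class L1) (set_val nu))%:C * xi nu.
Arguments ham : clear implicits.

(** * Q-lattices *)

Definition Qspan (L : set C) : set C :=
  [set z | exists (q : rat) (x : C), L x /\ z = ratr q * x].

Definition Z2 : set 'cV[rat]_2 := [set map_mx intr a | a in [set: 'cV[int]_2]].

(* A homomorphism Q^2/Z^2 -> QL/L is represented by a map defined on Q^2,
   trivial on Z^2, whose values are the elements of QL/L, i.e. cosets of L. *)
Record is_Qlattice (L : set C) (phi : 'cV[rat]_2 -> set C) : Prop := {
  Qlattice_lattice : is_lattice L ;
  Qlattice_val : forall x, cosets (Qspan L) L (phi x) ;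
  Qlattice_hom : forall x y,
    phi (x + y) = [set z | exists u v, [/\ phi x u, phi y v & z = u + v]] ;
  Qlattice_Z2 : forall x, Z2 x -> phi x = L
}.

Definition invertible_Qlattice (L : set C) (phi : 'cV[rat]_2 -> set C) : Prop :=
  [/\ is_Qlattice L phi,
      forall x y, phi x = phi y -> Z2 (x - y)
    & forall c, cosets (Qspan L) L c -> exists x, phi x = c].

(* The identification of M_2(Zhat) with End(Q^2/Z^2): [endQZ rho x x'] says
   that rho maps the class of x to the class of x'. If x = a/n with a integral
   then x' = a'/n with rho a congruent to a' modulo n. *)
Definition endQZ (rho : 'M[Zhat]_2) (x x' : 'cV[rat]_2) : Prop :=
  exists (n : nat) (a a' : 'cV[int]_2) (tau : 'cV[Zhat]_2),
    [/\ (0 < n)%N, n%:R *: x = map_mx intr a, n%:R *: x' = map_mx intr a'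
      & rho *m map_mx intr a = map_mx intr a' + n%:R *: tau].

Definition std_lattice (z : C) : set C :=
  [set w | exists m n : int, w = m%:~R + n%:~R * z].

(* (L, phi) is represented up to the scale k by (rho, z). *)
Definition represents (rho : 'M[Zhat]_2) (z : C)
    (L : set C) (phi : 'cV[rat]_2 -> set C) : Prop :=
  exists2 k : C, k != 0 &
    L = scale k (std_lattice z) /\
    forall x x', endQZ rho x x' ->
      phi x = scale k (coset (std_lattice z)
                        (ratr (x' 0 0) - z * ratr (x' 1 0))).

(** * The GL_2-system *)

Notation ambient := (M2Q * 'M[Zhat]_2 * C)%type.

Definition Y : set ambient :=
  [set p | let: (g, rho, z) := p in [/\ GL2p g, integral_at rho g & uhp z]].

Definition gl2_fun := M2Q -> 'M[Zhat]_2 -> C -> C.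

(* Functions on Y are extended by zero. *)
Record Ac (f : gl2_fun) : Prop := {
  Ac_off : forall g rho z, ~ Y (g, rho, z) -> f g rho z = 0 ;
  Ac_continuous :
    {within Y, continuous (fun p : ambient => f p.1.1 p.1.2 p.2)} ;
  Ac_left : forall gamma g rho z, Gamma1 gamma -> Y (g, rho, z) ->
    f (gamma *m g) rho z = f g rho z ;
  Ac_right : forall gamma g rho z,
    Gamma1 gamma -> Y (g, actZ gamma rho, mobius gamma z) ->
    f (g *m gamma) rho z = f g (actZ gamma rho) (mobius gamma z) ;
  Ac_support : exists K : set ambient, [/\ compact K, K `<=` Y &
    forall g rho z, f g rho z != 0 ->
      exists gam1 gam2 k rho0 z0,
        [/\ Gamma1 gam1, Gamma1 gam2, K (k, rho0, z0) &
            (g, rho, z) = (gam1 *m k *m invmx gam2 : M2Q,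
                           actZ gam2 rho0, mobius gam2 z0)]]
}.

Definition Ac_add (f1 f2 : gl2_fun) : gl2_fun :=
  fun g rho z => f1 g rho z + f2 g rho z.

Definition Ac_scale (k : C) (f : gl2_fun) : gl2_fun :=
  fun g rho z => k * f g rho z.

Definition Gcoset (g : M2Q) : set M2Q := 
  [set (gamma *m g : M2Q) | gamma in Gamma1].

(* Gamma1\Y_y for y = (rho, z); it does not depend on z. *)
Definition Yquot (rho : 'M[Zhat]_2) : set (set M2Q) :=
  [set Gcoset g | g in [set g | GL2p g /\ integral_at rho g]].

Definition Grepr (c : set M2Q) : M2Q := xget (1%:M : 'M[rat]_2) c.

(* The summands are invariant, hence evaluated on representatives, and only
   finitely many of them are nonzero when f1 and f2 are in Ac. *)
Definition Ac_mul (f1 f2 : gl2_fun) : gl2_fun :=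
  fun g rho z => \sum_(c \in Yquot rho)
    let s := Grepr c in
    f1 (g *m invmx s) (actZ s rho) (mobius s z) * f2 s rho z.

Definition Ac_star (f : gl2_fun) : gl2_fun :=
  fun g rho z =>
    if `[< Y (g, rho, z) >]
    then (f (invmx g) (actZ g rho) (mobius g z))^* else 0.

Definition Ac_evol (t : R) (f : gl2_fun) : gl2_fun :=
  fun g rho z => expi (t * ln (ratr (\det (g : 'M[rat]_2)))) * f g rho z.

Definition pi_y (rho : 'M[Zhat]_2) (z : C) (f : gl2_fun) :
    op (set_type (Yquot rho)) :=
  fun xi c => \sum_(d \in [set: set_type (Yquot rho)])
    let g := Grepr (set_val c) in
    let h := Grepr (set_val d) in
    f (g *m invmx h) (actZ h rho) (mobius h z) * xi d.

Arguments pi_y : clear implicits.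

Definition Ac_norm (f : gl2_fun) : \bar R :=
  ereal_sup [set opnorm (pi_y y.1 y.2 f)
            | y in [set y : 'M[Zhat]_2 * C | uhp y.2]].

(* (A, iota) is the C*-algebra completion of Ac. *)
Record is_completion (A : cstarAlg) (iota : gl2_fun -> A) : Prop := {
  iotaD : forall f1 f2, Ac f1 -> Ac f2 ->
    iota (Ac_add f1 f2) = iota f1 + iota f2 ;
  iotaZ : forall k f, Ac f -> iota (Ac_scale k f) = k *: iota f ;
  iotaM : forall f1 f2, Ac f1 -> Ac f2 ->
    iota (Ac_mul f1 f2) = cmul (iota f1) (iota f2) ;
  iota_star : forall f, Ac f -> iota (Ac_star f) = cstar (iota f) ;
  iota_norm : forall f, Ac f -> (complex.Re `|iota f|)%:E = Ac_norm f ;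
  iota_dense : closure [set iota f | f in Ac] = [set: A]
}.

Record is_time_evolution (A : cstarAlg) (iota : gl2_fun -> A)
    (sigma : R -> A -> A) : Prop := {
  evol_aut : forall t, star_automorphism (sigma t) ;
  evol0 : forall a, sigma 0 a = a ;
  evolD : forall s t a, sigma (s + t) a = sigma s (sigma t a) ;
  evol_continuous : forall a, continuous (sigma^~ a) ;
  evol_iota : forall t f, Ac f -> sigma t (iota f) = iota (Ac_evol t f)
}.

Definition is_GL2_system (A : cstarAlg) (iota : gl2_fun -> A)
    (sigma : R -> A -> A) : Prop :=
  is_completion iota /\ is_time_evolution iota sigma.

End Complex.

Arguments ham {R} L1 _ _.
Arguments pi_y {R} rho z f _ _.

(* Main.v *)
(* The representation is pi_y at y = (1, z1), carried by l^2(Gamma1\M2(Z)+),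
   extended by zero to l^2(V) along an injection j of Gamma1\M2(Z)+ into V.
   Since pi_y(f) has entries f(g h^-1, h rho, h z), the evolution multiplies them
   by (det g / det h)^(it), so H implements it as soon as
   d1(nu1, j(Gamma1 g)) = log (det g) up to an additive constant, which cancels
   in the conjugation.  The naive choice of j, sending g to the class of the
   lattice Lambda1 g, is not injective on non-primitive g.  Instead one counts:
   cosets of determinant n correspond to Hermite normal forms (a, b, d) with
   a d = n, and points of V at hyperdistance n from nu1 to those with
   gcd(a, b, d) = 1.  The number psi(n) of the latter satisfies
   m psi(n) <= psi(m n), and sorting all forms by their gcd m gives
   sum_{m^2 | n} psi(n / m^2) <= sum_m psi(2 n) / (2 m^2) <= psi(2 n),
   so that the forms of determinant n inject into the points at hyperdistance 2n.
   The extension from A_c to A is by density, as pi_y is bounded by the norm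
   of A.  It is not zero, because A_c contains a function supported on
   Gamma1 x M2(Zhat) x {z of bounded height} that does not vanish at (1, 1, z1). *)
Require Import Defs.
From mathcomp Require Import all_boot all_order all_algebra.
From mathcomp Require Import complex finmap.
From mathcomp Require Import all_classical all_reals all_analysis.
From mathcomp Require Import ring lra zify.

Set Implicit Arguments.
Unset Strict Implicit.
Unset Printing Implicit Defensive.
Import Order.TTheory GRing.Theory Num.Theory.
Import numFieldNormedType.Exports.
Local Open Scope classical_set_scope.
Local Open Scope ring_scope.

(** * Profinite integers *)

(** At rho = 1 integrality is elementary: g is integral there exactly when its entries are integers,
    so that cosets are indexed by Hermite normal forms. The factor 2 in the hyperdistance 2 n pays
    for a deficit in the count: there are sigma(n) forms of determinant n, but only psi(n) primitive
    ones (the Dedekind function), and sigma(n) > psi(n) as soon as n has a square factor. Doubling n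
    gains a factor of at least 2, which matches the bound 2 on the sum of inverse squares. The
    inequality m psi(n) <= psi(m n) is geometric: in the tree of p, at least p of the p + 1
    neighbours of a vertex lie further from the origin. The norm of A is tied to the pi_y only on
    A_c. Identities in A are reached by approximation from A_c, and for this A_c must be closed
    under its operations, compact support modulo Gamma1 x Gamma1 included. The finiteness there has
    one source: rational matrices of bounded denominator and determinant fall into finitely many
    cosets. It also makes the rows and columns of pi_y(f) finite, which matters because a sum with
    infinite support is 0 by convention. *)

Lemma Zhat_projM (x y : Zhat) n : Zhat_proj (x * y) n = Zhat_proj x n * Zhat_proj y n.
Proof. by []. Qed.
Lemma Zhat_projD (x y : Zhat) n : Zhat_proj (x + y) n = Zhat_proj x n + Zhat_proj y n.
Proof. by []. Qed.
Lemma Zhat_proj0 n : Zhat_proj 0 n = 0. Proof. by []. Qed.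
Lemma Zhat_projN (x : Zhat) n : Zhat_proj (- x) n = - Zhat_proj x n. Proof. by []. Qed.
Lemma Zhat_proj_nat k n : Zhat_proj k%:R n = k%:R.
Proof. by elim: k => // k IH; rewrite mulrSr Zhat_projD IH [RHS]mulrSr. Qed.
Arguments Zhat_proj : simpl never.

(* The component of x modulo N; only meaningful for N > 1. *)
Definition zproj (N : nat) (x : Zhat) : nat := Zhat_proj x N.-2.

Lemma zprojE N (x : Zhat) : (1 < N)%N -> (zproj N x < N)%N.
Proof. by case: N => [|[|N]] // _; rewrite /zproj/= ltn_ord. Qed.

Lemma zproj_dvd M N x : (1 < M)%N -> (0 < N)%N -> (M %| N)%N -> (zproj N x %% M)%N = zproj M x.
Proof.
case: M => [|[|M]] // _; case: N => [|[|N]] //.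
move=> _ MN; rewrite /zproj/=.
by rewrite -[in RHS](Zhat_projP x MN) val_Zp_nat.
Qed.

Lemma zproj_ext x y : (forall N, (1 < N)%N -> zproj N x = zproj N y) -> x = y.
Proof.
move=> xy; apply: Zhat_ext => n; apply: val_inj.
exact: (xy n.+2).
Qed.

Lemma zproj_natM n N x : (1 < N)%N -> zproj N (n%:R * x) = ((n * zproj N x) %% N)%N.
Proof.
case: N => [|[|N]] // _; rewrite /zproj/= Zhat_proj_nat.
by rewrite val_Zp_nat// modnMml.
Qed.

(** If n x vanishes modulo n N, then n cancels and x vanishes modulo N. *)
Lemma Zhat_torsion_free n (x : Zhat) : (0 < n)%N -> n%:R * x = 0 -> x = 0.
Proof.
move=> n0 nx0; apply: zproj_ext => N N1.
have nN : (1 < n * N)%N by rewrite (leq_trans N1)// leq_pmull.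
have := zproj_natM n x nN; rewrite nx0 {1}/zproj Zhat_proj0/= => /esym/eqP.
rewrite -[_ == 0]/(_ %| _)%N dvdn_pmul2l// => NP.
rewrite -(@zproj_dvd N (n * N)) ?dvdn_mull//; last by rewrite (leq_trans _ nN).
by move/eqP: NP => ->; rewrite /zproj Zhat_proj0.
Qed.

Lemma Zhat_natI n : (0 < n)%N -> injective (fun x : Zhat => n%:R * x).
Proof.
move=> n0 x y /eqP; rewrite -subr_eq0 -mulrBr => /eqP /(Zhat_torsion_free n0) /eqP.
by rewrite subr_eq0 => /eqP.
Qed.

(* Uses the component modulo 2n, since the component modulo n does not exist for n = 1. *)
Definition zdvd n (x : Zhat) : bool := (n %| zproj (n * 2) x)%N.

Lemma zdvd_natM n x : (0 < n)%N -> zdvd n (n%:R * x).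
Proof.
move=> n0; rewrite /zdvd zproj_natM; last by lia.
by rewrite -muln_modr dvdn_mulr.
Qed.

Lemma zdvd_zproj n x m : (0 < n)%N -> (0 < m)%N -> (1 < n * m)%N -> zdvd n x ->
  (n %| zproj (n * m) x)%N.
Proof.
move=> n0 m0 m1; rewrite /zdvd => nx.
have l1 : (0 < n * m * 2)%N by lia.
have e1 := @zproj_dvd (n * m) (n * m * 2) x m1 l1 (dvdn_mulr _ (dvdnn _)).
have e2 : (zproj (n * m * 2) x %% (n * 2) = zproj (n * 2) x)%N.
  by apply: zproj_dvd => //; [lia|rewrite mulnAC dvdn_mulr].
move: nx; rewrite -e2 -e1 /dvdn !modn_dvdm//.
  by rewrite dvdn_mulr.
by rewrite dvdn_mulr.
Qed.

(** The quotient is assembled componentwise: modulo m it is the component of x modulo n m, an exact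
    multiple of n, divided by n. *)
Lemma zdvdP n x : (0 < n)%N -> zdvd n x -> exists y, x = n%:R * y.
Proof.
move=> n0 nx.
pose q m := (zproj (n * m) x %/ n)%N.
have qn m : (0 < m)%N -> (1 < n * m)%N -> (q m * n)%N = zproj (n * m) x.
  by move=> m0 m1; rewrite /q divnK// zdvd_zproj.
have q_lt m : (1 < m)%N -> (q m < m)%N.
  move=> m1; rewrite /q ltn_divLR// [leqRHS]mulnC zprojE//; nia.
have hq : Zhat_compat (fun m => (q m.+2)%:R : 'Z_m.+2).
  move=> m N mN; rewrite [X in (X : nat)%:R]val_Zp_nat//= natr_Zp_mod//.
  apply: val_inj; rewrite /= !val_Zp_nat//.
  rewrite [RHS]modn_small ?q_lt//; apply/eqP.
  rewrite -(eqn_pmul2r n0) muln_modl qn//; last by nia.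
  rewrite qn//; last by nia.
  by rewrite [(m.+2 * n)%N]mulnC zproj_dvd ?dvdn_pmul2l//; nia.
exists (mkZhat hq); apply: zproj_ext => N N1.
rewrite zproj_natM//.
have -> : zproj N (mkZhat hq) = q N.
  case: N N1 => [|[|N]] // N1; rewrite {1}/zproj/= /Zhat_proj/=.
  by rewrite val_Zp_nat// modn_small// q_lt.
rewrite mulnC qn//; [|lia|nia].
by rewrite zproj_dvd//; [nia|rewrite dvdn_mull].
Qed.

(** It suffices to treat the remainder r < n of k, whose component modulo 2 n is r itself. *)
Lemma Zhat_int_dvd n (k : int) (y : Zhat) : (0 < n)%N -> k%:~R = n%:R * y -> (n%:Z %| k)%Z.
Proof.
move=> n0 ky.
have [r rE] : exists r : nat, (k %% n)%Z = r by exists `|(k %% n)%Z|%N; rewrite gez0_abs// modz_ge0// -lt0n.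
have rn : (r < n)%N by rewrite -ltz_nat -rE ltz_pmod.
have {}ky : r%:R = n%:R * (y - ((k %/ n)%Z)%:~R).
  by rewrite mulrBr -ky {1}(divz_eq k n) rE intrD intrM /= [_ * n%:~R]mulrC addrC addKr.
have := zdvd_natM (y - ((k %/ n)%Z)%:~R) n0; rewrite -ky /zdvd.
rewrite -[r%:R]mulr1 zproj_natM; last by lia.
have -> : zproj (n * 2) 1 = (1 %% (n * 2))%N.
  rewrite /zproj; have -> : (n * 2 = (n * 2).-2.+2)%N by lia.
  by [].
rewrite modnMmr muln1 modn_small; last by lia.
move=> nr; apply/dvdzP; exists (k %/ n)%Z; rewrite [LHS](divz_eq k n) rE.
by move: nr; rewrite /dvdn modn_small// => /eqP ->; rewrite addr0.
Qed.

(** * Topology of Zhat and compactness of M2(Zhat) *)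

Definition zball N (x : Zhat) : set Zhat := [set y | zproj N y = zproj N x].

Lemma zball_sub M N x : (1 < M)%N -> (0 < N)%N -> (M %| N)%N -> zball N x `<=` zball M x.
Proof. by move=> M1 N0 MN y; rewrite /zball/= -!(zproj_dvd _ M1 N0 MN) => ->. Qed.

Lemma Zhat_projE (x : Zhat) i : Zhat_proj x i = (set_val x : Zhat_fam) i.
Proof. by []. Qed.

Lemma Zhat_cvg (F : set_system Zhat) (x : Zhat) : Filter F ->
  (forall N, (1 < N)%N -> F (zball N x)) -> F --> x.
Proof.
move=> FF hF A [_ [/= [V oV <-] Vx VA]].
have nV : nbhs (set_val x) V by apply: open_nbhs_nbhs.
have : set_val @ F --> (set_val x : Zhat_fam).
  apply/cvg_sup => i U [_ [[W oW <-] Wx WU]].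
  suff : F (set_val @^-1` U) by [].
  apply: filterS (hF i.+2 isT) => y /ord_inj.
  by rewrite /= !Zhat_projE => yx; apply: WU => /=; rewrite yx.
by move=> /(_ _ nV) h; have {}h : F (set_val @^-1` V) := h; apply: filterS h.
Qed.

Lemma zball_nbhs N (x : Zhat) : (1 < N)%N -> nbhs x (zball N x).
Proof.
case: N => [|[|N]] // _.
have := @proj_continuous _ _ N (set_val x : Zhat_fam) [set proj N (set_val x)] (discrete_set1 _).
move=> /(@initial_continuous _ _ (set_val : Zhat -> Zhat_fam) x).
move=> h; have {}h : nbhs x (set_val @^-1` (proj N @^-1` [set proj N (set_val x : Zhat_fam)])) := h.
by apply: filterS h => y /=; rewrite /zball/zproj/= !Zhat_projE => yx; congr nat_of_ord.
Qed.

Lemma zball_filter (x : Zhat) : Filter (filter_from [set N | (1 < N)%N] (fun N => zball N x)).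
Proof.
apply: filter_from_filter; first by exists 2.
move=> M N /= M1 N1; exists (M * N)%N => /=; first by lia.
have MN : (0 < M * N)%N by lia.
by move=> y xy; split; [have := dvdn_mulr N (dvdnn M)|have := dvdn_mull M (dvdnn N)] => h; apply: zball_sub xy.
Qed.

Lemma zball_base (x : Zhat) (U : set Zhat) : nbhs x U -> exists2 N, (1 < N)%N & zball N x `<=` U.
Proof.
move=> xU; have [] := @Zhat_cvg _ x (zball_filter x) _ U xU; last by move=> N; exists N.
by move=> N N1; exists N.
Qed.

Definition mxball N (r : 'M[Zhat]_2) : set 'M[Zhat]_2 :=
  [set s | forall i j, zproj N (s i j) = zproj N (r i j)].

Lemma mxball_nbhs N (r : 'M[Zhat]_2) : (1 < N)%N -> nbhs r (mxball N r).
Proof.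
by move=> N1; exists (fun i j => zball N (r i j)) => // i j; exact: zball_nbhs.
Qed.

Lemma mxball_base (r : 'M[Zhat]_2) (U : set 'M[Zhat]_2) :
  nbhs r U -> exists2 N, (1 < N)%N & mxball N r `<=` U.
Proof.
move=> [P hP PU].
have /choice[N hN] i : exists N : 'I_2 -> nat, forall j, (1 < N j)%N /\ zball (N j) (r i j) `<=` P i j.
  have /choice[N hN] : forall j, exists n, (1 < n)%N /\ zball n (r i j) `<=` P i j.
    by move=> j; have [n] := zball_base (hP i j); exists n.
  by exists N.
pose M := (2 * \prod_i \prod_j N i j)%N.
have M0 : (0 < \prod_i \prod_j N i j)%N.
  by apply/prodn_gt0 => i; apply/prodn_gt0 => j; have [] := hN i j; lia.
exists M; first by rewrite /M; lia.
move=> s rs; apply: PU => i j; have [N1 NP] := hN i j; apply: NP.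
apply: zball_sub (rs i j) => //; first by rewrite /M; lia.
by rewrite /M (bigD1 i)//= (bigD1 j)//= dvdn_mull// -mulnA dvdn_mulr.
Qed.

Lemma mxZ_cvg (F : set_system 'M[Zhat]_2) r : Filter F ->
  (forall N, (1 < N)%N -> F (mxball N r)) -> F --> r.
Proof. by move=> FF hF A /mxball_base[N N1 NA]; apply: filterS NA (hF N N1). Qed.

Lemma ultra_fin (T : Type) (F : set_system T) (g : T -> nat) N : UltraFilter F ->
  F [set x | g x < N]%N -> exists m, F [set x | g x = m].
Proof.
move=> FU; elim: N => [|N IH] hg.
  by have [t] := @filter_ex _ F _ _ hg.
have [FN|FN] := in_ultra_setVsetC [set x | g x = N] FU; first by exists N.
apply: IH; apply: filterS (filterI hg FN) => x /= []; lia.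
Qed.

(** Along an ultrafilter each entry takes one value modulo each n + 2 ([ultra_fin]). Any two of
    these conditions hold at a common matrix, which makes the values compatible; the matrix they
    define is the limit. *)
Lemma compact_mxZ : compact [set: 'M[Zhat]_2].
Proof.
rewrite compact_ultra => F FU _.
have /choice[c hc] (u : 'I_2 * 'I_2 * nat) :
    exists m, F [set r : 'M[Zhat]_2 | zproj u.2.+2 (r u.1.1 u.1.2) = m].
  apply: (@ultra_fin _ _ _ u.2.+2).
  by apply: filterS filterT => r _ /=; apply: zprojE.
have cE (r : 'M[Zhat]_2) i j n : zproj n.+2 (r i j) = c (i, j, n) -> Zhat_proj (r i j) n = (c (i, j, n))%:R.
  by move=> <-; rewrite /zproj/= natr_Zp.
have hk i j : Zhat_compat (fun n => (c (i, j, n))%:R : 'Z_n.+2).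
  move=> m n mn /=.
  have [r [/= /cE <- /cE <-]] := filter_ex (filterI (hc (i, j, m)) (hc (i, j, n))).
  exact: Zhat_projP.
exists (\matrix_(i, j) mkZhat (hk i j)); split => //.
apply: mxZ_cvg => -[|[|N]] // _.
have : F [set r : 'M[Zhat]_2 | forall u : 'I_2 * 'I_2, zproj N.+2 (r u.1 u.2) = c (u, N)].
  by apply: filter_forall => -[i j]; exact: hc (i, j, N).
apply: filterS => r hr i j; have /= hr' := hr (i, j).
rewrite mxE /zproj /=; congr (nat_of_ord _).
by rewrite (cE r).
Qed.

(** * Products of rational and profinite matrices *)

Lemma common_denom (g : 'M[rat]_2) :
  exists (n : nat) (G : 'M[int]_2), (0 < n)%N /\ n%:R *: g = map_mx intr G.
Proof.
pose d i j := `|denq (g i j)|%N.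
pose n := (\prod_i \prod_j d i j)%N.
have n0 : (0 < n)%N by do 2! (apply/prodn_gt0 => ?); rewrite absz_gt0 denq_neq0.
exists n.
have /choice[G hG] (u : 'I_2 * 'I_2) : exists k : int, n%:R * g u.1 u.2 = k%:~R.
  case: u => i j /=.
  have /dvdnP[q ->] : (d i j %| n)%N by rewrite /n (bigD1 i)//= (bigD1 j)//= -mulnA dvdn_mulr.
  exists (q%:Z * numq (g i j)); rewrite natrM -mulrA intrM; congr (_ * _).
  by rewrite numqE mulrC /d -[in RHS]absz_denq.
exists (\matrix_(i, j) G (i, j)); split => //.
by apply/matrixP => i j; rewrite !mxE (hG (i, j)).
Qed.

Lemma scaler_nat_int n (G : 'M[int]_2) : n%:R *: (map_mx intr G : 'M[rat]_2) = map_mx intr (n%:R *: G).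
Proof. by apply/matrixP => i j; rewrite !mxE intrM rmorph_nat. Qed.

Lemma map_intr_inj : injective (@map_mx int rat intr 2 2).
Proof.
move=> A B /matrixP AB; apply/matrixP => i j; have := AB i j; rewrite !mxE => /eqP.
by rewrite eqr_int => /eqP.
Qed.

Local Notation mxZ := (map_mx (intr : int -> Zhat)).

Lemma mxZ_scale n (G : 'M[int]_2) : mxZ (n%:R *: G) = n%:R *: mxZ G.
Proof. by apply/matrixP => i j; rewrite !mxE intrM rmorph_nat. Qed.

Lemma mxZ_torsion n (x y : 'M[Zhat]_2) : (0 < n)%N -> n%:R *: x = n%:R *: y -> x = y.
Proof.
move=> n0 /matrixP xy; apply/matrixP => i j; have := xy i j; rewrite !mxE.
exact: Zhat_natI.
Qed.

Lemma mulQZ_uniq g r t t' : mulQZ g r t -> mulQZ g r t' -> t = t'.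
Proof.
move=> [n [G [n0 nG Gt]]] [n' [G' [n0' nG' Gt']]].
have GG : n'%:R *: G = n%:R *: G'.
  apply: map_intr_inj; rewrite -!scaler_nat_int -nG -nG' !scalerA.
  by rewrite mulrC.
apply: (@mxZ_torsion (n' * n)); first by rewrite muln_gt0 n0 n0'.
rewrite natrM -scalerA -Gt mulrC -scalerA -Gt'.
by rewrite !scalemxAl -!mxZ_scale GG.
Qed.

Lemma actZP g r : integral_at r g -> mulQZ g r (actZ g r).
Proof. by move=> gt; have := @xgetPex _ 0 [set t | mulQZ g r t] gt. Qed.

Lemma actZE g r t : mulQZ g r t -> actZ g r = t.
Proof. by move=> gt; apply: mulQZ_uniq (gt); apply: actZP; exists t. Qed.

Lemma mulQZ_comp (h s : 'M[rat]_2) r t t' :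
  mulQZ h r t -> mulQZ s t t' -> mulQZ (s *m h) r t'.
Proof.
move=> [n [H [n0 nH Ht]]] [m [S [m0 mS St]]].
exists (m * n)%N, (S *m H); split.
- by rewrite muln_gt0 m0.
- by rewrite map_mxM -mS -nH -scalemxAl -scalemxAr scalerA natrM.
- by rewrite map_mxM -mulmxA Ht -scalemxAr St scalerA mulrC natrM.
Qed.

Lemma mulQZ_int (G : 'M[int]_2) r : mulQZ (map_mx intr G) r (mxZ G *m r).
Proof. by exists 1%N, G; rewrite !scale1r. Qed.

(** With denominators cleared, h and its inverse become integer matrices whose product is the scalar
    m n. *)
Lemma mulQZ_inv (h : 'M[rat]_2) r t : h \in unitmx -> mulQZ h r t -> mulQZ (invmx h) t r.
Proof.
move=> hU [n [H [n0 nH Ht]]].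
have [m [H' [m0 mH']]] := common_denom (invmx h).
exists m, H'; split => //.
have HH : H' *m H = (m * n)%:R *: 1%:M.
  apply: map_intr_inj; rewrite map_mxM -mH' -nH -scalemxAl -scalemxAr scalerA mulVmx//.
  by rewrite -scaler_nat_int map_mx1 natrM.
apply: (mxZ_torsion n0); rewrite scalemxAr -Ht mulmxA -map_mxM HH mxZ_scale map_mx1.
by rewrite -scalemxAl mul1mx scalerA mulrC natrM.
Qed.

Lemma mulQZ_div (h s : 'M[rat]_2) r t t' : h \in unitmx ->
  mulQZ h r t -> mulQZ (s *m h) r t' -> mulQZ s t t'.
Proof.
move=> hU /(mulQZ_inv hU) ht sht'.
by have := mulQZ_comp ht sht'; rewrite mulmxK.
Qed.

Lemma mulQZ1 r : mulQZ (1%:M : 'M[rat]_2) r r.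
Proof. by have := mulQZ_int 1%:M r; rewrite !map_mx1 mul1mx. Qed.

(** This is the continuity of rho -> s rho at finite level: if n is a denominator of s, changing r
    by a multiple of n N changes the product by a multiple of N. *)
Lemma mulQZ_near (s : 'M[rat]_2) N : (1 < N)%N -> exists2 M, (1 < M)%N &
  forall r r' t, mxball M r r' -> mulQZ s r t -> exists2 t', mulQZ s r' t' & mxball N t t'.
Proof.
move=> N1; have [n [S [n0 nS]]] := common_denom s.
(* [zdvd (n * N)] reads the component modulo twice n N, hence the extra 2. *)
exists (n * N * 2)%N; first by nia.
move=> r r' t rr' st.
have {}st : mxZ S *m r = n%:R *: t.
  have [m [S' [m0 mS' S't]]] := st.
  have SS : m%:R *: S = n%:R *: S'.
    apply: map_intr_inj; rewrite -!scaler_nat_int -nS -mS' !scalerA.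
    by rewrite mulrC.
  apply: (mxZ_torsion m0); rewrite scalemxAl -mxZ_scale SS mxZ_scale -scalemxAl S't.
  by rewrite !scalerA mulrC.
have /choice[k hk] (u : 'I_2 * 'I_2) : exists k, r' u.1 u.2 - r u.1 u.2 = (n * N)%:R * k.
  case: u => i j /=; apply: zdvdP; first by nia.
  have := rr' i j; move: (r' i j) (r i j) => x y xy.
  rewrite /zdvd.
  suff -> : zproj (n * N * 2) (x - y) = 0%N by rewrite dvdn0.
  have -> : (n * N * 2 = (n * N * 2).-2.+2)%N by nia.
  move: xy; rewrite /zproj => /ord_inj xy.
  by rewrite Zhat_projD Zhat_projN xy subrr.
pose K : 'M[Zhat]_2 := \matrix_(i, j) k (i, j).
have r'E : r' = r + (n * N)%:R *: K.
  by apply/matrixP => i j; rewrite !mxE -(hk (i, j)) addrC subrK.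
exists (t + N%:R *: (mxZ S *m K)).
  exists n, S; split => //; rewrite r'E mulmxDr st -scalemxAr scalerDr natrM scalerA.
  by [].
move=> i j; rewrite mxE [X in _ + X]mxE; move: (t i j) ((_ *m K) i j) => x y.
case: N N1 {rr' hk K r'E} => [|[|N]] // _.
rewrite /zproj -[N.+2.-2]/N Zhat_projD Zhat_projM Zhat_proj_nat.
rewrite -(@natr_Zp_mod N N N.+2 (dvdnn _)) modnn.
by rewrite mul0r addr0.
Qed.

(** The relation [mxball M] is symmetric, so one modulus serves both directions: integrality of s is
    an open and closed condition on rho. *)
Lemma integral_at_near (s : 'M[rat]_2) : exists2 M, (1 < M)%N &
  forall r r', mxball M r r' -> integral_at r s <-> integral_at r' s.
Proof.
have [M M1 hM] := @mulQZ_near s 2 isT; exists M => // r r' rr'.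
have r'r : mxball M r' r by move=> i j; rewrite rr'.
by split=> -[t st]; [have [t' ? _] := hM _ _ _ rr' st|have [t' ? _] := hM _ _ _ r'r st]; exists t'.
Qed.

(** * SL_2(Z) and Hermite normal forms *)

Lemma Gamma1_1 : Gamma1 (1%:M : 'M[rat]_2).
Proof. by exists 1%:M; rewrite ?det1// map_mx1. Qed.

Lemma Gamma1M (g h : 'M[rat]_2) : Gamma1 g -> Gamma1 h -> Gamma1 (g *m h).
Proof.
move=> [G dG ->] [H dH ->]; exists (G *m H); last by rewrite map_mxM.
by rewrite det_mulmx dG dH mulr1.
Qed.

Lemma Gamma1_det (g : 'M[rat]_2) : Gamma1 g -> \det g = 1.
Proof. by move=> [G dG ->]; rewrite det_map_mx dG. Qed.

Lemma Gamma1_unit (g : 'M[rat]_2) : Gamma1 g -> g \in unitmx.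
Proof. by move=> /Gamma1_det dg; rewrite unitmxE dg. Qed.

Lemma invmx_eq (g h : 'M[rat]_2) : h *m g = 1%:M -> invmx g = h.
Proof.
move=> hg; have [_ gU] := mulmx1_unit hg.
by rewrite -[LHS]mul1mx -hg mulmxK.
Qed.

Lemma Gamma1V (g : 'M[rat]_2) : Gamma1 g -> Gamma1 (invmx g).
Proof.
move=> [G dG ->]; exists (\adj G).
  have := mul_adj_mx G; rewrite dG => /(congr1 determinant).
  by rewrite det_mulmx dG mulr1 det1.
by apply: invmx_eq; rewrite -map_mxM mul_adj_mx dG map_mx1.
Qed.

Lemma GL2p_unit (g : 'M[rat]_2) : GL2p g -> g \in unitmx.
Proof. by rewrite /GL2p /= unitmxE unitfE => /lt0r_neq0. Qed.

Lemma GL2pM (g h : 'M[rat]_2) : GL2p g -> GL2p h -> GL2p (g *m h).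
Proof. by rewrite /GL2p /= det_mulmx; exact: mulr_gt0. Qed.

Lemma GL2pV (g : 'M[rat]_2) : GL2p g -> GL2p (invmx g).
Proof. by rewrite /GL2p /= det_inv invr_gt0. Qed.

Lemma Gamma1_GL2p (g : 'M[rat]_2) : Gamma1 g -> GL2p g.
Proof. by move=> /Gamma1_det; rewrite /GL2p /= => ->. Qed.

Lemma invmxM (g h : 'M[rat]_2) : g \in unitmx -> h \in unitmx ->
  invmx (g *m h) = invmx h *m invmx g.
Proof.
move=> gU hU; apply: invmx_eq.
by rewrite mulmxA -[_ *m invmx g *m g]mulmxA mulVmx// mulmx1 mulVmx.
Qed.

Definition mx2 (R : nzRingType) (a b c d : R) : 'M[R]_2 :=
  \matrix_(i, j) if i == 0 then (if j == 0 then a else b) else (if j == 0 then c else d).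

Lemma mx2E (R : nzRingType) (g : 'M[R]_2) : g = mx2 (g 0 0) (g 0 1) (g 1 0) (g 1 1).
Proof.
apply/matrixP => i j; rewrite mxE.
by case: i => -[|[|i]] hi //=; case: j => -[|[|j]] hj //=; congr (g _ _); apply: val_inj.
Qed.

Lemma mx2M (R : nzRingType) (a b c d a' b' c' d' : R) :
  mx2 a b c d *m mx2 a' b' c' d' =
  mx2 (a * a' + b * c') (a * b' + b * d') (c * a' + d * c') (c * b' + d * d').
Proof.
apply/matrixP => i j; rewrite !mxE !big_ord_recl big_ord0 addr0 !mxE /=.
by case: ifP => _; case: ifP => _.
Qed.

Lemma det_mx2 (R : comNzRingType) (a b c d : R) : \det (mx2 a b c d) = a * d - b * c.
Proof. by rewrite (expand_det_row _ 0) !big_ord_recl big_ord0 /cofactor !det_mx11 !mxE /= expr0 expr1 addr0 mul1r mulN1r mulrN. Qed.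

Lemma mx2_map (R S : nzRingType) (f : R -> S) a b c d : map_mx f (mx2 a b c d) = mx2 (f a) (f b) (f c) (f d).
Proof. by apply/matrixP => i j; rewrite !mxE; do 2! case: ifP => _. Qed.

(** Bezout on the first column clears its lower entry; subtracting a multiple of the second row then
    reduces b modulo d. *)
Lemma hnf_int (G : 'M[int]_2) : 0 < \det G ->
  exists (H : 'M[int]_2) (a b d : nat), [/\ \det H = 1, (b < d)%N &
    H *m G = mx2 a%:Z b%:Z 0 d%:Z].
Proof.
rewrite (mx2E G); move: (G 0 0) (G 0 1) (G 1 0) (G 1 1) => x y z w {G}.
rewrite det_mx2 => dG.
have [u [v uv]] := Bezoutz x z.
have e0 : (gcdz x z) != 0.
  by rewrite gcdz_eq0; apply/negP => /andP[/eqP x0 /eqP z0]; move: dG; rewrite x0 z0; lia.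
have [x' xE] : exists x', x = x' * gcdz x z by apply/dvdzP; rewrite dvdz_gcdl.
have [z' zE] : exists z', z = z' * gcdz x z by apply/dvdzP; rewrite dvdz_gcdr.
have ge0 : 0 <= gcdz x z by [].
move: (gcdz x z) uv e0 xE zE ge0 => e uv e0 xE zE ge0.
have uv1 : u * x' + v * z' = 1.
  by apply: (mulIf e0); rewrite mul1r -[RHS]uv xE zE mulrDl !mulrA.
(* The determinant is e d with e >= 0 the gcd of the first column, so its positivity makes d
   positive. *)
pose d := x' * w - z' * y.
have dgt : 0 < d.
  have : 0 < e * d.
    apply: lt_le_trans dG _; rewrite /d {1}xE {1}zE; lia.
  by rewrite pmulr_rgt0// lt_def e0.
pose b0 := u * y + v * w.
exists (mx2 1 (- (b0 %/ d)%Z) 0 1 *m mx2 u v (- z') x'), `|e|%N, `|(b0 %% d)%Z|%N, `|d|%N.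
split.
- rewrite det_mulmx !det_mx2; rewrite -[RHS]uv1; ring.
- by rewrite -ltz_nat !gez0_abs ?modz_ge0 ?(ltW dgt)// ?gt_eqF// ltz_pmod.
- rewrite !gez0_abs ?modz_ge0 ?(ltW dgt)// ?gt_eqF//.
  rewrite !mx2M /modz; congr mx2.
  + rewrite xE zE; transitivity (e * (u * x' + v * z')); last by rewrite uv1 mulr1.
    by ring.
  + by rewrite /d /b0; ring.
  + by rewrite xE zE; ring.
  + by rewrite /d; ring.
Qed.

Lemma Gcoset_id (g : 'M[rat]_2) : Gcoset g g.
Proof. by exists 1%:M; [exact: Gamma1_1|rewrite mul1mx]. Qed.

Lemma GcosetM (c g : 'M[rat]_2) : Gamma1 c -> Gcoset (c *m g) = Gcoset g.
Proof.
move=> cG; apply/seteqP; split => _ [k kG <-].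
  by exists (k *m c); [exact: Gamma1M|rewrite mulmxA].
exists (k *m invmx c); first by apply: Gamma1M => //; exact: Gamma1V.
by rewrite mulmxA -[k *m _ *m c]mulmxA mulVmx ?mulmx1//; exact: Gamma1_unit.
Qed.

Lemma GreprP (g : 'M[rat]_2) : exists2 c, Gamma1 c & Grepr (Gcoset g) = c *m g.
Proof.
have : Gcoset g (Grepr (Gcoset g)) by apply: (@xgetPex _ _ (Gcoset g)); exists g; exact: Gcoset_id.
by move=> [c cG <-]; exists c.
Qed.

Lemma hnf_rat D (g : 'M[rat]_2) G : (0 < D)%N -> GL2p g -> D%:R *: g = map_mx intr G ->
  exists (c : 'M[rat]_2) (a b d : nat), [/\ Gamma1 c, (b < d)%N,
    (a * d)%:R = D%:R ^+ 2 * \det g &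
    D%:R *: (c *m g) = mx2 a%:R b%:R 0 d%:R].
Proof.
move=> D0 gp DG.
have dG : 0 < \det G.
  have : 0 < \det (map_mx intr G : 'M[rat]_2).
    by rewrite -DG detZ mulr_gt0// exprn_gt0// ltr0n.
  by rewrite det_map_mx ltr0z.
have [H [a [b [d [dH bd HG]]]]] := hnf_int dG.
exists (map_mx intr H), a, b, d; split => //; first by exists H.
  rewrite -detZ DG det_map_mx -[\det G]mul1r -dH -det_mulmx HG det_mx2 mulr0 subr0.
  by rewrite -PoszM.
by rewrite scalemxAr DG -map_mxM HG mx2_map /= rmorph0.
Qed.

(** The normal form (a, b, d) of D g satisfies a d = D^2 det g <= D^2 q and b < d, which bounds all
    three entries. The finiteness of supports, rows and columns below rests on this. *)
Lemma finite_hecke D (q : rat) : (0 < D)%N ->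
  finite_set [set Gcoset g | g in [set g : M2Q | [/\ GL2p g, \det (g : 'M[rat]_2) <= q &
     exists G, D%:R *: (g : 'M[rat]_2) = map_mx intr G]]].
Proof.
move=> D0.
pose N := (Num.trunc (D%:R ^+ 2 * q)).+1.
pose T := ('I_N.+1 * 'I_N.+1 * 'I_N.+1)%type.
pose F (t : T) : set M2Q := Gcoset (D%:R^-1 *: mx2 (t.1.1 : nat)%:R (t.1.2 : nat)%:R 0 (t.2 : nat)%:R).
apply: (@sub_finite_set _ _ (F @` setT)); last by apply/finite_image/finite_finset.
move=> _ [g [gp gq [G DG]] <-].
have [c [a [b [d [cG bd ad cg]]]]] := hnf_rat D0 gp DG.
have ad0 : (0 < a * d)%N.
  by rewrite -(ltr_nat rat) ad mulr_gt0// exprn_gt0// ltr0n.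
have adN : (a * d < N)%N.
  rewrite -(ltr_nat rat) ad; apply: le_lt_trans (_ : D%:R ^+ 2 * q < _).
    by rewrite ler_wpM2l// exprn_ge0.
  by rewrite truncnS_gt.
have aN : (a < N.+1)%N by nia.
have dN : (d < N.+1)%N.
  have a0 : (0 < a)%N by move: ad0; rewrite muln_gt0 => /andP[].
  by rewrite ltnS; apply: (leq_trans (leq_pmull d a0)); exact: ltnW.
have bN : (b < N.+1)%N by lia.
exists (Ordinal aN, Ordinal bN, Ordinal dN) => //.
rewrite /F /= -cg scalerA mulVf ?scale1r ?GcosetM//.
by rewrite pnatr_eq0 -lt0n.
Qed.

(** * Counting Hermite normal forms *)

(* (a, b, d) stands for the matrix [[a, b], [0, d]]. *)
Definition hnf_seq (n : nat) : seq (nat * nat * nat) :=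
  [seq ((n %/ d)%N, b, d) | d <- divisors n, b <- iota 0 d].

Definition prim3 (t : nat * nat * nat) : bool := gcdn (gcdn t.1.1 t.1.2) t.2 == 1%N.

(** For n > 0 its length is the Dedekind function psi(n), the number of sublattices of index n with
    cyclic quotient. *)
Definition prim_seq (n : nat) := [seq t <- hnf_seq n | prim3 t].

Lemma mem_hnf_seq n a b d : (0 < n)%N ->
  ((a, b, d) \in hnf_seq n) = ((a * d == n) && (b < d))%N.
Proof.
move=> n0; apply/idP/idP.
  move=> /allpairsPdep[d' [b' [+ + [-> -> ->]]]].
  rewrite -dvdn_divisors// mem_iota add0n /= => dn bd.
  by rewrite divnK// eqxx.
move=> /andP[/eqP adn bd]; apply/allpairsPdep; exists d, b; split.
- by rewrite -dvdn_divisors// -adn dvdn_mull.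
- by rewrite mem_iota add0n.
- by rewrite -adn mulnK//; lia.
Qed.

Lemma mem_prim_seq n t : (0 < n)%N ->
  (t \in prim_seq n) = [&& (t.1.1 * t.2 == n)%N, (t.1.2 < t.2)%N & prim3 t].
Proof.
by case: t => [[a b] d] n0; rewrite mem_filter mem_hnf_seq//= andbC andbA.
Qed.

Lemma hnf_seq_uniq n : uniq (hnf_seq n).
Proof.
apply: allpairs_uniq_dep; first exact: divisors_uniq.
  by move=> *; exact: iota_uniq.
by move=> [x y] [x' y'] _ _ /= [_ -> ->].
Qed.

Lemma prim_seq_uniq n : uniq (prim_seq n).
Proof. exact/filter_uniq/hnf_seq_uniq. Qed.

Lemma prim3P a b d : reflect (forall q, prime q -> (q %| a)%N -> (q %| b)%N -> (q %| d)%N -> False)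
  (prim3 (a, b, d)).
Proof.
rewrite /prim3 /=; apply: (iffP eqP) => [g1 q qp qa qb qd|h].
  have : (q %| gcdn (gcdn a b) d)%N by rewrite !dvdn_gcd qa qb qd.
  by rewrite g1 dvdn1 => /eqP q1; move: qp; rewrite q1.
apply/eqP; apply: contraT => g1.
have := pdiv_prime; case E : (gcdn (gcdn a b) d) g1 => [|[|g]] // _ hp.
  (* A gcd of 0 has to be excluded before a prime divisor is taken: all three entries would vanish,
     and 2 would divide them. *)
  have := h 2 isT; move: E => /eqP; rewrite eqn0Ngt gcdn_gt0 gcdn_gt0 negb_or negb_or -!eqn0Ngt.
  by move=> /andP[/andP[/eqP-> /eqP->] /eqP->]; rewrite !dvdn0 => /(_ isT isT isT).
have {}hp := hp g.+2 isT.
have := pdiv_dvd g.+2; rewrite -E !dvdn_gcd => /andP[/andP[qa qb] qd].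
by case: (h _ hp); rewrite -E.
Qed.

Lemma dvdn_sub_small p x y : (x <= y)%N -> (y < p)%N -> (p %| y - x)%N -> x = y.
Proof.
move=> xy yp; have [yx _|yx0 /(dvdn_leq yx0) yxp] := posnP (y - x)%N; first by lia.
by exfalso; lia.
Qed.

Section prim_step.
Variables (p n : nat).
Hypotheses (pp : prime p) (n0 : (0 < n)%N).

(** For a primitive t, the child (a, b + i d, p d) fails to be primitive exactly for these i. As p
    does not divide d, there is at most one of them below p; that one is replaced by the sublattice
    in which the first row is multiplied by p. *)
Let bad (t : nat * nat * nat) i : bool :=
  [&& (p %| t.1.1)%N, ~~ (p %| t.2)%N & (p %| t.1.2 + i * t.2)%N].

(* The p neighbours of t that are further from the origin in the p-tree. *)
Let child (t : nat * nat * nat) i : nat * nat * nat :=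
  if bad t i then ((p * t.1.1)%N, ((p * t.1.2) %% t.2)%N, t.2)
  else (t.1.1, (t.1.2 + i * t.2)%N, (p * t.2)%N).

(** In the exceptional case p does not divide d, so a common prime divisor differs from p and
    divides a and b already. Otherwise a common prime divisor either divides d, hence b, or equals
    p, and then i would be exceptional. *)
Let child_prim t i : t \in prim_seq n -> (i < p)%N -> child t i \in prim_seq (p * n).
Proof.
have p0 := prime_gt0 pp.
case: t => [[a b] d]; rewrite !mem_prim_seq//= ?muln_gt0 ?p0// => /and3P[/eqP adn bd /prim3P abd] ip.
rewrite /child/=; case: ifPn => [/and3P[/= pa pd pbd]|/=].
  rewrite -mulnA adn eqxx ltn_mod (leq_ltn_trans _ bd)//=.
  apply/prim3P => q qp qa qb qd.
  have qp' : (q != p) by apply: contraNneq pd => <-.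
  have cqp : coprime q p by rewrite prime_coprime// dvdn_prime2.
  apply: (abd q) => //; first by rewrite -(Gauss_dvdr _ cqp).
  rewrite -(Gauss_dvdr _ cqp) (divn_eq (p * b) d).
  by rewrite dvdn_addr// dvdn_mull.
rewrite /bad /= => nbad.
apply/and3P; split.
- by rewrite mulnCA adn.
- have : (i * d + d <= p * d)%N by rewrite -mulSnr leq_mul2r ip orbT.
  by lia.
apply/prim3P => q qp qa qb qd.
have [qdd|nqd] := boolP (q %| d)%N.
  by apply: (abd q) => //; move: qb; rewrite dvdn_addl// dvdn_mull.
have qE : q = p.
  move: qd; rewrite Euclid_dvdM// (negbTE nqd) orbF.
  by rewrite dvdn_prime2// => /eqP.
by move: nbad; rewrite -qE qa nqd qb.
Qed.

(** Divisibility of the last entry by p tells the two kinds of children apart. In the exceptional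
    kind b is recovered because p is invertible modulo d, and i from p | b + i d; in the other kind
    i and b are the quotient and the remainder of b + i d by d. *)
Let child_inj t i t' i' : t \in prim_seq n -> t' \in prim_seq n -> (i < p)%N -> (i' < p)%N ->
  child t i = child t' i' -> t = t' /\ i = i'.
Proof.
have p0 := prime_gt0 pp.
case: t t' => [[a b] d] [[a' b'] d']; rewrite !mem_prim_seq//=.
move=> /and3P[/eqP adn bd _] /and3P[/eqP adn' bd' _] ip ip'; rewrite /child.
case: ifPn => [/and3P[/= pa pd pbd]|/=]; case: ifPn => [/and3P[/= pa' pd' pbd']|/=].
- move=> [/eqP]; rewrite eqn_pmul2l// => /eqP aa' bb' dd'; move: aa' bb' dd' => -> bb' dd'.
  subst d'.
  have cpd : coprime p d by rewrite prime_coprime.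
  have bbE : b = b'.
    wlog bleb : b b' bd bd' bb' {pbd pbd' ip ip'} / (b <= b')%N.
      by move=> h; case: (leqP b b') => [|/ltnW] ?; [apply: h|apply/esym/h].
    move: bb' => /esym/eqP; rewrite eqn_mod_dvd ?leq_mul2l ?bleb ?orbT//.
    rewrite -mulnBr Gauss_dvdr 1?coprime_sym// => db.
    exact: (dvdn_sub_small bleb bd' db).
  subst b'; split => //.
  have main x y : (x < p)%N -> (y < p)%N -> (p %| b + x * d)%N -> (p %| b + y * d)%N -> (x <= y)%N -> x = y.
    move=> xp yp xd yd xy.
    have : (p %| (b + y * d) - (b + x * d))%N by rewrite dvdn_sub.
    by rewrite subnDl -mulnBl Gauss_dvdl//; exact: dvdn_sub_small.
  by case: (leqP i i') => [|/ltnW] ?; [apply: main|apply/esym/main].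
- move=> _ [_ _ dd']; move: pd; rewrite dd' dvdn_mulr//.
- by move=> _ [_ _ dd']; move: pd'; rewrite -dd' dvdn_mulr//.
- move=> _ _ [-> bb' /eqP]; rewrite eqn_pmul2l// => /eqP dd'; subst d'.
  have e : i = i'.
    have := congr1 (divn^~ d) bb'; rewrite ![(_ + _ * d)%N]addnC !divnMDl ?(leq_ltn_trans _ bd)//.
    by rewrite !divn_small// !addn0.
  by split => //; subst i'; move: bb' => /addIn ->.
Qed.

Lemma prim_step : (p * size (prim_seq n) <= size (prim_seq (p * n)))%N.
Proof.
have -> : (p * size (prim_seq n) = size [seq child t i | t <- prim_seq n, i <- iota 0 p])%N.
  by rewrite size_allpairs size_iota mulnC.
apply: uniq_leq_size.
  apply: allpairs_uniq; [exact: prim_seq_uniq|exact: iota_uniq|].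
  move=> [t i] [t' i'] /allpairsP[[? ?] /= [t1 t2 [-> ->]]] /allpairsP[[? ?] /= [t1' t2' [-> ->]]].
  move: t2 t2'; rewrite !mem_iota add0n /= => t2 t2' /child_inj h.
  by have [//|//|//|//|-> ->] := h.
move=> _ /allpairsP[[t i] /= [tn + ->]]; rewrite mem_iota add0n /= => ip.
exact: child_prim.
Qed.
End prim_step.

Lemma prim_mul N n : (0 < N)%N -> (0 < n)%N -> (N * size (prim_seq n) <= size (prim_seq (N * n)))%N.
Proof.
elim/ltn_ind: N n => N IH n N0 n0.
have [N1|N1] := leqP N 1; first by have -> : N = 1%N by [lia]; rewrite !mul1n.
have pp := pdiv_prime N1; have p1 := prime_gt1 pp.
have [q NE] : exists q, N = (q * pdiv N)%N by apply/dvdnP/pdiv_dvd.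
have q0 : (0 < q)%N by lia.
rewrite NE -mulnA; apply: leq_trans (leq_mul (leqnn q) (prim_step pp n0)) _.
by rewrite -mulnA; apply: IH; nia.
Qed.

Lemma hnf_seq_leq n : (0 < n)%N ->
  (size (hnf_seq n) <= \sum_(m <- iota 1 n | m ^ 2 %| n) size (prim_seq (n %/ m ^ 2)))%N.
Proof.
move=> n0.
pose s := [seq (m * t.1.1, m * t.1.2, m * t.2)%N | m <- [seq m <- iota 1 n | m ^ 2 %| n]%N,
   t <- prim_seq (n %/ m ^ 2)].
apply: (@leq_trans (size s)); last first.
  rewrite /s size_allpairs_dep sumnE big_map big_filter.
  by [].
apply: uniq_leq_size; first exact: hnf_seq_uniq.
move=> [[a b] d]; rewrite mem_hnf_seq// => /andP[/eqP adn bd].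
pose m := gcdn (gcdn a b) d.
have m0 : (0 < m)%N by rewrite gcdn_gt0; apply/orP; right; lia.
have [a' aE] : exists a', a = (a' * m)%N by apply/dvdnP; rewrite /m -gcdnA dvdn_gcdl.
have [b' bE] : exists b', b = (b' * m)%N.
  by apply/dvdnP; rewrite /m -gcdnA (dvdn_trans (dvdn_gcdr _ _))// dvdn_gcdl.
have [d' dE] : exists d', d = (d' * m)%N by apply/dvdnP; rewrite /m dvdn_gcdr.
have nE : n = (a' * d' * m ^ 2)%N by rewrite -adn aE dE mulnACA mulnn.
have m2 : (0 < m ^ 2)%N by rewrite expn_gt0 m0.
have ad0 : (0 < a' * d')%N by move: n0; rewrite nE; case: (a' * d')%N.
apply/allpairsPdep; exists m, (a', b', d'); split => /=.
- rewrite mem_filter mem_iota {1}nE dvdn_mull//= m0 add1n ltnS nE.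
  by rewrite -mulnn mulnA leq_pmull// muln_gt0 ad0 m0.
- rewrite {1}nE mulnK// mem_prim_seq//= eqxx /=.
  have -> /= : (b' < d')%N by move: bd; rewrite bE dE ltn_pmul2r.
  rewrite /prim3 /= -(eqn_pmul2r m0) mul1n.
  by rewrite !muln_gcdl -aE -bE -dE.
- by rewrite [in LHS]aE [in LHS]bE [in LHS]dE ![(m * _)%N]mulnC.
Qed.

Lemma sum_inv_sq n : \sum_(m <- iota 1 n) ((m%:R : rat) ^+ 2)^-1 <= 2.
Proof.
case: n => [|n]; first by rewrite big_nil.
(* The sharper bound 2 - 1/(n + 1), which telescopes, is the one that the induction can carry. *)
suff : \sum_(m <- iota 1 n.+1) ((m%:R : rat) ^+ 2)^-1 <= 2 - (n.+1%:R)^-1.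
  by move=> h; apply: (le_trans h); rewrite lerBlDr lerDl invr_ge0.
elim: n => [|n IH]; first by rewrite big_seq1.
have -> : iota 1 n.+2 = iota 1 n.+1 ++ [:: n.+2] by rewrite -[X in iota 1 X]addn1 iotaD.
rewrite big_cat big_seq1 /=.
apply: (le_trans (lerD IH (lexx _))).
have n1 : (0 : rat) < n.+1%:R by [].
rewrite -[n.+2%:R]natr1.
move: (n.+1%:R : rat) n1 => x x0.
rewrite -subr_ge0.
have -> : 2 - (x + 1)^-1 - (2 - x^-1 + (x + 1) ^- 2) = (x * (x + 1) ^+ 2)^-1.
  by field; lra.
by rewrite invr_ge0 mulr_ge0 ?exprn_ge0//; lra.
Qed.

Lemma hnf_le_prim n : (0 < n)%N -> (size (hnf_seq n) <= size (prim_seq (2 * n)))%N.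
Proof.
move=> n0; apply: leq_trans (hnf_seq_leq n0) _.
rewrite -(ler_nat rat) natr_sum.
set S := size (prim_seq _).
apply: (@le_trans _ _ (\sum_(m <- iota 1 n) S%:R / 2 * ((m%:R : rat) ^+ 2)^-1)); last first.
  rewrite -mulr_sumr; apply: (le_trans (ler_wpM2l _ (sum_inv_sq n))); first by rewrite divr_ge0.
  by rewrite divfK.
rewrite big_mkcond /= big_seq [leRHS]big_seq; apply: ler_sum => m; rewrite mem_iota => /andP[m1 _].
have m0 : (0 : rat) < m%:R ^+ 2 by rewrite exprn_gt0// ltr0n.
case: ifPn => [mn|_]; last by rewrite mulr_ge0// invr_ge0// ltW.
rewrite ler_pdivlMr// -natrX -natrM ler_pdivlMr// -natrM ler_nat.
have q0 : (0 < n %/ m ^ 2)%N by rewrite divn_gt0 ?expn_gt0 ?m1// dvdn_leq.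
have m2 : (0 < 2 * m ^ 2)%N by rewrite muln_gt0 expn_gt0 m1.
(* The multiplier is 2 m^2: the square leads back from n / m^2 to n, and the 2 cancels the bound of
   [sum_inv_sq]. *)
have := prim_mul m2 q0.
have -> : (2 * m ^ 2 * (n %/ m ^ 2) = 2 * n)%N by rewrite -mulnA [(m ^ 2 * _)%N]mulnC divnK.
by rewrite -/S mulnC [(2 * _)%N]mulnC mulnA.
Qed.

(** Only injectivity matters, so the two lists are matched by position. For t in [hnf_seq n] with n
    > 0 the index is in range and the default is never returned. *)
Definition hnf_prim (n : nat) (t : nat * nat * nat) : nat * nat * nat :=
  nth t (prim_seq (2 * n)) (index t (hnf_seq n)).

Lemma hnf_prim_in n t : (0 < n)%N -> t \in hnf_seq n -> hnf_prim n t \in prim_seq (2 * n).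
Proof.
by move=> n0 tn; apply: mem_nth; rewrite (leq_trans _ (hnf_le_prim n0))// index_mem.
Qed.

Lemma hnf_prim_inj n : (0 < n)%N -> {in hnf_seq n &, injective (hnf_prim n)}.
Proof.
move=> n0 t t' tn tn'; have := hnf_le_prim n0 => le_n; rewrite /hnf_prim.
have it : (index t (hnf_seq n) < size (prim_seq (2 * n)))%N by rewrite (leq_trans _ le_n)// index_mem.
have it' : (index t' (hnf_seq n) < size (prim_seq (2 * n)))%N by rewrite (leq_trans _ le_n)// index_mem.
(* The two calls of [nth] have different defaults, which must be unified before uniqueness of the
   list applies. *)
rewrite (set_nth_default t')// => /eqP; rewrite nth_uniq// ?prim_seq_uniq// => /eqP.
by move=> e; rewrite -(nth_index t tn) e nth_index.
Qed.

(** * Lattices and hyperdistance *)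

Section lattices.
Variable R : realType.
Local Open Scope card_scope.
Local Notation C := R[i].
Implicit Types (u v w : C) (L M : set C).

Definition lat u v : set C := [set w | exists m n : int, w = m%:~R * u + n%:~R * v].

Definition indep u v := forall x y : rat, ratr x * u + ratr y * v = 0 -> x = 0 /\ y = 0.

Lemma indepZ u v (x y x' y' : rat) : indep u v ->
  ratr x * u + ratr y * v = ratr x' * u + ratr y' * v -> x = x' /\ y = y'.
Proof.
move=> uv e.
have [] := uv (x - x') (y - y').
  by rewrite !rmorphB /= !mulrBl addrACA -opprD e subrr.
by move=> /eqP; rewrite subr_eq0 => /eqP -> /eqP; rewrite subr_eq0 => /eqP.
Qed.

Lemma indep_int u v (x y x' y' : int) : indep u v ->
  x%:~R * u + y%:~R * v = x'%:~R * u + y'%:~R * v -> x = x' /\ y = y'.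
Proof.
move=> uv; rewrite -(ratr_int _ x) -(ratr_int _ y) -(ratr_int _ x') -(ratr_int _ y') => /(indepZ uv)[/eqP + /eqP].
by rewrite !eqr_int => /eqP -> /eqP.
Qed.

Lemma scale_lat c u v : scale c (lat u v) = lat (c * u) (c * v).
Proof.
apply/seteqP; split => [_ [_ [m [n ->]] <-]|_ [m [n ->]]].
  by exists m, n; rewrite mulrDr !(mulrCA c).
by exists (m%:~R * u + n%:~R * v); [exists m, n|rewrite mulrDr !(mulrCA c)].
Qed.

Lemma scaleA c c' L : scale c (scale c' L) = scale (c * c') L.
Proof.
apply/seteqP; split => [_ [_ [x Lx <-] <-]|_ [x Lx <-]]; first by exists x; rewrite ?mulrA.
by exists (c' * x); [exists x|rewrite mulrA].
Qed.

Lemma scale1 L : scale 1 L = L.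
Proof. by apply/seteqP; split => [_ [x Lx <-]|x Lx]; [rewrite mul1r|exists x; rewrite ?mul1r]. Qed.

Lemma std_lat z : std_lattice z = lat 1 z.
Proof. by apply/seteqP; split => [_ [m [n ->]]|_ [m [n ->]]]; exists m, n; rewrite mulr1. Qed.

Lemma scaleS c L M : L `<=` M -> scale c L `<=` scale c M.
Proof. by move=> LM _ [x Lx <-]; exists x => //; exact: LM. Qed.

Lemma has_index_scale c L M N : c != 0 -> has_index L M N -> has_index (scale c L) (scale c M) N.
Proof.
move=> c0 [ML LM]; split; first exact: scaleS.
have -> : cosets (scale c L) (scale c M) = (fun S => scale c S) @` cosets L M.
  have cE x : coset (scale c M) (c * x) = scale c (coset M x).
    apply/seteqP; split => [_ [_ [y My <-] <-]|_ [_ [y My <-] <-]].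
      by exists (x + y); [exists y|rewrite mulrDr].
    by exists (c * y); [exists y|rewrite mulrDr].
  apply/seteqP; split => [_ [_ [x Lx <-] <-]|_ [_ [x Lx <-] <-]].
    by exists (coset M x); [exists x|rewrite cE].
  by exists (c * x); [exists x|rewrite cE].
apply: card_eq_trans LM; apply: inj_card_eq => S S' _ _ e.
by rewrite -[S]scale1 -[S']scale1 -(mulVf c0) -!scaleA e.
Qed.

Lemma has_index_uniq L M N N' : has_index L M N -> has_index L M N' -> N = N'.
Proof.
move=> [_ h] [_ h']; have : `I_N #= `I_N' by apply: card_eq_trans h'; rewrite card_eq_sym.
by move=> /card_eq_II.
Qed.

Lemma lat_sub u v x y : lat u v x -> lat u v y -> lat u v (x - y).
Proof.
move=> [m [n ->]] [m' [n' ->]]; exists (m - m'), (n - n').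
by rewrite !intrD !rmorphN /= !mulrDl !mulNr opprD addrACA.
Qed.

Lemma lat_add u v x y : lat u v x -> lat u v y -> lat u v (x + y).
Proof.
move=> [m [n ->]] [m' [n' ->]]; exists (m + m'), (n + n').
by rewrite !intrD !mulrDl addrACA.
Qed.

Lemma lat0 u v : lat u v 0.
Proof. by exists 0, 0; rewrite !mul0r addr0. Qed.

Lemma coset_lat u v x y : coset (lat u v) x = coset (lat u v) y <-> lat u v (x - y).
Proof.
split=> [e|xy].
  have : coset (lat u v) x x by exists 0; rewrite ?addr0//; exact: lat0.
  by rewrite e => -[z Lz <-]; rewrite addrC addKr.
apply/seteqP; split => [_ [z Lz <-]|_ [z Lz <-]].
  by exists (x - y + z); [exact: lat_add|rewrite addrA [y + _]addrC subrK].
exists (z - (x - y)); first exact: lat_sub.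
by rewrite opprB addrC -addrA addrC subrK addrC.
Qed.

(** The rows of the normal form (a, b, d), read in the basis u, v. The entry b is an integer because
    the inclusion of (a d) L in this sublattice is again of this form, with -b in place of b. *)
Definition tri u v (a : nat) (b : int) (d : nat) := lat (a%:R * u + b%:~R * v) (d%:R * v).

Lemma tri_in u v a b d (m n : int) :
  m%:~R * (a%:R * u + b%:~R * v) + n%:~R * (d%:R * v) =
  (m * a%:Z)%:~R * u + (m * b + n * d%:Z)%:~R * v.
Proof. by rewrite intrD !intrM -!pmulrn; ring. Qed.

Lemma triP u v a b d (m n : int) : indep u v ->
  tri u v a b d (m%:~R * u + n%:~R * v) <->
  exists p q : int, m = p * a%:Z /\ n = p * b + q * d%:Z.
Proof.
move=> uv; split=> [[p [q]]|[p [q [-> ->]]]]; last by exists p, q; rewrite tri_in.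
by rewrite tri_in => /(indep_int uv)[-> ->]; exists p, q.
Qed.

(** The cosets are represented by i u + j v with i < a and j < d, numbered by i d + j. *)
Lemma tri_index u v a b d : indep u v -> (0 < a)%N -> (0 < d)%N ->
  has_index (lat u v) (tri u v a b d) (a * d).
Proof.
move=> uv a0 d0; split.
  by move=> _ [p [q ->]]; rewrite tri_in; eexists; eexists.
pose F (n : nat) := coset (tri u v a b d) ((n %/ d)%N%:~R * u + (n %% d)%N%:~R * v).
have -> : cosets (lat u v) (tri u v a b d) = F @` `I_(a * d).
  apply/seteqP; split => [_ [_ [m [n ->]] <-]|_ [n _ <-]]; last first.
    by exists ((n %/ d)%N%:~R * u + (n %% d)%N%:~R * v) => //; eexists; eexists.
  have aZ : (a%:Z != 0) by rewrite eqz_nat -lt0n.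
  have dZ : (d%:Z != 0) by rewrite eqz_nat -lt0n.
  pose q := (m %/ a)%Z; pose i := `|(m %% a)%Z|%N.
  have iE : m = q * a + i by rewrite /i gez0_abs ?modz_ge0//; exact: divz_eq.
  have ia : (i < a)%N by rewrite -ltz_nat /i gez0_abs ?modz_ge0// ltz_pmod.
  pose s := ((n - q * b) %/ d)%Z; pose j := `|((n - q * b)%R %% d)%Z|%N.
  have jE : n = q * b + s * d + j.
    by rewrite /j gez0_abs ?modz_ge0// -addrA -divz_eq addrC subrK.
  have jd : (j < d)%N by rewrite -ltz_nat /j gez0_abs ?modz_ge0// ltz_pmod.
  exists (i * d + j)%N.
    rewrite /=; have : (i.+1 * d <= a * d)%N by rewrite leq_mul2r ia orbT.
    by rewrite mulSn; lia.
  rewrite /F divnMDl// modnMDl divn_small// modn_small// addn0.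
  apply/esym/coset_lat; exists q, s; rewrite tri_in iE jE !intrD.
  by ring.
apply: inj_card_eq => n n' /[!inE] /= nad nad' /coset_lat.
rewrite -/(tri _ _ _ _ _).
have -> : (n %/ d)%N%:~R * u + (n %% d)%N%:~R * v - ((n' %/ d)%N%:~R * u + (n' %% d)%N%:~R * v) =
  ((n %/ d)%N%:Z - (n' %/ d)%N%:Z)%:~R * u + ((n %% d)%N%:Z - (n' %% d)%N%:Z)%:~R * v.
  by rewrite !intrB; ring.
move=> /(triP _ _ _ _ _ uv)[p [q [e1 e2]]].
have l1 : (n %/ d < a)%N by rewrite ltn_divLR.
have l1' : (n' %/ d < a)%N by rewrite ltn_divLR.
have l2 : (n %% d < d)%N by rewrite ltn_mod.
have l2' : (n' %% d < d)%N by rewrite ltn_mod.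
rewrite (divn_eq n d) (divn_eq n' d).
move: (n %/ d)%N (n' %/ d)%N (n %% d)%N (n' %% d)%N e1 e2 l1 l1' l2 l2' => x x' y y' e1 e2 l1 l1' l2 l2'.
have p0 : p = 0 by nia.
have q0 : q = 0 by rewrite p0 in e2; nia.
rewrite p0 q0 in e1 e2.
have -> : x = x' by lia.
by have -> : y = y' by lia.
Qed.
End lattices.

(** * The hyperdistance from a lattice to a primitive sublattice *)

Section hyperdistance.
Variable R : realType.
Local Open Scope card_scope.
Local Notation C := R[i].
Implicit Types (u v w : C) (L M : set C).

Lemma lat_opp u v : lat (- u) (- v) = lat u v.
Proof.
by apply/seteqP; split => [_ [m [n ->]]|_ [m [n ->]]]; exists (- m), (- n);
  rewrite !rmorphN /= ?mulrNN// !mulNr !mulrN.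
Qed.

Lemma prim3_bezout a b d : prim3 (a, b, d) ->
  exists x y z : int, x * a%:Z + y * b%:Z + z * d%:Z = 1.
Proof.
rewrite /prim3 /= => /eqP g1.
have [x [y xy]] := Bezoutz a b; have [s [z sz]] := Bezoutz (gcdz a b) d.
exists (s * x), (s * y), z; rewrite -!mulrA -mulrDr xy sz.
by rewrite /gcdz !absz_nat g1.
Qed.

Lemma ratr_neq0 (q : rat) : q != 0 -> ratr q != 0 :> C.
Proof. by move=> q0; rewrite fmorph_eq0. Qed.

(** The numbers q a, q b and q d are integers because the scaled generators lie in the lattice;
    Bezout for the primitive triple makes q an integer, and a lattice does not see its sign. *)
Lemma prim_scale u v a b d (q : rat) : indep u v -> prim3 (a, b, d) -> q != 0 ->
  scale (ratr q) (tri u v a b d) `<=` lat u v ->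
  exists2 p : nat, (0 < p)%N & scale (ratr q) (tri u v a b d) = tri u v (p * a) (p * b)%N (p * d).
Proof.
move=> uv /prim3_bezout[x [y [z xyz]]] q0 qL.
have [m [n [qa qb]]] : exists m n : int, q * a%:R = m%:~R /\ q * b%:R = n%:~R.
  have [|m [n e]] := qL (ratr q * (a%:R * u + b%:~R * v)).
    by exists (a%:R * u + b%:~R * v) => //; exists 1, 0; rewrite mul1r mul0r addr0.
  exists m, n; apply: (indepZ uv).
  by rewrite !ratr_int -e !rmorphM /= !ratr_nat -pmulrn; ring.
have [m' qd] : exists m' : int, q * d%:R = m'%:~R.
  have [|m' [n' e]] := qL (ratr q * (d%:R * v)).
    by exists (d%:R * v) => //; exists 0, 1; rewrite mul1r mul0r add0r.
  exists n'; have [] // : 0 = m'%:~R :> rat /\ q * d%:R = n'%:~R.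
  by apply: (indepZ uv); rewrite !ratr_int -e !rmorphM /= !ratr_nat rmorph0; ring.
have qE : q = (x * m + y * n + z * m')%:~R.
  rewrite !intrD !intrM -qa -qb -qd -[LHS]mulr1 -[X in _ * X](_ : (1 : int)%:~R = 1)// -xyz.
  by rewrite !intrD !intrM -!pmulrn; ring.
move: (_ + z * m') qE => k qE; rewrite {q q0 qL qa qb qd}qE in q0 *.
have k0 : k != 0 by move: q0; rewrite intr_eq0.
exists `|k|%N; first by rewrite absz_gt0.
rewrite ratr_int /tri scale_lat -pmulrn.
have {k0}[->|->] : k = `|k|%N%:Z \/ k = - `|k|%N%:Z by lia.
  by rewrite absz_nat -!pmulrn !natrM; congr lat; ring.
by rewrite abszN absz_nat -[LHS]lat_opp mulrNz -!pmulrn !natrM; congr lat; ring.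
Qed.

(** T has index a d in L and (a d) L has index a d in T, so a d is a candidate. It is minimal
    because a rational multiple of T inside L is p T for a positive integer p, of index p^2 a d. The
    factors [al] and [be] allow for the unknown representatives on which [dist1] is computed. *)
Lemma hyperdist_tri u v a b d (al be : rat) : indep u v -> (0 < a)%N -> (0 < d)%N ->
  prim3 (a, b, d) -> al != 0 -> be != 0 ->
  hyperdist (scale (ratr al) (lat u v)) (scale (ratr be) (tri u v a b d)) = (a * d)%N.
Proof.
move=> uv a0 d0 abd al0 be0.
have ad0 : (0 < a * d)%N by rewrite muln_gt0 a0.
set L := lat u v; set M := tri _ _ _ _ _.
have candE : hyperdist_cand (scale (ratr al) L) (scale (ratr be) M) (a * d)%N.
  (* The factor al / be turns be T into al T inside al L, and (a d) be / al turns al L into (a d) be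
     L inside be T. *)
  split => //; exists ((a * d)%:R * be / al), (al / be).
  split; rewrite ?mulf_neq0 ?invr_neq0 ?pnatr_eq0 -?lt0n//.
    rewrite scaleA -rmorphM divfK//.
    by apply: has_index_scale; [exact: ratr_neq0|exact: tri_index].
  rewrite scaleA -rmorphM divfK// mulrC rmorphM /= -scaleA ratr_nat.
  apply: has_index_scale; first exact: ratr_neq0.
  have uv' : indep (a%:R * u + b%:~R * v) (d%:R * v).
    move=> x y.
    have -> : ratr x * (a%:R * u + b%:~R * v) + ratr y * (d%:R * v) =
       ratr (x * a%:R) * u + ratr (x * b%:R + y * d%:R) * v.
      by rewrite rmorphD !rmorphM /= !ratr_nat -pmulrn; ring.
    move=> /uv[/eqP]; rewrite mulf_eq0 pnatr_eq0 (gtn_eqF a0) orbF => /eqP ->.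
    rewrite mul0r add0r => /eqP; rewrite mulf_eq0 pnatr_eq0 (gtn_eqF d0) orbF => /eqP ->.
    by [].
  (* In the basis u' = a u + b v, v' = d v of T one has a d u = d u' - b v' and a d v = a v'. *)
  have := @tri_index R _ _ d (- b%:Z) a uv' d0 a0; rewrite mulnC.
  congr has_index; rewrite scale_lat /tri; congr lat; rewrite ?natrM ?mulrNz -?pmulrn; ring.
have candL N : hyperdist_cand (scale (ratr al) L) (scale (ratr be) M) N -> (a * d <= N)%N.
  move=> [N0 [q [q' [q0 q'0 h _]]]].
  have {h} : has_index L (scale (ratr (al^-1 * q' * be)) M) N.
    have := has_index_scale (ratr_neq0 (invr_neq0 al0)) h.
    by rewrite !scaleA -!rmorphM/= mulVf// rmorph1 scale1 ?mulrA.
  have c0 : al^-1 * q' * be != 0 by rewrite !mulf_neq0// invr_neq0.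
  move=> h; have [p p0 e] := prim_scale uv abd c0 h.1.
  move: h; rewrite e => /has_index_uniq h.
  have <- : (p * a * (p * d))%N = N.
    by apply/esym/h/tri_index => //; rewrite muln_gt0 p0.
  by rewrite mulnACA leq_pmull// muln_gt0 p0.
have := @xgetPex _ 0%N [set N | hyperdist_cand (scale (ratr al) L) (scale (ratr be) M) N /\
                    forall N', hyperdist_cand (scale (ratr al) L) (scale (ratr be) M) N' -> (N <= N')%N].
rewrite -/(hyperdist _ _) => -[]; first by exists (a * d)%N.
by move=> h1 h2; apply/eqP; rewrite eqn_leq (h2 _ candE) (candL _ h1).
Qed.

Lemma dist1_tri u v a b d : indep u v -> (0 < a)%N -> (0 < d)%N -> prim3 (a, b, d) ->
  dist1 (proj_class (lat u v)) (proj_class (tri u v a b d)) = ln (a * d)%:R.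
Proof.
move=> uv a0 d0 abd; rewrite /dist1.
have rep L : exists2 q : rat, q != 0 & xget set0 (proj_class L) = scale (ratr q) L.
  have := @xgetPex _ set0 (proj_class L); apply.
  by exists L, 1; rewrite ?oner_eq0// rmorph1 scale1.
have [al al0 ->] := rep (lat u v); have [be be0 ->] := rep (tri u v a b d).
by rewrite hyperdist_tri.
Qed.

Lemma int_mul_eq0 (a : nat) (r : int) : (0 < a)%N -> 0 = r * a%:Z -> r = 0.
Proof. by move=> a0 /esym/eqP; rewrite mulf_eq0 eqz_nat (gtn_eqF a0) orbF => /eqP. Qed.

Lemma int_mutual_dvd (a a' : nat) (p p' : int) : (0 < a)%N ->
  a%:Z = p * a'%:Z -> a'%:Z = p' * a%:Z -> a = a' /\ p = 1.
Proof.
move=> a0 e e'.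
have aa : a = a'.
  have : (a%:Z %| a'%:Z)%Z by apply/dvdzP; exists p'.
  have : (a'%:Z %| a%:Z)%Z by apply/dvdzP; exists p.
  by rewrite !dvdzE /= => h h'; apply/eqP; rewrite eqn_dvd h h'.
split => //; apply: (@mulIf _ a%:Z); first by rewrite eqz_nat -lt0n.
by rewrite mul1r [RHS]e aa.
Qed.

(** Expressing the generators of each lattice in the other gives mutual divisibility, hence a = a'
    and d = d'; then b - b' is a multiple of d of absolute value below d. *)
Lemma tri_inj u v a b d a' b' d' : indep u v -> (0 < a)%N -> (0 < d)%N -> (0 < a')%N -> (0 < d')%N ->
  (b < d)%N -> (b' < d')%N ->
  tri u v a b d = tri u v a' b' d' -> (a, b, d) = (a', b', d').
Proof.
move=> uv a0 d0 a0' d0' bd bd' e.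
have T1 (x y : nat) z : tri u v x y z (x%:~R * u + y%:~R * v).
  by apply/(triP _ _ _ _ _ uv); exists 1, 0; rewrite !mul1r mul0r addr0.
have T2 (x y : nat) (z : nat) : tri u v x y z (0%:~R * u + z%:~R * v).
  by apply/(triP _ _ _ _ _ uv); exists 0, 1; rewrite !mul1r !mul0r add0r.
have := T1 a b d; rewrite e => /(triP _ _ _ _ _ uv)[p [q [e1 e2]]].
have := T1 a' b' d'; rewrite -e => /(triP _ _ _ _ _ uv)[p' [q' [e1' e2']]].
have := T2 a b d; rewrite e => /(triP _ _ _ _ _ uv)[r [s [f1 f2]]].
have := T2 a' b' d'; rewrite -e => /(triP _ _ _ _ _ uv)[r' [s' [f1' f2']]].
have r0 := int_mul_eq0 a0' f1; have r0' := int_mul_eq0 a0 f1'.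
move: f2 f2'; rewrite r0 r0' !mul0r !add0r => f2 f2'.
have [dd s1] := int_mutual_dvd d0 f2 f2'; have [aa p1] := int_mutual_dvd a0 e1 e1'.
move: e2; rewrite p1 mul1r => e2.
have q0 : q = 0.
  move: bd bd' e2; rewrite -dd; move: q; clear => q bd bd' e2.
  have [//|q1|q1] := ltrgt0P q; nia.
by congr (_, _, _) => //; move: e2; rewrite q0 mul0r addr0 => -[].
Qed.

(** If one of the sublattices is p times the other, comparing indices gives p^2 n = n, hence p =
    1. *)
Lemma proj_class_tri_inj u v t t' n : indep u v -> (0 < n)%N ->
  t \in prim_seq n -> t' \in prim_seq n ->
  proj_class (tri u v t.1.1 t.1.2 t.2) = proj_class (tri u v t'.1.1 t'.1.2 t'.2) -> t = t'.
Proof.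
case: t t' => [[a b] d] [[a' b'] d'] uv n0; rewrite !mem_prim_seq//=.
move=> /and3P[/eqP adn bd abd] /and3P[/eqP adn' bd' abd'] e.
have : proj_class (tri u v a b d) (tri u v a' b' d').
  by rewrite e; exists 1; rewrite ?oner_eq0// rmorph1 scale1.
have := n0; rewrite -{1}adn muln_gt0 => /andP[a0 d0].
have := n0; rewrite -{1}adn' muln_gt0 => /andP[a0' d0'].
move=> [q q0 qE].
have idx' := tri_index b' uv a0' d0'.
have := prim_scale uv abd q0; rewrite -qE => /(_ idx'.1)[p p0 pE].
have pa0 : (0 < p * a)%N by rewrite muln_gt0 p0.
have pd0 : (0 < p * d)%N by rewrite muln_gt0 p0.
have idx := tri_index (p * b)%N uv pa0 pd0.
have p1 : p = 1%N.
  move: idx; rewrite -pE => /(has_index_uniq idx').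
  rewrite adn' mulnACA adn => /esym/eqP.
  by rewrite -[X in _ == X]mul1n eqn_pmul2r// muln_eq1 => /andP[/eqP].
by move: pE; rewrite p1 !mul1n => /(tri_inj uv a0' d0' a0 d0 bd' bd) ->.
Qed.
End hyperdistance.

(** * Embedding of the integral cosets into the big picture *)

Section embedding.
Variable R : realType.
Local Open Scope card_scope.
Local Notation C := R[i].
Implicit Types (u v w : C) (L M : set C).

Lemma has_index_finite L M N : has_index L M N -> finite_set (cosets L M).
Proof. by move=> [_ h]; exists N. Qed.

(** Cocompactness passes to a sublattice of finite index: the compact set is enlarged by the
    finitely many chosen coset representatives. *)
Lemma sublattice_is_lattice u v u' v' N : is_lattice (lat u v) ->
  has_index (lat u v) (lat u' v') N -> is_lattice (lat u' v').
Proof.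
move=> Llat idx; have [ML _] := idx.
split.
- exact: lat0.
- exact: lat_sub.
- move=> x Mx; have [U xU UL] := lattice_discrete Llat (ML _ Mx).
  exists U => //; apply/seteqP; split => [y [Uy My]|_ ->].
    by rewrite -UL; split => //; exact: ML.
  by split => //; exact: nbhs_singleton.
- have [K cK hK] := lattice_cocompact Llat.
  pose F := (xget 0) @` cosets (lat u v) (lat u' v').
  have fF : finite_set F by apply: finite_image; exact: has_index_finite idx.
  exists ((fun p : C * C => p.1 + p.2) @` (F `*` K)).
    apply: continuous_compact.
      by apply: continuous_subspaceT; exact: add_continuous.
    by apply: compact_setX => //; exact: finite_compact.
  move=> z; have [x [y [Lx Ky zE]]] := hK z.
  have cx : coset (lat u' v') x x by exists 0; rewrite ?addr0//; exact: lat0.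
  have := xgetPex 0 (ex_intro _ x cx); set f := xget _ _ => -[m Mm mE].
  exists (- m), (f + y); split.
  + by rewrite -sub0r; apply: lat_sub => //; exact: lat0.
  + exists (f, y) => //; split => //=.
    by exists (coset (lat u' v') x) => //; exists x.
  + by rewrite -mE zE [x + m]addrC -addrA addKr.
Qed.

Lemma sublattice_commensurable u v u' v' N :
  has_index (lat u v) (lat u' v') N -> commensurable (lat u v) (lat u' v').
Proof.
move=> idx; have [ML _] := idx; rewrite /commensurable (setIidr ML); split.
  exact: has_index_finite idx.
apply: (@sub_finite_set _ _ [set coset (lat u' v') 0]); last exact: finite_set1.
by move=> _ [x Mx <-]; apply/coset_lat; rewrite subr0.
Qed.

(** Clearing a denominator n leaves integers that are divisible by n in Zhat, hence in Z. *)
Lemma integral_at1 (g : 'M[rat]_2) : integral_at 1%:M g <-> exists G : 'M[int]_2, g = map_mx intr G.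
Proof.
split=> [[t [n [G [n0 nG]]]]|[G ->]]; last by eexists; exact: mulQZ_int.
rewrite mulmx1 => /matrixP Gt.
have /choice[H hH] (p : 'I_2 * 'I_2) : exists k, G p.1 p.2 = n%:Z * k.
  have := Gt p.1 p.2; rewrite !mxE => /(Zhat_int_dvd n0)/dvdzP[k ->].
  by exists k; rewrite mulrC.
exists (\matrix_(i, j) H (i, j)).
have n0' : n%:R != 0 :> rat by rewrite pnatr_eq0 -lt0n.
apply: (scalerI n0'); rewrite nG; apply/matrixP => i j; rewrite !mxE (hH (i, j)) intrM.
by [].
Qed.

Lemma YquotP r (c : set_type (Yquot r)) :
  let g := Grepr (set_val c) in [/\ GL2p g, integral_at r g & set_val c = Gcoset g].
Proof.
move=> g; rewrite /g {g}; have [g [gp gr]] := set_valP c; rewrite -set_valE => <-.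
have [k kG ->] := GreprP g.
split; first by apply: GL2pM => //; exact: Gamma1_GL2p.
  have [t gt] := gr; have [K _ ->] := kG.
  by eexists; apply: (mulQZ_comp gt); exact: mulQZ_int.
by rewrite GcosetM.
Qed.

Definition tri_of (u v : C) (t : nat * nat * nat) := tri u v t.1.1 t.1.2 t.2.

Lemma tri_of_PL u v n t : is_lattice (lat u v) -> indep u v -> (0 < n)%N -> t \in prim_seq n ->
  PL (lat u v) (proj_class (tri_of u v t)) /\
  dist1 (proj_class (lat u v)) (proj_class (tri_of u v t)) = ln n%:R.
Proof.
case: t => [[a b] d] Llat uv n0; rewrite mem_prim_seq//= => /and3P[/eqP adn bd abd].
have := n0; rewrite -{1}adn muln_gt0 => /andP[a0 d0].
split; last by rewrite dist1_tri// adn.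
have idx := tri_index b uv a0 d0.
exists (tri_of u v (a, b, d)) => //; split; first exact: sublattice_is_lattice idx.
exact: sublattice_commensurable idx.
Qed.

(** A coset with normal form t of determinant n goes to the class of the sublattice with form
    [hnf_prim n t]. The distance ln (2 n) gives back n, the class then gives back the primitive
    form, hence t and the coset. *)
Lemma coset_embedding u v : is_lattice (lat u v) -> indep u v ->
  exists j : set_type (Yquot 1%:M) -> set_type (PL (lat u v)), injective j /\
   forall c, exists n : nat, [/\ (0 < n)%N, \det (Grepr (set_val c) : 'M[rat]_2) = n%:R &
     dist1 (proj_class (lat u v)) (set_val (j c)) = ln (2 * n)%:R].
Proof.
move=> Llat uv.
have /choice[f hf] (c : set_type (Yquot 1%:M)) : exists nt : nat * (nat * nat * nat),
   [/\ (0 < nt.1)%N, nt.2 \in hnf_seq nt.1, \det (Grepr (set_val c) : 'M[rat]_2) = nt.1%:R &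
       set_val c = Gcoset (mx2 nt.2.1.1%:R nt.2.1.2%:R 0 nt.2.2%:R)].
  have /= [gp /integral_at1[G gG] cE] := YquotP c.
  move: (Grepr _) gp gG cE => g gp gG cE.
  have [|k [a [b [d [kG bd]]]]] := @hnf_rat 1 g G isT gp; first by rewrite scale1r.
  rewrite expr1n mul1r scale1r => ad kg.
  have ad0 : (0 < a * d)%N by rewrite -(ltr_nat rat) ad.
  exists ((a * d)%N, (a, b, d)); split => //=.
    by rewrite mem_hnf_seq// eqxx.
  by rewrite cE -kg GcosetM.
pose T c := tri_of u v (hnf_prim (f c).1 (f c).2).
have hT c : hnf_prim (f c).1 (f c).2 \in prim_seq (2 * (f c).1).
  by have [n0 tn _ _] := hf c; exact: hnf_prim_in.
have n2 c : (0 < 2 * (f c).1)%N by have [n0 _ _ _] := hf c; rewrite muln_gt0.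
exists (fun c => SigSub (mem_set (tri_of_PL Llat uv (n2 c) (hT c)).1)); split.
  move=> c c' [e].
  have nE : (f c).1 = (f c').1.
    have := (tri_of_PL Llat uv (n2 c) (hT c)).2; rewrite e (tri_of_PL Llat uv (n2 c') (hT c')).2.
    move=> /(@ln_inj R) h; have {h} : (2 * (f c').1)%:R = (2 * (f c).1)%:R :> R.
      by apply: h; rewrite posrE ltr0n.
    by move=> /eqP; rewrite eqr_nat eqn_pmul2l// => /eqP.
  have [n0 t1 _ cE] := hf c; have [n0' t1' _ cE'] := hf c'.
  have h := hT c'; rewrite -nE in h.
  have e' : proj_class (tri_of u v (hnf_prim (f c).1 (f c).2)) =
            proj_class (tri_of u v (hnf_prim (f c).1 (f c').2)) by rewrite e nE.
  have := proj_class_tri_inj uv (n2 c) (hT c) h e'.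
  rewrite -nE in t1'; move=> /(hnf_prim_inj n0 t1 t1') tt.
  by apply: val_inj; rewrite -!set_valE cE cE' tt.
move=> c; exists (f c).1; have [n0 tn dE cE] := hf c; split => //.
exact: (tri_of_PL Llat uv (n2 c) (hT c)).2.
Qed.

Lemma ratr_complex (q : rat) : ratr q = (ratr q)%:C%C :> C.
Proof. by rewrite fmorph_rat. Qed.

Lemma indep_uhp (k z : C) : k != 0 -> uhp z -> indep k (k * z).
Proof.
move=> k0 z0 x y; rewrite mulrCA [_ * k]mulrC -mulrDr => /eqP.
rewrite mulf_eq0 (negbTE k0) /= => /eqP; rewrite !ratr_complex.
case: z z0 => a b; rewrite /uhp /= => b0 /eqP; rewrite eq_complex /= => /andP[/eqP e1 /eqP e2].
have y0 : y = 0.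
  move: e2; rewrite mul0r addr0 add0r => /eqP; rewrite mulf_eq0 (gt_eqF b0) orbF fmorph_eq0.
  by move=> /eqP.
by move: e1; rewrite y0 rmorph0 !mul0r subr0 addr0 => /eqP; rewrite fmorph_eq0 => /eqP ->.
Qed.
End embedding.

(** * Square-summable families *)

Section modulus.
Variable R : realType.
Local Notation C := R[i].
Local Open Scope complex_scope.
Implicit Types z w : C.

(** The norm of [R[i]] has its values in [R[i]]; estimates are carried out on this version with
    values in R. *)
Definition cmod z : R := complex.Re `|z|.

Lemma cmodE z : `|z| = (cmod z)%:C.
Proof. by rewrite /cmod RRe_real// ger0_real. Qed.

Lemma cmod_ge0 z : 0 <= cmod z.
Proof. by have := normr_ge0 z; rewrite cmodE -[X in X <= _]/(0%:C) lecR. Qed.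

Lemma cmodM z w : cmod (z * w) = cmod z * cmod w.
Proof. by apply: complexI; rewrite rmorphM /= -!cmodE normrM. Qed.

Lemma cmodD z w : cmod (z + w) <= cmod z + cmod w.
Proof. by rewrite -lecR rmorphD /= -!cmodE ler_normD. Qed.

Lemma cmod0 : cmod 0 = 0.
Proof. by apply: complexI; rewrite -cmodE normr0. Qed.

Lemma cmod1 : cmod 1 = 1.
Proof. by apply: complexI; rewrite -cmodE normr1. Qed.

Lemma cmodN z : cmod (- z) = cmod z.
Proof. by rewrite /cmod normrN. Qed.

Lemma cmod_eq0 z : (cmod z == 0) = (z == 0).
Proof. by rewrite -[RHS]normr_eq0 cmodE; apply/idP/idP => [/eqP ->//|/eqP/complexI ->]. Qed.

Lemma cmod_conj z : cmod z^* = cmod z.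
Proof. by apply: complexI; rewrite -!cmodE norm_conjC. Qed.

Lemma cmod_sum (I : Type) (r : seq I) (P : pred I) (F : I -> C) :
  cmod (\sum_(i <- r | P i) F i) <= \sum_(i <- r | P i) cmod (F i).
Proof.
elim/big_rec2: _ => [|i x y _ h]; first by rewrite cmod0.
exact: le_trans (cmodD _ _) (lerD _ _).
Qed.

Lemma cmod_real (x : R) : cmod x%:C = `|x|.
Proof. by apply: complexI; rewrite -cmodE normc_def /= expr0n addr0 sqrtr_sqr. Qed.

Lemma cmod_sqr z : cmod z ^+ 2 = complex.Re z ^+ 2 + complex.Im z ^+ 2.
Proof.
rewrite /cmod normc_def /= sqr_sqrtr// addr_ge0 ?sqr_ge0//.
Qed.

Lemma Re_le_cmod z : `|complex.Re z| <= cmod z.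
Proof.
rewrite -(ler_pXn2r (n := 2))// ?nnegrE ?cmod_ge0// cmod_sqr real_normK ?num_real// lerDl.
exact: sqr_ge0.
Qed.

Lemma Im_le_cmod z : `|complex.Im z| <= cmod z.
Proof.
rewrite -(ler_pXn2r (n := 2))// ?nnegrE ?cmod_ge0// cmod_sqr real_normK ?num_real// lerDr.
exact: sqr_ge0.
Qed.

Lemma cmod_le_ReIm z : cmod z <= `|complex.Re z| + `|complex.Im z|.
Proof.
rewrite -(ler_pXn2r (n := 2))// ?nnegrE ?cmod_ge0 ?addr_ge0//.
rewrite cmod_sqr sqrrD !real_normK ?num_real//.
by rewrite lerD2r lerDl mulrn_wge0// mulr_ge0.
Qed.

Lemma cmod_small_eq z w : (forall e, 0 < e -> cmod (z - w) <= e) -> z = w.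
Proof.
move=> h; apply/eqP; rewrite -subr_eq0 -cmod_eq0; apply/negPn/negP => n0.
have p0 : 0 < cmod (z - w) by rewrite lt_def n0 cmod_ge0.
by have := h _ (divr_gt0 p0 (ltr0n _ 2)); lra.
Qed.
End modulus.

Section minkowski.
Variables (R : realType) (T : Type).
Implicit Types (r : seq T) (a b : T -> R).

Lemma cauchy_schwarz r a b :
  (\sum_(x <- r) a x * b x) ^+ 2 <= (\sum_(x <- r) a x ^+ 2) * (\sum_(x <- r) b x ^+ 2).
Proof.
set S := \sum_(x <- r) _ * _; set A := \sum_(x <- r) _; set B := \sum_(x <- r) b _ ^+ 2.
have B0 : 0 <= B by apply: sumr_ge0 => *; exact: sqr_ge0.
have A0 : 0 <= A by apply: sumr_ge0 => *; exact: sqr_ge0.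
(* A nonnegative quadratic form in s and t; the values s = B, t = S give the inequality when B >
   0. *)
have h s t : 0 <= s ^+ 2 * A - 2 * s * t * S + t ^+ 2 * B.
  have -> : s ^+ 2 * A - 2 * s * t * S + t ^+ 2 * B = \sum_(x <- r) (s * a x - t * b x) ^+ 2.
    rewrite /A /S /B !mulr_sumr -sumrB -big_split /=; apply: eq_bigr => x _; ring.
  by apply: sumr_ge0 => *; exact: sqr_ge0.
have [B00|Bp] : B = 0 \/ 0 < B by move: B0; rewrite le_eqVlt => /orP[/eqP|]; [left|right].
  have [S0|S0] := eqVneq S 0; first by rewrite B00 S0 mulr0 expr0n.
  (* For B = 0 the form is affine in t, and this t gives it the value -1. *)
  have := h 1 ((A + 1) / (2 * S)); rewrite B00.
  have -> : 1 ^+ 2 * A - 2 * 1 * ((A + 1) / (2 * S)) * S + ((A + 1) / (2 * S)) ^+ 2 * 0 = -1 by field.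
  by rewrite ler0N1.
have := h B S; have -> : B ^+ 2 * A - 2 * B * S * S + S ^+ 2 * B = B * (A * B - S ^+ 2) by ring.
by rewrite pmulr_rge0// subr_ge0.
Qed.

Definition fnorm r a := Num.sqrt (\sum_(x <- r) a x ^+ 2).

Lemma fnormD r a b : fnorm r (fun x => a x + b x) <= fnorm r a + fnorm r b.
Proof.
have n0 (c : T -> R) : 0 <= \sum_(x <- r) c x ^+ 2 by apply: sumr_ge0 => *; exact: sqr_ge0.
rewrite -(ler_pXn2r (n := 2))// ?nnegrE ?addr_ge0 ?sqrtr_ge0//.
rewrite sqrrD !sqr_sqrtr//.
have -> : \sum_(x <- r) (a x + b x) ^+ 2 =
  \sum_(x <- r) a x ^+ 2 + (\sum_(x <- r) a x * b x) *+ 2 + \sum_(x <- r) b x ^+ 2.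
  by rewrite -sumrMnl -!big_split /=; apply: eq_bigr => x _; rewrite sqrrD.
rewrite lerD2r lerD2l ler_wMn2r// -sqrtrM//.
apply: le_trans (ler_norm _) _; rewrite -sqrtr_sqr ler_wsqrtr//.
exact: cauchy_schwarz.
Qed.
End minkowski.

Section l2_theory.
Variables (R : realType) (T : choiceType).
Local Notation C := R[i].
Local Open Scope complex_scope.
Implicit Types (xi eta : T -> C) (F G : {fset T}) (M : R).

Definition fn F xi : R := fnorm F (fun x => cmod (xi x)).

Lemma fn_ge0 F xi : 0 <= fn F xi.
Proof. exact: sqrtr_ge0. Qed.

Lemma fn_sqr F xi : fn F xi ^+ 2 = \sum_(x <- F) cmod (xi x) ^+ 2.
Proof. by rewrite sqr_sqrtr//; apply: sumr_ge0 => *; exact: sqr_ge0. Qed.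

Lemma fnorm_le (r : seq T) (a b : T -> R) : (forall x, x \in r -> 0 <= a x <= b x) -> fnorm r a <= fnorm r b.
Proof.
move=> ab; apply: ler_wsqrtr; rewrite big_seq [leRHS]big_seq; apply: ler_sum => x /ab/andP[a0 h].
by rewrite ler_pXn2r// nnegrE (le_trans a0).
Qed.

Lemma big_fset_sub F G (f : T -> R) : (F `<=` G)%fset ->
  \sum_(x <- G) f x = \sum_(x <- F) f x + \sum_(x <- (G `\` F)%fset) f x.
Proof.
move=> FG; rewrite (big_fsetID _ (mem F)) /=; congr (_ + _); apply: congr_big => //.
  by congr enum_fset; apply/fsetP => x; rewrite !inE andbC; apply/idP/idP => [/andP[]//|xF]; rewrite xF (fsubsetP FG).
by congr enum_fset; apply/fsetP => x; rewrite !inE andbC.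
Qed.

Lemma ler_fset_sub F G (f : T -> R) : (F `<=` G)%fset -> (forall x, 0 <= f x) ->
  \sum_(x <- F) f x <= \sum_(x <- G) f x.
Proof. by move=> FG f0; rewrite (big_fset_sub _ FG) lerDl; apply: sumr_ge0. Qed.

Lemma fnD F xi eta : fn F (fun x => xi x + eta x) <= fn F xi + fn F eta.
Proof.
apply: le_trans (fnormD _ _ _); apply: fnorm_le => x _.
by rewrite cmod_ge0 cmodD.
Qed.

Lemma fnZ F c xi : fn F (fun x => c * xi x) = cmod c * fn F xi.
Proof.
rewrite /fn /fnorm -[cmod c]ger0_norm ?cmod_ge0// -sqrtr_sqr -sqrtrM ?sqr_ge0//.
by rewrite mulr_sumr; congr Num.sqrt; apply: eq_bigr => x _; rewrite cmodM exprMn.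
Qed.

Lemma fn_point F xi x : x \in F -> cmod (xi x) <= fn F xi.
Proof.
move=> xF; rewrite -(ler_pXn2r (n := 2))// ?nnegrE ?cmod_ge0 ?fn_ge0// fn_sqr.
by rewrite (big_fsetD1 x)//= lerDl; apply: sumr_ge0 => *; exact: sqr_ge0.
Qed.

Lemma fn_unif F xi e : 0 <= e -> (forall x, x \in F -> cmod (xi x) <= e) -> fn F xi <= #|` F|%:R * e.
Proof.
move=> e0 h; rewrite -(ler_pXn2r (n := 2))// ?nnegrE ?fn_ge0 ?mulr_ge0// fn_sqr.
apply: (@le_trans _ _ (\sum_(x <- F) e ^+ 2)).
  rewrite big_seq [leRHS]big_seq; apply: ler_sum => x /h xe.
  by rewrite ler_pXn2r// nnegrE// cmod_ge0.
rewrite big_const_seq count_predT iter_addr_0 exprMn -[leLHS]mulr_natl.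
rewrite ler_wpM2r ?sqr_ge0// -natrX ler_nat.
by rewrite -mulnn; case: (size _) => // k; rewrite leq_pmulr.
Qed.

(** [l2norm] is the square root of a supremum of finite sums, so bounding it means bounding all
    finite sections alike. The later l^2 estimates are reduced to finite sums by this. *)
Lemma l2norm_leP xi M : 0 <= M ->
  (l2norm xi <= M%:E)%E <-> forall F, fn F xi <= M.
Proof.
move=> M0.
have -> : (l2norm xi <= M%:E)%E <->
  (\esum_(x in [set: T]) ((complex.Re `|xi x|) ^+ 2)%:E <= (M ^+ 2)%:E)%E.
  rewrite /l2norm; have : (0 <= \esum_(x in [set: T]) ((complex.Re `|xi x|) ^+ 2)%:E)%E.
    by apply: esum_ge0 => x _; rewrite lee_fin sqr_ge0.
  case: (esum _ _) => [r| |] //= r0; last by rewrite invr_eq0 pnatr_eq0 /= !leye_eq.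
  rewrite lee_fin in r0; rewrite !lee_fin powR12_sqrt//.
  rewrite -[in X in _ <-> X](sqr_sqrtr r0) ler_pXn2r// nnegrE ?sqrtr_ge0//.
split=> [h F|h].
  rewrite -(ler_pXn2r (n := 2))// ?nnegrE ?fn_ge0// fn_sqr -lee_fin.
  apply: le_trans h; apply: ereal_sup_ubound => /=.
  exists [set` F]; first by split.
  by rewrite fsbig_finite//= set_fsetK -sumEFin.
apply: ge_ereal_sup => _ [A [fA _] <-].
rewrite fsbig_finite//= sumEFin lee_fin.
have : fn (fset_set A) xi ^+ 2 <= M ^+ 2 by rewrite ler_pXn2r ?nnegrE ?fn_ge0.
by rewrite fn_sqr.
Qed.

Definition hn xi : R := fine (l2norm xi).

Lemma l2normE xi : l2 xi -> l2norm xi = (hn xi)%:E.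
Proof.
by rewrite /l2 /= => h; rewrite fineK// ge0_fin_numE//; exact: poweR_ge0.
Qed.

Lemma hn_ge0 xi : 0 <= hn xi.
Proof. by rewrite fine_ge0//; exact: poweR_ge0. Qed.

Lemma fn_le_hn F xi : l2 xi -> fn F xi <= hn xi.
Proof. by move=> h; apply: (l2norm_leP xi (hn_ge0 xi)).1; rewrite l2normE. Qed.

Lemma l2_hn xi M : 0 <= M -> (forall F, fn F xi <= M) -> l2 xi /\ hn xi <= M.
Proof.
move=> M0 /(l2norm_leP _ M0) h.
have l2xi : l2 xi by rewrite /l2/=; apply: le_lt_trans h _; rewrite ltry.
by split => //; rewrite -lee_fin -l2normE.
Qed.

Lemma cmod_le_hn xi x : l2 xi -> cmod (xi x) <= hn xi.
Proof.
move=> h; apply: le_trans (fn_le_hn [fset x]%fset h).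
by apply: fn_point; rewrite inE.
Qed.

Lemma l2D xi eta : l2 xi -> l2 eta ->
  l2 (fun x => xi x + eta x) /\ hn (fun x => xi x + eta x) <= hn xi + hn eta.
Proof.
move=> h1 h2; apply: l2_hn; first by rewrite addr_ge0// hn_ge0.
by move=> F; apply: le_trans (fnD _ _ _) _; rewrite lerD// fn_le_hn.
Qed.

Lemma l2Z c xi : l2 xi -> l2 (fun x => c * xi x) /\ hn (fun x => c * xi x) <= cmod c * hn xi.
Proof.
move=> h; apply: l2_hn; first by rewrite mulr_ge0 ?cmod_ge0 ?hn_ge0.
by move=> F; rewrite fnZ ler_wpM2l ?cmod_ge0// fn_le_hn.
Qed.

Definition cut F xi : T -> C := fun x => if x \in F then xi x else 0.

(** F is chosen to carry all of the squared norm except e^2; by orthogonality the part outside F has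
    norm at most e. *)
Lemma hn_tail xi e : l2 xi -> 0 < e -> exists F, l2 (fun x => xi x - cut F xi x) /\
  hn (fun x => xi x - cut F xi x) <= e.
Proof.
move=> hxi e0.
have [e1|e1] := leP (hn xi) e.
  exists fset0; have -> : (fun x => xi x - cut fset0 xi x) = xi.
    by apply/funext => x; rewrite /cut inE subr0.
  by [].
have d0 : 0 <= hn xi ^+ 2 - e ^+ 2 by rewrite subr_ge0 ler_pXn2r// ?nnegrE ?hn_ge0// ltW.
(* Otherwise the square root of hn^2 - e^2 would bound every finite section, hence the norm
   itself. *)
have [F hF] : exists F, hn xi ^+ 2 - e ^+ 2 <= fn F xi ^+ 2.
  apply/not_existsP => h.
  have [_] : l2 xi /\ hn xi <= Num.sqrt (hn xi ^+ 2 - e ^+ 2).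
    apply: l2_hn; first exact: sqrtr_ge0.
    move=> F; rewrite -[fn F xi]ger0_norm ?fn_ge0// -sqrtr_sqr ler_wsqrtr//.
    by have /negP := h F; rewrite -ltNge => /ltW.
  rewrite -(ler_pXn2r (n := 2))// ?nnegrE ?hn_ge0 ?sqrtr_ge0// sqr_sqrtr//.
  by have := exprn_gt0 2 e0; lra.
exists F; apply: l2_hn; first exact: ltW.
move=> G; rewrite -(ler_pXn2r (n := 2))// ?nnegrE ?fn_ge0 ?(ltW e0)// fn_sqr.
have : fn (G `|` F)%fset xi ^+ 2 <= hn xi ^+ 2.
  by rewrite ler_pXn2r// ?nnegrE ?fn_ge0 ?hn_ge0// fn_le_hn.
have sG : \sum_(x <- G) cmod (xi x - cut F xi x) ^+ 2 <= \sum_(x <- (G `|` F)%fset) cmod (xi x - cut F xi x) ^+ 2.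
  by apply: ler_fset_sub; [exact: fsubsetUl|move=> x; exact: sqr_ge0].
have FG := fsubsetUr G F.
rewrite fn_sqr (big_fset_sub _ FG) -(fn_sqr F xi).
rewrite [leRHS](big_fset_sub _ FG) [X in X + _]big_seq [X in X + _]big1 ?add0r in sG; last first.
  by move=> x xF; rewrite /cut xF subrr cmod0 expr0n.
have e2 : \sum_(x <- ((G `|` F) `\` F)%fset) cmod (xi x - cut F xi x) ^+ 2 =
          \sum_(x <- ((G `|` F) `\` F)%fset) cmod (xi x) ^+ 2.
  by apply: eq_big_seq => x; rewrite !inE => /andP[/negbTE xF _]; rewrite /cut xF subr0.
by rewrite e2 in sG; lra.
Qed.

End l2_theory.

(** * Absolutely summable families and the inner product *)

Section csum_theory.
Variables (R : realType) (T : choiceType).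
Local Notation C := R[i].
Local Open Scope complex_scope.
Implicit Types (xi eta : T -> C) (F G : {fset T}) (M : R).

Lemma esum_approx (f : T -> R) M e : (forall x, 0 <= f x) -> (forall F, \sum_(x <- F) f x <= M) -> 0 < e ->
  exists s, (\esum_(x in [set: T]) (f x)%:E = s%:E)%E /\
   exists F0, forall F, (F0 `<=` F)%fset -> s - e <= \sum_(x <- F) f x <= s.
Proof.
move=> f0 fM e0; set S := (\esum_(x in _) _)%E.
have finS F : ((\sum_(x <- F) f x)%:E <= S)%E.
  apply: ereal_sup_ubound => /=; exists [set` F]; first by split.
  by rewrite fsbig_finite//= set_fsetK -sumEFin.
have SM : (S <= M%:E)%E.
  apply: ge_ereal_sup => _ [A [fA _] <-].
  by rewrite fsbig_finite//= sumEFin lee_fin.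
have S0 : (0 <= S)%E by apply: esum_ge0 => x _; rewrite lee_fin.
have [s sE] : exists s, S = s%:E.
  by case: (S) SM S0 => [s| |] //; exists s.
exists s; split => //.
suff [F0 hF0] : exists F0, s - e <= \sum_(x <- F0) f x.
  exists F0 => F F0F; apply/andP; split; last by rewrite -lee_fin -sE.
  by apply: le_trans hF0 _; exact: ler_fset_sub.
apply/not_existsP => h.
have : (S <= (s - e)%:E)%E.
  apply: ge_ereal_sup => _ [A [fA _] <-].
  rewrite fsbig_finite//= sumEFin lee_fin.
  by have /negP := h (fset_set A); rewrite -ltNge => /ltW.
by rewrite sE lee_fin; lra.
Qed.

Lemma rsum_approx (u : T -> R) M e : (forall F, \sum_(x <- F) `|u x| <= M) -> 0 < e ->
  exists F0, forall F, (F0 `<=` F)%fset -> `|\sum_(x <- F) u x - rsum u| <= e.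
Proof.
move=> uM e0; have e2 : 0 < e / 2 by rewrite divr_gt0.
pose p x := Num.max (u x) 0; pose m x := Num.max (- u x) 0.
have p0 x : 0 <= p x by rewrite le_max lexx orbT.
have m0 x : 0 <= m x by rewrite le_max lexx orbT.
have pu x : p x <= `|u x| by rewrite ge_max ler_norm normr_ge0.
have mu x : m x <= `|u x| by rewrite ge_max -normrN ler_norm normr_ge0.
have [sp [spE [Fp hp]]] := esum_approx p0 (fun F => le_trans (ler_sum _ (fun x _ => pu x)) (uM F)) e2.
have [sm [smE [Fm hm]]] := esum_approx m0 (fun F => le_trans (ler_sum _ (fun x _ => mu x)) (uM F)) e2.
have -> : rsum u = sp - sm.
  rewrite /rsum.
  have -> : (\esum_(x in [set: T]) (EFin \o u)^\+ x = sp%:E)%E.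
    by rewrite -spE; apply: eq_esum => x _; rewrite funeposE /= -EFin_max.
  have -> : (\esum_(x in [set: T]) (EFin \o u)^\- x = sm%:E)%E.
    by rewrite -smE; apply: eq_esum => x _; rewrite funenegE /= -EFin_max.
  by [].
exists (Fp `|` Fm)%fset => F FF.
have := hp F (fsubset_trans (fsubsetUl _ _) FF); have := hm F (fsubset_trans (fsubsetUr _ _) FF).
have -> : \sum_(x <- F) u x = \sum_(x <- F) p x - \sum_(x <- F) m x.
  rewrite -sumrB; apply: eq_bigr => x _; rewrite /p /m.
  by have [h|h] := leP (u x) 0; have [h'|h'] := leP (- u x) 0; lra.
move=> /andP[h1 h2] /andP[h3 h4]; rewrite ler_norml; apply/andP; split; lra.
Qed.

Definition asummable (u : T -> C) M := forall F, \sum_(x <- F) cmod (u x) <= M.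

Lemma Re_sum (r : seq T) (u : T -> C) : complex.Re (\sum_(x <- r) u x) = \sum_(x <- r) complex.Re (u x).
Proof. by elim/big_rec2: _ => // x y z _ <-; case: (u x) => ? ?; case: z. Qed.

Lemma Im_sum (r : seq T) (u : T -> C) : complex.Im (\sum_(x <- r) u x) = \sum_(x <- r) complex.Im (u x).
Proof. by elim/big_rec2: _ => // x y z _ <-; case: (u x) => ? ?; case: z. Qed.

(** [csum] is made of four extended sums of nonnegative families. Its properties below are all
    deduced from this convergence of the finite sums. *)
Lemma csum_approx (u : T -> C) M e : asummable u M -> 0 < e ->
  exists F0, forall F, (F0 `<=` F)%fset -> cmod (\sum_(x <- F) u x - csum u) <= e.
Proof.
move=> uM e0; have e2 : 0 < e / 2 by rewrite divr_gt0.
have [F1 h1] := rsum_approx (fun F => le_trans (ler_sum _ (fun x _ => Re_le_cmod (u x))) (uM F)) e2.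
have [F2 h2] := rsum_approx (fun F => le_trans (ler_sum _ (fun x _ => Im_le_cmod (u x))) (uM F)) e2.
exists (F1 `|` F2)%fset => F FF; apply: le_trans (cmod_le_ReIm _) _.
have := h1 F (fsubset_trans (fsubsetUl _ _) FF); have := h2 F (fsubset_trans (fsubsetUr _ _) FF).
rewrite -Re_sum -Im_sum /csum; case: (\sum_(x <- F) u x) => a b /=.
by move=> ? ?; lra.
Qed.

Lemma csum_le u M : asummable u M -> cmod (csum u) <= M.
Proof.
move=> uM; apply/ler_addgt0Pr => e e0; have [F hF] := csum_approx uM e0.
have := hF F (fsubset_refl _).
have := cmodD (\sum_(x <- F) u x) (csum u - \sum_(x <- F) u x); rewrite addrC subrK.
have := cmod_sum F xpredT u; have := uM F.
rewrite -[cmod (_ - csum u)]cmodN opprB; lra.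
Qed.

Lemma asummableD u v M N : asummable u M -> asummable v N -> asummable (fun x => u x + v x) (M + N).
Proof.
move=> uM vN F; apply: le_trans (lerD (uM F) (vN F)); rewrite -big_split /=.
by apply: ler_sum => x _; exact: cmodD.
Qed.

Lemma csumD u v M N : asummable u M -> asummable v N -> csum (fun x => u x + v x) = csum u + csum v.
Proof.
move=> uM vN; apply: cmod_small_eq => e e0.
have e3 : 0 < e / 3 by rewrite divr_gt0.
have [F1 h1] := csum_approx uM e3; have [F2 h2] := csum_approx vN e3.
have [F3 h3] := csum_approx (asummableD uM vN) e3.
pose F := (F1 `|` F2 `|` F3)%fset.
have := h1 F (fsubset_trans (fsubsetUl _ _) (fsubsetUl _ _)).
have := h2 F (fsubset_trans (fsubsetUr _ _) (fsubsetUl _ _)).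
have := h3 F (fsubsetUr _ _).
rewrite big_split /=; move: (\sum_(x <- F) u x) (\sum_(x <- F) v x) (csum u) (csum v) (csum _) => a b a' b' c' hc hb ha.
have -> : c' - (a' + b') = - (a + b - c') + (a - a' + (b - b')) by ring.
have := cmodD (- (a + b - c')) (a - a' + (b - b')); rewrite cmodN.
by have := cmodD (a - a') (b - b'); lra.
Qed.

Lemma csum_fin F (u : T -> C) : (forall x, x \notin F -> u x = 0) -> csum u = \sum_(x <- F) u x.
Proof.
move=> uF.
have sE G : (F `<=` G)%fset -> \sum_(x <- G) u x = \sum_(x <- F) u x.
  move=> FG; rewrite (big_fsetID _ (mem F)) /= [X in _ + X]big_seq [X in _ + X]big1 ?addr0; last first.
    by move=> x; rewrite !inE => /andP[_ /uF].
  apply: congr_big => //; congr enum_fset; apply/fsetP => x; rewrite !inE andbC.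
  by apply/idP/idP => [/andP[]//|xF]; rewrite xF (fsubsetP FG).
have uM : asummable u (\sum_(x <- F) cmod (u x)).
  move=> G; apply: (@le_trans _ _ (\sum_(x <- (G `|` F)%fset) cmod (u x))).
    by apply: ler_fset_sub; [exact: fsubsetUl|move=> x; exact: cmod_ge0].
  rewrite (big_fset_sub _ (fsubsetUr G F)) gerDl.
  by rewrite big_seq big1// => x; rewrite !inE => /andP[/uF -> _]; rewrite cmod0.
apply/esym/cmod_small_eq => e e0; have [F0 h] := csum_approx uM e0.
by rewrite -(sE (F0 `|` F)%fset (fsubsetUr _ _)); apply/h/fsubsetUl.
Qed.

Lemma l2dot_summable xi eta : l2 xi -> l2 eta -> asummable (fun x => xi x * (eta x)^*) (hn xi * hn eta).
Proof.
move=> h1 h2 F.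
have -> : \sum_(x <- F) cmod (xi x * (eta x)^*) = \sum_(x <- F) cmod (xi x) * cmod (eta x).
  by apply: eq_bigr => x _; rewrite cmodM cmod_conj.
have := cauchy_schwarz F (fun x => cmod (xi x)) (fun x => cmod (eta x)); rewrite -!fn_sqr -exprMn => h.
apply: (@le_trans _ _ (fn F xi * fn F eta)).
  rewrite -(ler_pXn2r (n := 2))// ?nnegrE ?mulr_ge0 ?fn_ge0//.
  by apply: sumr_ge0 => *; rewrite mulr_ge0 ?cmod_ge0.
by apply: ler_pM; rewrite ?fn_ge0 ?fn_le_hn.
Qed.

Lemma l2dot_le xi eta : l2 xi -> l2 eta -> cmod (l2dot xi eta) <= hn xi * hn eta.
Proof. by move=> h1 h2; exact: csum_le (l2dot_summable h1 h2). Qed.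

Lemma l2dotDl xi xi' eta : l2 xi -> l2 xi' -> l2 eta ->
  l2dot (fun x => xi x + xi' x) eta = l2dot xi eta + l2dot xi' eta.
Proof.
move=> h1 h1' h2; rewrite /l2dot -(csumD (l2dot_summable h1 h2) (l2dot_summable h1' h2)).
by congr csum; apply/funext => x; rewrite mulrDl.
Qed.

Lemma l2dotDr xi eta eta' : l2 xi -> l2 eta -> l2 eta' ->
  l2dot xi (fun x => eta x + eta' x) = l2dot xi eta + l2dot xi eta'.
Proof.
move=> h1 h2 h2'; rewrite /l2dot -(csumD (l2dot_summable h1 h2) (l2dot_summable h1 h2')).
by congr csum; apply/funext => x; rewrite rmorphD mulrDr.
Qed.

End csum_theory.

(** * The groupoid of Q-lattices *)

Section mobius_action.
Variable R : realType.
Local Notation C := R[i].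
Local Open Scope complex_scope.
Implicit Types (z w : C) (g h : 'M[rat]_2).

(** The automorphy factor c z + d; [mden_comp] is its cocycle identity. *)
Definition mden g z : C := ratr (g 1 0) * z + ratr (g 1 1).
Definition mnum g z : C := ratr (g 0 0) * z + ratr (g 0 1).

Lemma mobiusE g z : mobius g z = mnum g z / mden g z.
Proof. by []. Qed.

Lemma Im_affine (a b : rat) z : complex.Im (ratr a * z + ratr b) = ratr a * complex.Im z.
Proof. by rewrite !ratr_complex; case: z => x y /=; rewrite mul0r addr0 addr0. Qed.

Lemma Re_affine (a b : rat) z : complex.Re (ratr a * z + ratr b) = ratr a * complex.Re z + ratr b.
Proof. by rewrite !ratr_complex; case: z => x y /=; rewrite mul0r subr0. Qed.

Lemma affine_neq0 (a b : rat) z : uhp z -> (a != 0) || (b != 0) -> ratr a * z + ratr b != 0.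
Proof.
move=> z0 ab; apply/negP => /eqP e.
have := Im_affine a b z; have := Re_affine a b z; rewrite e /= => e1 e2.
have a0 : a = 0.
  by move/esym/eqP: e2; rewrite mulf_eq0 (gt_eqF z0) orbF fmorph_eq0 => /eqP.
move: e1; rewrite a0 rmorph0 mul0r add0r => /esym/eqP; rewrite fmorph_eq0 => /eqP b0.
by move: ab; rewrite a0 b0 eqxx.
Qed.

Lemma det2 (K : comNzRingType) (g : 'M[K]_2) : \det g = g 0 0 * g 1 1 - g 0 1 * g 1 0.
Proof. by rewrite {1}(mx2E g) det_mx2. Qed.

Lemma mden_neq0 g z : GL2p g -> uhp z -> mden g z != 0.
Proof.
move=> gp z0; apply: affine_neq0 => //; apply/negPn/negP; rewrite negb_or !negbK => /andP[/eqP c0 /eqP d0].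
by move: gp; rewrite /GL2p /= det2 c0 d0 !mulr0 subr0 ltxx.
Qed.

Lemma Im_div (u v : C) : complex.Im (u / v) =
  (complex.Im u * complex.Re v - complex.Re u * complex.Im v) / (cmod v) ^+ 2.
Proof. by rewrite cmod_sqr; case: u => a b; case: v => c d /=; ring. Qed.

Lemma Im_mobius g z : complex.Im (mobius g z) = ratr (\det g) * complex.Im z / cmod (mden g z) ^+ 2.
Proof.
rewrite mobiusE Im_div; congr (_ / _).
rewrite /mnum /mden !Im_affine !Re_affine det2 rmorphB !rmorphM /=; ring.
Qed.

Lemma uhp_mobius g z : GL2p g -> uhp z -> uhp (mobius g z).
Proof.
move=> gp z0; rewrite /uhp /= Im_mobius divr_gt0//; first by rewrite mulr_gt0// ltr0q.
by rewrite exprn_gt0// lt_def cmod_ge0 cmod_eq0 mden_neq0.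
Qed.

Lemma affine_comp (a b : rat) h z : GL2p h -> uhp z ->
  (ratr a * mobius h z + ratr b) * mden h z =
  ratr (a * h 0 0 + b * h 1 0) * z + ratr (a * h 0 1 + b * h 1 1).
Proof.
move=> hp z0; rewrite mobiusE mulrDl -[X in X + _]mulrA divfK ?mden_neq0//.
by rewrite /mnum /mden !rmorphD !rmorphM /=; ring.
Qed.

Lemma mulmx2E (K : nzRingType) (g h : 'M[K]_2) i j : (g *m h) i j = g i 0 * h 0 j + g i 1 * h 1 j.
Proof.
rewrite mxE !big_ord_recl big_ord0 addr0; congr (_ + _ * _); first by congr (g _ _); apply: val_inj.
by congr (h _ _); apply: val_inj.
Qed.

Lemma mden_comp g h z : GL2p h -> uhp z -> mden (g *m h) z = mden g (mobius h z) * mden h z.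
Proof. by move=> hp z0; rewrite affine_comp// /mden !mulmx2E. Qed.

Lemma mobius_comp g h z : GL2p g -> GL2p h -> uhp z ->
  mobius (g *m h) z = mobius g (mobius h z).
Proof.
move=> gp hp z0; rewrite [LHS]mobiusE mden_comp//.
have -> : mnum (g *m h) z = mnum g (mobius h z) * mden h z by rewrite affine_comp// /mnum !mulmx2E.
by rewrite -mulf_div divff ?mulr1 ?mden_neq0.
Qed.

Lemma mobius1 z : mobius (1%:M : 'M[rat]_2) z = z.
Proof. by rewrite mobiusE /mnum /mden !mxE /= !rmorph1 !rmorph0 mul1r mul0r addr0 add0r divr1. Qed.

End mobius_action.

Section groupoid.
Variable R : realType.
Local Notation C := R[i].
Implicit Types (z w : C) (g h s c : 'M[rat]_2) (r t : 'M[Zhat]_2).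

Lemma integral_Gamma1 r c : Gamma1 c -> integral_at r c.
Proof. by move=> [G _ ->]; eexists; exact: mulQZ_int. Qed.

Lemma integral_comp r h s : GL2p h -> integral_at r h ->
  integral_at (actZ h r) s <-> integral_at r (s *m h).
Proof.
move=> /GL2p_unit hU /actZP hr; split=> -[t st]; exists t.
  exact: mulQZ_comp hr st.
exact: mulQZ_div hU hr st.
Qed.

Lemma actZ_comp r h s : GL2p h -> integral_at r h -> integral_at r (s *m h) ->
  actZ (s *m h) r = actZ s (actZ h r).
Proof.
move=> /GL2p_unit hU /actZP hr /actZP shr; apply/esym/actZE.
exact: mulQZ_div hU hr shr.
Qed.

Lemma integral_Gamma1M r h c : Gamma1 c -> GL2p h -> integral_at r (c *m h) <-> integral_at r h.
Proof.
move=> cG hp; split.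
  move=> cr.
  have := (integral_comp (invmx c) (GL2pM (Gamma1_GL2p cG) hp) cr).1.
  rewrite mulmxA mulVmx ?mul1mx ?Gamma1_unit//; apply.
  exact/integral_Gamma1/Gamma1V.
by move=> hr; apply/(integral_comp c hp hr)/integral_Gamma1.
Qed.

Lemma actZ1 r : actZ (1%:M : 'M[rat]_2) r = r.
Proof. exact/actZE/mulQZ1. Qed.

(** Seen as a groupoid, Y has (h, r, z) as an arrow from (r, z) to (h r, h z); arrows leaving the
    target correspond to arrows leaving the source by composition with h. *)
Lemma Y_comp r z h s : GL2p h -> integral_at r h -> uhp z ->
  Y (s, actZ h r, mobius h z) <-> Y (s *m h : M2Q, r, z).
Proof.
move=> hp hr z0; split=> -[/= sp sr _]; split => //.
- exact: GL2pM.
- exact/(integral_comp s hp hr).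
- by rewrite /GL2p /= -[s](mulmxK (GL2p_unit hp)); apply: GL2pM => //; exact: GL2pV.
- exact/(integral_comp s hp hr).
- exact: uhp_mobius.
Qed.

Lemma Y_Gamma1M r z c g : Gamma1 c -> Y (c *m g : M2Q, r, z) <-> Y (g : M2Q, r, z).
Proof.
move=> cG; split=> -[/= gp gr z0].
  have gp' : GL2p g by rewrite /GL2p/=; move: gp; rewrite /GL2p/= det_mulmx (Gamma1_det cG) mul1r.
  by split => //=; exact/(integral_Gamma1M r cG gp').
by split => //=; [apply: GL2pM => //; exact: Gamma1_GL2p|exact/(integral_Gamma1M r cG gp)].
Qed.
End groupoid.

(** * Continuity on Y, one group element at a time *)

Section continuity.
Variable R : realType.
Local Notation C := R[i].
Implicit Types (z w : C) (g h s c : 'M[rat]_2) (r t : 'M[Zhat]_2) (f : gl2_fun R).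

(** The group coordinate is discrete, so continuity on Y can be tested in (rho, z) at fixed g, among
    the pairs allowed by g ([YcontP]). *)
Definition Ynear (g : M2Q) r z : set_system ('M[Zhat]_2 * C) :=
  within [set q | Y (g, q.1, q.2)] (nbhs (r, z)).

Global Instance Ynear_filter g r z : Filter (Ynear g r z).
Proof. exact: within_filter. Qed.

Definition Ycont f := forall (g : M2Q) r z, Y (g, r, z) ->
  (fun q => f g q.1 q.2) @ Ynear g r z --> f g r z.

Lemma YcontP f :
  {within @Y R, continuous (fun p : M2Q * 'M[Zhat]_2 * C => f p.1.1 p.1.2 p.2)} <-> Ycont f.
Proof.
split=> [/subspace_continuousP fc g r z Yz|fc].
  apply: cvg_trans (fc (g, r, z) Yz) => A /= [[P Q] [[[P1 P2] /= [P1g P2r] P12] Qz] PQA].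
  exists (P2, Q) => //= -[r' z'] /= [P2r' Qz'] Y'.
  apply: (PQA (g, r', z')) => //; split => //=; apply: P12; split => //=.
  exact: nbhs_singleton P1g.
apply/subspace_continuousP => -[[g r] z] Yz A fA.
have [[P Q] [/= Pr Qz] PQA] := fc g r z Yz A fA.
exists ([set g] `*` P, Q) => /=.
  by split => //; exists ([set g], P) => //=; split => //; exact: discrete_set1.
move=> [[g' r'] z'] /= [[-> Pr'] Qz'] Y'.
exact: (PQA (r', z')).
Qed.

Lemma actZ_continuous s r : integral_at r s -> actZ s @ r --> actZ s r.
Proof.
move=> sr; have FF : Filter (actZ s @ nbhs r) by apply: fmap_filter; exact: nbhs_filter.
apply: mxZ_cvg => N N1.
have [M M1 hM] := mulQZ_near s N1.
suff : nbhs r (actZ s @^-1` mxball N (actZ s r)) by [].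
apply: filterS (mxball_nbhs r M1) => r' rr'.
have [t' st' tt'] := hM _ _ _ rr' (actZP sr).
by rewrite /= (actZE st').
Qed.

Lemma integral_at_nbhs s r : integral_at r s -> \forall r' \near r, integral_at r' s.
Proof.
move=> sr; have [M M1 hM] := integral_at_near s.
by apply: filterS (mxball_nbhs r M1) => r' /hM [] h _; exact: h.
Qed.

Lemma not_integral_at_nbhs s r : ~ integral_at r s -> \forall r' \near r, ~ integral_at r' s.
Proof.
move=> sr; have [M M1 hM] := integral_at_near s.
by apply: filterS (mxball_nbhs r M1) => r' /hM [] _ h /h.
Qed.

Section complex_cvg.
Variables (T : Type) (F : set_system T).
Context {FF : Filter F}.
Lemma ccvgM (f g : T -> C) (a b : C) : f @ F --> a -> g @ F --> b -> (fun x => f x * g x) @ F --> a * b.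
Proof. by move=> fa gb; exact: (cvgM fa gb). Qed.

Lemma ccvgD (f g : T -> C) (a b : C) : f @ F --> a -> g @ F --> b -> (fun x => f x + g x) @ F --> a + b.
Proof. by move=> fa gb; exact: (cvgD fa gb). Qed.

Lemma ccvgV (f : T -> C) (a : C) : a != 0 -> f @ F --> a -> (fun x => (f x)^-1) @ F --> a^-1.
Proof. by move=> a0 fa; exact: (cvgV a0 fa). Qed.

Lemma ccvg_cst (a : C) : (fun _ : T => a) @ F --> a.
Proof. exact: cvg_cst. Qed.

Lemma ccvg_sum (I : Type) (u : seq I) (f : I -> T -> C) (a : I -> C) :
  (forall i, f i @ F --> a i) -> (fun x => \sum_(i <- u) f i x) @ F --> \sum_(i <- u) a i.
Proof.
move=> fa; elim: u => [|i u IH].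
  rewrite big_nil; have -> : (fun x => \sum_(i <- [::]) f i x) = fun=> 0 : C.
    by apply/funext => x; rewrite big_nil.
  exact: ccvg_cst.
rewrite big_cons; have -> : (fun x => \sum_(j <- i :: u) f j x) = fun x => f i x + \sum_(j <- u) f j x.
  by apply/funext => x; rewrite big_cons.
exact: (ccvgD (fa i) IH).
Qed.

Lemma ccvg_near (f g : T -> C) (a : C) : {near F, f =1 g} -> g @ F --> a -> f @ F --> a.
Proof. by move=> fg ga A /ga; apply: filterS2 fg => x /= ->. Qed.

End complex_cvg.

Lemma mobius_continuous g z : GL2p g -> uhp z -> mobius g @ z --> mobius g z.
Proof.
move=> gp z0.
have FFz : Filter (nbhs z) by exact: nbhs_filter.
have aff (a b : rat) : (fun w : C => ratr a * w + ratr b) @ z --> (ratr a * z + ratr b : C).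
  have idz : (fun w : C => w) @ z --> z by exact: cvg_id.
  exact: (ccvgD (ccvgM (@ccvg_cst _ _ _ (ratr a)) idz) (@ccvg_cst _ _ _ (ratr b))).
exact: (ccvgM (aff _ _) (ccvgV (mden_neq0 gp z0) (aff _ _))).
Qed.

Lemma Ynear_act g s r z : GL2p s -> integral_at r s -> Y (g : M2Q, r, z) ->
  (fun q => (actZ s q.1, mobius s q.2)) @ Ynear g r z --> Ynear (g *m invmx s) (actZ s r) (mobius s z).
Proof.
move=> sp sr [/= gp gr z0] A [[P Q] [/= Pr Qz] PQA].
exists ((actZ s @^-1` P) `&` [set r' | integral_at r' s], mobius s @^-1` Q).
  split; first by apply: filterI; [exact: actZ_continuous|exact: integral_at_nbhs].
  exact: mobius_continuous.
move=> -[r' z'] /= [[h1 h2] h3] Y'; have [_ _ /= z0'] := Y'.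
apply: (PQA (_, _)) => //.
by apply/(Y_comp _ sp h2 z0'); rewrite mulmxKV// GL2p_unit.
Qed.

(** Integrality of s is an open condition on rho, so near r the slice of Y at g lies in the slice at
    s. *)
Lemma Ynear_change g s r z : GL2p s -> integral_at r s -> Ynear g r z --> Ynear s r z.
Proof.
move=> sp sr A [[P Q] [/= Pr Qz] PQA].
exists (P `&` [set r' | integral_at r' s], Q).
  by split => //; apply: filterI => //; exact: integral_at_nbhs.
by move=> -[r' z'] /= [[h1 h2] h3] [_ _ z0']; apply: (PQA (_, _)).
Qed.

Lemma Ynear_fst g r z (P : set 'M[Zhat]_2) : nbhs r P -> Ynear g r z [set q | P q.1].
Proof. by move=> rP; exists (P, setT); [split => //; exact: filterT|move=> [r' z'] /= []]. Qed.
End continuity.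

Lemma drop_fst_continuous (U V W : topologicalType) :
  continuous (fun p : U * V * W => (p.1.2, p.2)).
Proof.
move=> [[u v] w] A [[P Q] /= [vP wQ] PQA].
exists ([set p | P p.2], Q) => /=; last by move=> [[u' v'] w'] /= [? ?]; exact: PQA.
by split => //; exists (setT, P) => /=; [split => //; exact: filterT|move=> [? ?] []].
Qed.

Lemma add_fst_continuous (U V W : topologicalType) (u : U) :
  continuous (fun p : V * W => (u, p.1, p.2)).
Proof.
move=> [v w] A [[P Q] /= [[[P1 P2] /= [uP vP] PP] wQ] PQA].
exists (P2, Q) => //= -[v' w'] /= [? ?]; apply: PQA; split => //=; apply: PP; split => //=.
exact: nbhs_singleton uP.
Qed.

(** * Compact support modulo Gamma1 x Gamma1 *)

Section support.
Variable R : realType.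
Local Notation C := R[i].
Implicit Types (z w : C) (g h s c : 'M[rat]_2) (r t : 'M[Zhat]_2) (f : gl2_fun R).

(** Stable under Gamma1 on both sides and, for D > 0, finite modulo Gamma1 on the left, this set
    replaces the compact subsets of the group modulo Gamma1. *)
Definition hecke (D : nat) (q : rat) : set M2Q := [set g : M2Q | [/\ GL2p g, \det (g : 'M[rat]_2) <= q &
     exists G, D%:R *: (g : 'M[rat]_2) = map_mx intr G]].

Lemma hecke_mul D q D' q' g h : hecke D q g -> hecke D' q' h -> hecke (D * D') (q * q') (g *m h).
Proof.
move=> [gp gq [G DG]] [hp hq [H DH]]; split.
- exact: GL2pM.
- by rewrite det_mulmx ler_pM// ltW.
- by exists (G *m H); rewrite map_mxM -DG -DH -scalemxAl -scalemxAr scalerA natrM.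
Qed.

Lemma hecke_widen D q D' q' : (D %| D')%N -> q <= q' -> hecke D q `<=` hecke D' q'.
Proof.
move=> /dvdnP[k ->] qq g [gp gq [G DG]]; split => //; first exact: le_trans qq.
by exists (k%:R *: G); rewrite natrM -scalerA DG scaler_nat_int.
Qed.

Lemma hecke_Gamma1l D q c g : Gamma1 c -> hecke D q g -> hecke D q (c *m g).
Proof.
move=> cG [gp gq [G DG]]; split.
- by apply: GL2pM => //; exact: Gamma1_GL2p.
- by rewrite det_mulmx (Gamma1_det cG) mul1r.
- by have [K _ ->] := cG; exists (K *m G); rewrite map_mxM -DG scalemxAr.
Qed.

Lemma hecke_Gamma1r D q c g : Gamma1 c -> hecke D q g -> hecke D q (g *m c).
Proof.
move=> cG [gp gq [G DG]]; split.
- by apply: GL2pM => //; exact: Gamma1_GL2p.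
- by rewrite det_mulmx (Gamma1_det cG) mulr1.
- by have [K _ ->] := cG; exists (G *m K); rewrite map_mxM -DG scalemxAl.
Qed.

(** Let n be the determinant of the integer matrix D g. The inverse of g has denominator dividing D
    n, up to the adjugate; as n <= N, the factorial of N serves all g at once, and the inverse has
    determinant D^2 / n <= D^2. *)
Lemma hecke_inv D q : (0 < D)%N -> exists D' q', (0 < D')%N /\ forall g, hecke D q g -> hecke D' q' (invmx g).
Proof.
move=> D0; pose N := (Num.trunc (D%:R ^+ 2 * q)).+1.
exists (D * N`!)%N, (D%:R ^+ 2); split; first by rewrite muln_gt0 D0 fact_gt0.
move=> g [gp gq [G DG]].
have dG : (\det G)%:~R = D%:R ^+ 2 * \det g :> rat by rewrite -detZ DG det_map_mx.
have D2 : 0 < D%:R ^+ 2 :> rat by rewrite exprn_gt0// ltr0n.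
have dG0 : 0 < \det G by rewrite -(ltr0z rat) dG mulr_gt0.
have [n nE] : exists n : nat, \det G = n by exists `|\det G|%N; rewrite gez0_abs// ltW.
have n0 : (0 < n)%N by move: dG0; rewrite nE.
have nN : (n <= N)%N.
  rewrite ltnW// -(ltr_nat rat) pmulrn -nE dG.
  apply: le_lt_trans (_ : D%:R ^+ 2 * q < _); first by rewrite ler_pM2l.
  exact: truncnS_gt.
split.
- exact: GL2pV.
- have -> : \det (invmx g) = D%:R ^+ 2 / n%:R.
    rewrite det_inv; apply: (canRL (mulfK _)); first by rewrite pnatr_eq0 -lt0n.
    by rewrite pmulrn -nE dG mulrCA mulVf ?mulr1// gt_eqF.
  by rewrite ler_pdivrMr ?ltr0n// ler_peMr ?(ltW D2)// ler1n.
have /dvdnP[k kE] : (n %| N`!)%N by rewrite dvdn_fact// n0.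
exists ((k * D ^ 2)%N%:R *: \adj G).
rewrite -scaler_nat_int.
have GU : g \in unitmx := GL2p_unit gp.
have : map_mx intr (\adj G) *m (D%:R *: g) = n%:R%:M.
  by rewrite DG -map_mxM mul_adj_mx nE map_scalar_mx /= pmulrn.
move=> /(congr1 (fun x => x *m invmx g)); rewrite -scalemxAr -scalemxAl mulmxK// mul_scalar_mx => e.
have -> : (k * D ^ 2 = k * D * D)%N by rewrite -mulnA mulnn.
rewrite [(k * D * D)%:R]natrM -scalerA e scalerA; congr (_ *: _).
by rewrite kE !natrM; ring.
Qed.

(** For infinite A, the sets missing only finitely many points of A form a proper filter. A cluster
    point p would have to meet the member A minus p within its neighbourhood reduced to p. *)
Lemma compact_discrete_finite (T : choiceType) (A : set (discrete_topology T)) : compact A -> finite_set A.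
Proof.
move=> cA; apply: contrapT => infA.
pose F : set_system (discrete_topology T) := [set B | finite_set (A `\` B)].
have FF : ProperFilter F.
  split; first by rewrite /F /= setD0.
  split.
  - by rewrite /F /= setDT.
  - by move=> P Q; rewrite /F /= setDIr => fP fQ; rewrite finite_setU.
  - by move=> P Q PQ; apply: sub_finite_set; exact: setDS.
have [|p [Ap]] := cA F FF; first by rewrite /F /= setDv.
have FAp : F (A `\ p) by rewrite /F /= setDD; apply: sub_finite_set (finite_set1 p); exact: subIsetr.
by move=> /(_ _ _ FAp (discrete_set1 p))[x [[_ /= xp] xp']].
Qed.

Lemma common_hecke (A : set M2Q) : finite_set A -> (forall g, A g -> GL2p g) ->
  exists D q, (0 < D)%N /\ A `<=` hecke D q.
Proof.
move=> /finite_seqP[u ->]; elim: u => [|g u IH] hA; first by exists 1%N, 0; split => // x.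
have [|D [q [D0 hu]]] := IH; first by move=> x xu; apply: hA; rewrite /= inE; apply/orP; right.
have [n [G [n0 nG]]] := common_denom g.
exists (D * n)%N, (Num.max q (\det (g : 'M[rat]_2))); split; first by rewrite muln_gt0 D0.
move=> x; rewrite /= inE => /orP[/eqP ->|xu].
  apply: (@hecke_widen n (\det (g : 'M[rat]_2))); first exact: dvdn_mull.
    by rewrite le_max lexx orbT.
  by split => //; [apply: hA; rewrite /= inE eqxx|exists G].
apply: (@hecke_widen D q); first exact: dvdn_mulr.
  by rewrite le_max lexx.
exact: hu.
Qed.

(* The support condition, with the support described modulo the right action only. *)
Definition Ysupp f := exists D q (K : set ('M[Zhat]_2 * C)), [/\ (0 < D)%N, compact K,
  forall q, K q -> uhp q.2 &
  forall g r z, f g r z != 0 -> hecke D q g /\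
    exists c q0, [/\ Gamma1 c, K q0, r = actZ c q0.1 & z = mobius c q0.2]].

(** The compact set has a finite projection to the discrete coordinate, hence a common denominator
    and a bound on determinants. *)
Lemma Ac_Ysupp f : Ac f -> Ysupp f.
Proof.
move=> [_ _ _ _ [K [cK KY hK]]].
pose A : set M2Q := (fun p : M2Q * 'M[Zhat]_2 * C => p.1.1) @` K.
have fA : finite_set A.
  apply: compact_discrete_finite; apply: continuous_compact => //.
  apply: continuous_subspaceT => p; apply: continuous_comp; first exact: cvg_fst.
  exact: cvg_fst.
have [g [p Kp <-]|D [q [D0 AD]]] := common_hecke fA.
  by have := KY _ Kp; case: p {Kp} => [[g' r] z] [].
exists D, q, ((fun p : M2Q * 'M[Zhat]_2 * C => (p.1.2, p.2)) @` K); split => //.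
- apply: continuous_compact => //.
  by apply: continuous_subspaceT; exact: drop_fst_continuous.
- by move=> _ [p Kp <-] /=; have := KY _ Kp; case: p {Kp} => [[g' r] z] [].
move=> g r z /hK[c1 [c2 [k [r0 [z0 [c1G c2G Kk [-> -> ->]]]]]]]; split.
  apply: hecke_Gamma1r; first exact: Gamma1V.
  by apply: hecke_Gamma1l => //; apply: AD; exists (k, r0, z0).
by exists c2, (r0, z0); split => //; exists (k, r0, z0).
Qed.

Lemma integral_closed s : closed [set r | integral_at r s].
Proof.
rewrite -openC openE => r /= nr; apply: not_integral_at_nbhs; exact: nr.
Qed.

(** Converse of [Ac_Ysupp]: the compact subset of Y is rebuilt from finitely many slices, one for
    each coset representative m of the Hecke set, cut down to the closed set where m is integral. *)
Lemma Ac_build f :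
  (forall g r z, ~ Y (g, r, z) -> f g r z = 0) -> Ycont f ->
  (forall c g r z, Gamma1 c -> Y (g, r, z) -> f (c *m g) r z = f g r z) ->
  (forall c g r z, Gamma1 c -> Y (g, actZ c r, mobius c z) ->
    f (g *m c) r z = f g (actZ c r) (mobius c z)) ->
  Ysupp f -> Ac f.
Proof.
move=> off cont left right [D [q [K [D0 cK Kz hK]]]]; split => //; first exact/YcontP.
pose B : set M2Q := Grepr @` (Gcoset @` hecke D q).
have fB : finite_set B by apply/finite_image/finite_hecke.
have Bp m : B m -> GL2p m.
  move=> [_ [g [gp _ _] <-] <-]; have [c cG ->] := GreprP g.
  by apply: GL2pM => //; exact: Gamma1_GL2p.
pose Km (m : M2Q) : set (M2Q * 'M[Zhat]_2 * C) :=
  (fun p : 'M[Zhat]_2 * C => (m, p.1, p.2)) @` (K `&` [set p | integral_at p.1 m]).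
exists (\bigcup_(m in B) Km m); split.
- have [u uE] : exists u : seq M2Q, B = [set` u] by apply/finite_seqP.
  rewrite uE bigcup_seq.
  apply: bigsetU_compact => m _; apply: continuous_compact.
    by apply: continuous_subspaceT; exact: add_fst_continuous.
  apply: compact_closedI => //.
  apply: (@preimage_closed _ _ fst [set r | integral_at r m]); last exact: integral_closed.
  by move=> p _; exact: cvg_fst.
- by move=> _ [m Bm [[r z] [/= Kp mr] <-]]; split => //=; [exact: Bp|exact: (Kz _ Kp)].
move=> g r z f0; have [hg [c [[r0 z0] [cG Kp rE zE]]]] := hK _ _ _ f0.
have [gp gr z0'] : Y (g, r, z) by apply: contrapT => nY; move: f0; rewrite (off _ _ _ nY) eqxx.
(* The factorization sought is g = k^-1 m c^-1, where m = k g c is the representative of the coset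
   of g c. *)
have [k kG kE] := GreprP (g *m c).
exists (invmx k), c, (Grepr (Gcoset (g *m c))), r0, z0; split => //.
- exact: Gamma1V.
- exists (Grepr (Gcoset (g *m c))).
    by exists (Gcoset (g *m c)) => //; exists (g *m c) => //; exact: hecke_Gamma1r.
  exists (r0, z0) => //; split => //=.
  have cp := Gamma1_GL2p cG.
  rewrite kE integral_Gamma1M//; last exact: GL2pM.
  by apply/(integral_comp g cp (integral_Gamma1 r0 cG)); rewrite -rE.
- rewrite kE rE zE /=; congr (_, _, _); rewrite mulmxA mulVmx ?Gamma1_unit// mul1mx.
  by rewrite mulmxK// Gamma1_unit.
Qed.
End support.

(** * Closure of A_c under the operations *)

Section Ac_closed.
Variable R : realType.
Local Notation C := R[i].
Local Open Scope complex_scope.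
Implicit Types (z w : C) (g h s c : 'M[rat]_2) (r t : 'M[Zhat]_2) (f : gl2_fun R).

Lemma Ac_Ycont f : Ac f -> Ycont f.
Proof. by move=> [_ + _ _ _] => /YcontP. Qed.

(** Both sides vanish off Y, which extends the invariance to all arguments. *)
Lemma Ac_leftU f c g r z : Ac f -> Gamma1 c -> f (c *m g) r z = f g r z.
Proof.
move=> fA cG; have [Yg|nY] := pselect (Y (g : M2Q, r, z)); first exact: (Ac_left fA).
rewrite !(Ac_off fA)//; apply: contra_not nY => Yc; exact/(Y_Gamma1M r z g cG).
Qed.

Lemma Ac_rightU f c g r z : Ac f -> Gamma1 c -> uhp z ->
  f (g *m c) r z = f g (actZ c r) (mobius c z).
Proof.
move=> fA cG z0.
have Yc := Y_comp g (Gamma1_GL2p cG) (integral_Gamma1 r cG) z0.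
have [Yg|nY] := pselect (Y (g : M2Q, actZ c r, mobius c z)); first exact: (Ac_right fA).
by rewrite !(Ac_off fA)// => /Yc.
Qed.

Lemma Ysupp_sub f1 f2 : (forall g r z, f2 g r z != 0 -> f1 g r z != 0) -> Ysupp f1 -> Ysupp f2.
Proof.
move=> h [D [q [K [D0 cK Kz hK]]]]; exists D, q, K; split => // g r z /h; exact: hK.
Qed.

Lemma Ac_addP f1 f2 : Ac f1 -> Ac f2 -> Ac (Ac_add f1 f2).
Proof.
move=> A1 A2; apply: Ac_build.
- by move=> g r z nY; rewrite /Ac_add !(Ac_off _ nY)// addr0.
- move=> g r z Yg; exact: ccvgD (Ac_Ycont A1 Yg) (Ac_Ycont A2 Yg).
- by move=> c g r z cG _; rewrite /Ac_add !Ac_leftU.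
- move=> c g r z cG Yg; rewrite /Ac_add !(Ac_right _ cG Yg)//.
have [D1 [q1 [K1 [D10 cK1 Kz1 hK1]]]] := Ac_Ysupp A1.
have [D2 [q2 [K2 [D20 cK2 Kz2 hK2]]]] := Ac_Ysupp A2.
exists (D1 * D2)%N, (Num.max q1 q2), (K1 `|` K2); split.
- by rewrite muln_gt0 D10.
- exact: compactU.
- by move=> q [/Kz1|/Kz2].
move=> g r z; rewrite /Ac_add; have [f10|f10 _] := eqVneq (f1 g r z) 0.
  rewrite f10 add0r => /hK2[hg [c [q0 [cG Kq rE zE]]]]; split; last first.
    by exists c, q0; split => //; right.
  by apply: hecke_widen hg; [exact: dvdn_mull|rewrite le_max lexx orbT].
have [hg [c [q0 [cG Kq rE zE]]]] := hK1 _ _ _ f10; split; last first.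
  by exists c, q0; split => //; left.
by apply: hecke_widen hg; [exact: dvdn_mulr|rewrite le_max lexx].
Qed.

Lemma Ac_mulfun f (u : M2Q -> C) : (forall c g, Gamma1 c -> u (c *m g) = u g) ->
  (forall c g, Gamma1 c -> u (g *m c) = u g) -> Ac f -> Ac (fun g r z => u g * f g r z).
Proof.
move=> ul ur A; apply: Ac_build.
- by move=> g r z nY; rewrite (Ac_off A nY) mulr0.
- move=> g r z Yg; exact: ccvgM (@ccvg_cst _ _ _ _ (u g)) (Ac_Ycont A Yg).
- by move=> c g r z cG _; rewrite Ac_leftU// ul.
- by move=> c g r z cG Yg; rewrite (Ac_right A cG Yg) ur.
apply: Ysupp_sub (Ac_Ysupp A) => g r z.
by apply: contra_neq => ->; rewrite mulr0.
Qed.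

Lemma Ac_scaleP k f : Ac f -> Ac (Ac_scale k f).
Proof. by move=> A; apply: (@Ac_mulfun f (fun=> k)). Qed.

Lemma Ac_evolP (t : R) f : Ac f -> Ac (Ac_evol t f).
Proof.
move=> A; apply: (@Ac_mulfun f (fun g => expi (t * ln (ratr (\det (g : 'M[rat]_2)))))) => //.
  by move=> c g cG; rewrite det_mulmx (Gamma1_det cG) mul1r.
by move=> c g cG; rewrite det_mulmx (Gamma1_det cG) mulr1.
Qed.

Lemma conj_cvg (T : Type) (F : set_system T) (u : T -> C) (a : C) : Filter F ->
  u @ F --> a -> (fun x => (u x)^*) @ F --> a^*.
Proof.
move=> FF /cvgrPdist_lt ua; apply/cvgrPdist_lt => e e0.
by apply: filterS (ua e e0) => x; rewrite -rmorphB norm_conjC.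
Qed.

Lemma Ac_starE f g r z : Y (g : M2Q, r, z) -> Ac_star f g r z = (f (invmx g) (actZ g r) (mobius g z))^*.
Proof. by move=> Yg; rewrite /Ac_star; case: asboolP. Qed.

Lemma Y_inv g r z : Y (g : M2Q, r, z) -> Y (invmx g : M2Q, actZ g r, mobius g z).
Proof.
move=> [/= gp gr z0]; apply/(Y_comp _ gp gr z0); rewrite mulVmx ?GL2p_unit//.
split => //=; first by rewrite /GL2p /= det1.
by exists r; exact: mulQZ1.
Qed.

Lemma act_inv g r z : Y (g : M2Q, r, z) ->
  actZ (invmx g) (actZ g r) = r /\ mobius (invmx g) (mobius g z) = z.
Proof.
move=> [/= gp gr z0]; have gU := GL2p_unit gp; split.
  by rewrite -actZ_comp ?mulVmx ?actZ1//; exists r; exact: mulQZ1.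
by rewrite -mobius_comp ?mulVmx ?mobius1//; exact: GL2pV.
Qed.

Lemma uhp_mobiusV c z : GL2p c -> uhp (mobius c z) -> uhp z.
Proof.
move=> cp; rewrite /uhp /= Im_mobius -mulrA mulrCA; apply: contraTT; rewrite -!leNgt => z0.
by rewrite mulr_le0_ge0// mulr_ge0 ?invr_ge0 ?sqr_ge0// ltW// ltr0q.
Qed.

Lemma act_pair_continuous s (q : 'M[Zhat]_2 * C) : GL2p s -> integral_at q.1 s -> uhp q.2 ->
  (fun q => (actZ s q.1, mobius s q.2)) @ q --> (actZ s q.1, mobius s q.2).
Proof.
case: q => r z sp /= sr z0 A [[P Q] [/= Pr Qz] PQA].
exists (actZ s @^-1` P, mobius s @^-1` Q) => /=.
  by split; [exact: actZ_continuous|exact: mobius_continuous].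
by move=> [r' z'] /= [h1 h2]; apply: (PQA (_, _)).
Qed.

(** For the support: if f does not vanish at (g^-1, g r, g z), then (g r, g z) = c q0 with q0 in the
    compact set K, so (r, z) = g^-1 c q0. Here g^-1 c = k^-1 m with m among finitely many
    representatives, and the new compact set is the union of the images under m of the part of K
    where m is integral. *)
Lemma Ac_starP f : Ac f -> Ac (Ac_star f).
Proof.
move=> A; apply: Ac_build.
- by move=> g r z nY; rewrite /Ac_star; case: asboolP.
- move=> g r z Yg; have [/= gp gr z0] := Yg.
  have -> : Ac_star f g r z = (f (invmx g) (actZ g r) (mobius g z))^* by exact: Ac_starE.
  apply: (@ccvg_near _ _ _ _ _ (fun q => (f (invmx g) (actZ g q.1) (mobius g q.2))^*)).
    by exists (setT, setT) => /=; [split; exact: filterT|move=> [r' z'] _ Y'; exact: Ac_starE].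
  apply: conj_cvg.
  have [_ gr' _] := Y_inv Yg.
  have h := cvg_trans (Ynear_act gp gr Yg) (@Ynear_change _ (g *m invmx g) _ _ (mobius g z) (GL2pV gp) gr').
  by move=> P /(Ac_Ycont A (Y_inv Yg)) hP; exact: (h _ hP).
- move=> c g r z cG Yg; have Yc := (Y_Gamma1M r z g cG).2 Yg; have [/= gp gr z0] := Yg.
  have [_ cgr _] := Yc.
  rewrite !Ac_starE// invmxM ?GL2p_unit ?Gamma1_unit//; last exact: Gamma1_GL2p.
  rewrite actZ_comp// mobius_comp//; last exact: Gamma1_GL2p.
  rewrite -Ac_rightU//; last exact: uhp_mobius.
  by rewrite mulmxKV// Gamma1_unit.
- move=> c g r z cG Yg; have cp := Gamma1_GL2p cG; have cr := integral_Gamma1 r cG.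
  have [/= gp gr z0'] := Yg.
  have z0 := uhp_mobiusV cp z0'.
  have Ygc := (Y_comp g cp cr z0).1 Yg; have [/= gcp gcr _] := Ygc.
  rewrite !Ac_starE// invmxM ?GL2p_unit ?Gamma1_unit//.
  by rewrite Ac_leftU ?actZ_comp ?mobius_comp//; exact: Gamma1V.
have [D [q [K [D0 cK Kz hK]]]] := Ac_Ysupp A.
have [D' [q' [D0' hinv]]] := hecke_inv q D0.
pose B : set M2Q := Grepr @` (Gcoset @` hecke D q).
have fB : finite_set B by apply/finite_image/finite_hecke.
pose Km (m : M2Q) : set ('M[Zhat]_2 * C) := (fun p : 'M[Zhat]_2 * C => (actZ m p.1, mobius m p.2)) @`
   (K `&` [set p | integral_at p.1 m /\ GL2p m]).
exists D', q', (\bigcup_(m in B) Km m); split => //.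
- have [u uE] : exists u : seq M2Q, B = [set` u] by apply/finite_seqP.
  rewrite uE bigcup_seq; apply: bigsetU_compact => m _; apply: continuous_compact.
    apply: continuous_in_subspaceT => p; rewrite inE => -[Kp [mr mp]].
    by apply: act_pair_continuous => //; exact: Kz.
  have [mp|nmp] := pselect (GL2p m); last first.
    rewrite (_ : _ `&` _ = set0); first exact: compact0.
    by apply/seteqP; split => // p [_ [_ /nmp]].
  rewrite (_ : [set p | _] = [set p | integral_at p.1 m]); last first.
    by apply/seteqP; split => [p []|p].
  apply: compact_closedI => //.
  apply: (@preimage_closed _ _ fst [set r | integral_at r m]); last exact: integral_closed.
  by move=> p _; exact: cvg_fst.
- by move=> _ [m Bm [p [Kp [mr mp]] <-]] /=; apply: uhp_mobius => //; exact: Kz.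
move=> g r z f0.
have Yg : Y (g, r, z) by apply: contrapT => nY; move: f0; rewrite /Ac_star; case: asboolP => // _; rewrite eqxx.
have [/= gp gr z0] := Yg.
move: f0; rewrite Ac_starE// conjC_eq0 => /hK[hg [c [q0 [cG Kq rE zE]]]].
split; first by have := hinv _ hg; rewrite invmxK.
have [rE' zE'] := act_inv Yg; have cp := Gamma1_GL2p cG.
have [k kG kE] := GreprP (invmx g *m c); set m := Grepr _ in kE.
have q0z := Kz _ Kq.
have [_ gr' _] := Y_inv Yg.
have icr : integral_at q0.1 (invmx g *m c).
  by apply/(integral_comp _ cp (integral_Gamma1 _ cG)); rewrite -rE.
have icp : GL2p (invmx g *m c) by apply: GL2pM => //; exact: GL2pV.
have mr : integral_at q0.1 m by rewrite kE; apply/integral_Gamma1M.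
have mp : GL2p m by rewrite kE; apply: GL2pM => //; exact: Gamma1_GL2p.
have mE : invmx g *m c = invmx k *m m by rewrite kE mulmxA mulVmx ?mul1mx// Gamma1_unit.
exists (invmx k), (actZ m q0.1, mobius m q0.2); split.
- exact: Gamma1V.
- exists m; first by exists (Gcoset (invmx g *m c)) => //; exists (invmx g *m c) => //; exact: hecke_Gamma1r.
  by exists q0.
- rewrite /= -actZ_comp -?mE//.
  by rewrite actZ_comp -?rE//; exact: integral_Gamma1.
- rewrite /= -mobius_comp -?mE//; last by apply: GL2pV; exact: Gamma1_GL2p.
  by rewrite mobius_comp -?zE//; exact: GL2pV.
Qed.
End Ac_closed.

(** * Convolution of elements of A_c *)

Section convolution.
Variable R : realType.
Local Notation C := R[i].
Local Open Scope complex_scope.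
Implicit Types (z w : C) (g h s c : 'M[rat]_2) (r t : 'M[Zhat]_2) (f : gl2_fun R).

(** A change of variable: right translation by h maps the cosets integral at h r bijectively onto
    those integral at r. *)
Lemma fsum_translate r h (F : M2Q -> C) : GL2p h -> integral_at r h ->
  (forall c s, Gamma1 c -> GL2p s -> F (c *m s) = F s) ->
  \sum_(c \in Yquot r) F (Grepr c) = \sum_(c \in Yquot (actZ h r)) F (Grepr c *m h).
Proof.
move=> hp hr Finv; have hU := GL2p_unit hp.
pose phi (c : set M2Q) : set M2Q := [set (x : 'M[rat]_2) *m h | x in c].
have phiE s : phi (Gcoset s) = Gcoset (s *m h).
  apply/seteqP; split => [_ [_ [k kG <-] <-]|_ [k kG <-]].
    by exists k => //; rewrite mulmxA.
  by exists (k *m s); [exists k|rewrite mulmxA].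
rewrite (reindex_fsbig phi (Yquot (actZ h r))).
  apply: eq_fsbigr => _ /[!inE] -[s [sp sr] <-]; rewrite phiE.
  have [k kG ->] := GreprP (s *m h); have [k' k'G ->] := GreprP s.
  have shp := GL2pM sp hp.
  by rewrite -mulmxA (Finv k)// (Finv k').
split.
- move=> _ [s [sp sr] <-]; rewrite phiE; exists (s *m h) => //.
  by split; [exact: GL2pM|exact/(integral_comp s hp hr)].
- have phiK : cancel phi (fun c : set M2Q => [set (x : 'M[rat]_2) *m invmx h | x in c] : set M2Q).
    move=> c; apply/seteqP; split => [_ [_ [x cx <-] <-]|x cx]; first by rewrite mulmxK.
    by exists (x *m h); [exists x|rewrite mulmxK].
  by move=> c c' _ _; apply: can_inj phiK _ _.
- move=> _ [k [kp kr] <-]; exists (Gcoset (k *m invmx h)); last by rewrite phiE mulmxKV.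
  exists (k *m invmx h) => //; split; first by apply: GL2pM => //; exact: GL2pV.
  by apply/(integral_comp _ hp hr); rewrite mulmxKV.
Qed.

Definition tm f1 f2 g r z s : C := f1 (g *m invmx s) (actZ s r) (mobius s z) * f2 s r z.

Lemma tm_inv f1 f2 g r z c s : Ac f1 -> Ac f2 -> Gamma1 c -> GL2p s ->
  tm f1 f2 g r z (c *m s) = tm f1 f2 g r z s.
Proof.
move=> A1 A2 cG sp; rewrite /tm (Ac_leftU s r z A2 cG).
have [[_ /= sr z0]|nY] := pselect (Y (s : M2Q, r, z)); last by rewrite (Ac_off A2 nY) !mulr0.
congr (_ * _); have cp := Gamma1_GL2p cG.
rewrite actZ_comp//; last exact/(integral_Gamma1M r cG sp).
rewrite mobius_comp// invmxM ?GL2p_unit// mulmxA.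
rewrite -Ac_rightU//; last exact: uhp_mobius.
by rewrite mulmxKV// GL2p_unit.
Qed.

Lemma Ac_mulE f1 f2 g r z : Ac_mul f1 f2 g r z = \sum_(c \in Yquot r) tm f1 f2 g r z (Grepr c).
Proof. by []. Qed.

(** The index set of the convolution varies with r. A fixed finite set of cosets carrying f2 takes
    its place, so that continuity can be checked term by term. *)
Lemma Ac_mul_fin f1 f2 D q : (0 < D)%N -> Ac f2 ->
  (forall g r z, f2 g r z != 0 -> hecke D q g) ->
  forall g r z, Ac_mul f1 f2 g r z =
    \sum_(c <- fset_set (Gcoset @` hecke D q)) tm f1 f2 g r z (Grepr c).
Proof.
move=> D0 A2 hf2 g r z; rewrite Ac_mulE -fsbig_finite; last exact: finite_hecke.
set S := Gcoset @` hecke D q.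
(* Both index sets are compared with their intersection: the terms left out vanish, on one side
   because f2 is zero off Y, on the other by its support. *)
rewrite -(@fsbig_widen _ _ _ _ (Yquot r `&` S) S); last 2 first.
- exact: subIsetr.
- move=> _ [[s hs <-] /= nY]; rewrite /tm.
  have [c cG cE] := GreprP s.
  rewrite (Ac_off A2) ?mulr0// => -[sp sr _]; apply: nY; split; last by exists s.
  by rewrite -(GcosetM s cG) -cE; exists (Grepr (Gcoset s)).
rewrite -(@fsbig_widen _ _ _ _ (Yquot r `&` S) (Yquot r)) => [//||]; first exact: subIsetl.
move=> _ [[s [sp sr] <-] /= nS]; rewrite /tm.
have [->|f20] := eqVneq (f2 (Grepr (Gcoset s)) r z) 0; first by rewrite mulr0.
exfalso; apply: nS; split; first by exists s.
have [c cG cE] := GreprP s.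
rewrite -(GcosetM s cG) -cE; exists (Grepr (Gcoset s)) => //.
exact: hf2 f20.
Qed.

Lemma tm_Y f1 f2 g r z s : Ac f1 -> Ac f2 -> tm f1 f2 g r z s != 0 ->
  [/\ f1 (g *m invmx s) (actZ s r) (mobius s z) != 0, f2 s r z != 0, Y (s : M2Q, r, z) & Y (g : M2Q, r, z)].
Proof.
move=> A1 A2; rewrite /tm mulf_eq0 negb_or => /andP[n1 n2].
have Y2 : Y (s : M2Q, r, z) by apply: contrapT => nY; move: n2; rewrite (Ac_off A2 nY) eqxx.
have Y1 : Y (g *m invmx s : M2Q, actZ s r, mobius s z).
  by apply: contrapT => nY; move: n1; rewrite (Ac_off A1 nY) eqxx.
have [sp sr z0] := Y2; split => //.
by have := (Y_comp (g *m invmx s) sp sr z0).1 Y1; rewrite mulmxKV// GL2p_unit.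
Qed.

Lemma sum_neq0 (I : eqType) (u : seq I) (F : I -> C) : \sum_(i <- u) F i != 0 -> exists2 i, i \in u & F i != 0.
Proof.
move=> h; apply: contrapT => n; move: h; rewrite big_seq big1 ?eqxx// => i iu.
by apply/eqP; apply: contrapT => /negP Fi; apply: n; exists i.
Qed.

(** Where s is not integral it remains so nearby, and the term is locally zero; where it is
    integral, both factors converge by transport along s. *)
Lemma tm_cvg f1 f2 g r z s : Ac f1 -> Ac f2 -> Y (g : M2Q, r, z) ->
  (fun q => tm f1 f2 g q.1 q.2 s) @ Ynear g r z --> tm f1 f2 g r z s.
Proof.
move=> A1 A2 Yg; have [/= gp gr z0] := Yg.
have [[sp sr]|ns] := pselect (GL2p s /\ integral_at r s); last first.
  have -> : tm f1 f2 g r z s = 0 by rewrite /tm (Ac_off A2) ?mulr0// => -[sp sr _]; exact: ns.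
  apply: (@ccvg_near _ _ _ _ _ (fun=> 0)); last exact: ccvg_cst.
  have [sp|nsp] := pselect (GL2p s); last first.
    by near=> q; rewrite /tm (Ac_off A2) ?mulr0// => -[sp _ _]; exact: nsp.
  have nsr : ~ integral_at r s by move=> sr; apply: ns.
  apply: filterS (Ynear_fst g z (not_integral_at_nbhs nsr)) => q nq.
  by rewrite /tm (Ac_off A2) ?mulr0// => -[_ ? _]; exact: nq.
have Ys : Y (s : M2Q, r, z) by split.
have h2 : (fun q => f2 s q.1 q.2) @ Ynear g r z --> f2 s r z.
  have h := @Ynear_change _ g s r z sp sr.
  by move=> P /(Ac_Ycont A2 Ys) hP; exact: (h _ hP).
have Y1 : Y (g *m invmx s : M2Q, actZ s r, mobius s z).
  by apply/(Y_comp _ sp sr z0); rewrite mulmxKV// GL2p_unit.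
have h1 : (fun q => f1 (g *m invmx s) (actZ s q.1) (mobius s q.2)) @ Ynear g r z -->
    f1 (g *m invmx s) (actZ s r) (mobius s z).
  have h := Ynear_act sp sr Yg.
  by move=> P /(Ac_Ycont A1 Y1) hP; exact: (h _ hP).
exact: ccvgM h1 h2.
Unshelve. all: by end_near.
Qed.

Lemma Ac_mulP f1 f2 : Ac f1 -> Ac f2 -> Ac (Ac_mul f1 f2).
Proof.
move=> A1 A2.
have [D1 [q1 [K1 [D10 cK1 Kz1 hK1]]]] := Ac_Ysupp A1.
have [D2 [q2 [K2 [D20 cK2 Kz2 hK2]]]] := Ac_Ysupp A2.
have mulE := Ac_mul_fin f1 D20 A2 (fun g r z (h : f2 g r z != 0) => proj1 (@hK2 g r z h)).
apply: Ac_build.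
- move=> g r z nY; rewrite Ac_mulE fsbig1// => c _; apply/eqP/negPn/negP => t0.
  by apply: nY; have [] := tm_Y A1 A2 t0.
- move=> g r z Yg; rewrite mulE.
  rewrite (_ : (fun q => _) = fun q : 'M[Zhat]_2 * C => \sum_(c <- fset_set (Gcoset @` hecke D2 q2)) tm f1 f2 g q.1 q.2 (Grepr c)); last first.
    by apply/funext => q; rewrite mulE.
  by apply: ccvg_sum => c; exact: tm_cvg.
- move=> c g r z cG Yg; rewrite !Ac_mulE; apply: eq_fsbigr => d _.
  by rewrite /tm -mulmxA Ac_leftU.
- move=> c g r z cG Yg; have cp := Gamma1_GL2p cG; have cr := integral_Gamma1 r cG.
  have [/= gp gr /(uhp_mobiusV cp) z0] := Yg.
  rewrite !Ac_mulE (fsum_translate cp cr); last by move=> k s kG sp; exact: tm_inv.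
  apply: eq_fsbigr => _ /[!inE] -[s' [sp' sr'] <-].
  have [k kG sE] := GreprP s'; set s := Grepr _ in sE *.
  have sp : GL2p s by rewrite sE; apply: GL2pM => //; exact: Gamma1_GL2p.
  have sr : integral_at (actZ c r) s by rewrite sE; apply/integral_Gamma1M.
  rewrite /tm [X in _ * X = _]Ac_rightU//; congr (_ * _).
  rewrite invmxM ?GL2p_unit// mulmxA mulmxK ?Gamma1_unit//.
  by rewrite actZ_comp ?mobius_comp//; exact/integral_comp.
(* The pair (r, z) of a nonzero term is controlled by the support of f2, and g = (g s^-1) s is a
   product of two Hecke elements. *)
exists (D1 * D2)%N, (q1 * q2), K2; split => //; first by rewrite muln_gt0 D10.
move=> g r z; rewrite mulE => /sum_neq0[c _ /(tm_Y A1 A2)[n1 n2 [sp _ _] _]].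
have [h1 _] := hK1 _ _ _ n1; have [h2 h2'] := hK2 _ _ _ n2.
split => //; rewrite -[g](mulmxKV (GL2p_unit sp)).
exact: hecke_mul.
Qed.
End convolution.

(** * The matrix of pi_y *)

Section kernel.
Variables (R : realType) (r : 'M[Zhat]_2) (z : R[i]).
Hypothesis z0 : uhp z.
Local Notation C := R[i].
Local Notation T := (set_type (Yquot r)).
Local Open Scope complex_scope.
Implicit Types (f : gl2_fun R) (c d e : T).

Definition rep c : 'M[rat]_2 := Grepr (set_val c).

Lemma repP c : [/\ GL2p (rep c), integral_at r (rep c) & set_val c = Gcoset (rep c)].
Proof. exact: YquotP. Qed.

Definition ker f c d : C := f (rep c *m invmx (rep d)) (actZ (rep d) r) (mobius (rep d) z).

Lemma pi_yE f xi c : pi_y r z f xi c = \sum_(d \in [set: T]) ker f c d * xi d.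
Proof. by []. Qed.

Lemma ker_Y c d : Y (rep c *m invmx (rep d) : M2Q, actZ (rep d) r, mobius (rep d) z).
Proof.
have [cp cr _] := repP c; have [dp dr _] := repP d.
by apply/(Y_comp _ dp dr z0); rewrite mulmxKV// GL2p_unit.
Qed.

Lemma hecke_cosets_fset D q : (0 < D)%N -> exists F : {fset T}, forall c, hecke D q (rep c) -> c \in F.
Proof.
move=> D0; pose A : set T := [set c | hecke D q (rep c)].
have fA : finite_set A.
  have injv : {in set_val @^-1` (Gcoset @` hecke D q) &, injective (set_val : T -> set M2Q)}.
    by move=> x y _ _; exact: val_inj.
  apply: (sub_finite_set _ (finite_preimage injv (finite_hecke q D0))) => c hc /=.
  by have [_ _ ->] := repP c; exists (rep c).
by exists (fset_set A) => c hc; rewrite in_fset_set// inE.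
Qed.

Lemma ker_hecke f : Ac f -> exists D q, (0 < D)%N /\ forall c d, ker f c d != 0 -> hecke D q (rep c *m invmx (rep d)).
Proof.
move=> /Ac_Ysupp[D [q [K [D0 _ _ hK]]]]; exists D, q; split => // c d /hK[h _]; exact: h.
Qed.

Lemma hecke_self (g : 'M[rat]_2) : GL2p g -> exists n, (0 < n)%N /\ hecke n (\det g) g.
Proof.
by move=> gp; have [n [G [n0 nG]]] := common_denom g; exists n; split => //; split => //; exists G.
Qed.

(** A nonzero entry makes [rep c] the product of a Hecke element and the fixed [rep d], which leaves
    finitely many c. For rows the same is done with inverses. *)
Lemma ker_col f d : Ac f -> exists F : {fset T}, forall c, c \notin F -> ker f c d = 0.
Proof.
move=> /ker_hecke[D [q [D0 hD]]]; have [dp _ _] := repP d; have [n [n0 hn]] := hecke_self dp.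
have [|F hF] := @hecke_cosets_fset (D * n) (q * \det (rep d)); first by rewrite muln_gt0 D0.
exists F => c; apply: contraNeq => /hD h; apply: hF.
by rewrite -[rep c](mulmxKV (GL2p_unit dp)); exact: hecke_mul.
Qed.

Lemma ker_row f c : Ac f -> exists F : {fset T}, forall d, d \notin F -> ker f c d = 0.
Proof.
move=> /ker_hecke[D [q [D0 hD]]]; have [cp _ _] := repP c; have [n [n0 hn]] := hecke_self cp.
have [D' [q' [D0' hinv]]] := hecke_inv q D0.
have [|F hF] := @hecke_cosets_fset (D' * n) (q' * \det (rep c)); first by rewrite muln_gt0 D0'.
exists F => d; apply: contraNeq => /hD/hinv h; apply: hF.
have [dp _ _] := repP d.
move: h; rewrite invmxM ?unitmx_inv ?GL2p_unit// invmxK => h.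
by rewrite -[rep d](mulmxKV (GL2p_unit cp)); exact: hecke_mul.
Qed.

Lemma ker_add f1 f2 c d : ker (Ac_add f1 f2) c d = ker f1 c d + ker f2 c d.
Proof. by []. Qed.

Lemma ker_scale k f c d : ker (Ac_scale k f) c d = k * ker f c d.
Proof. by []. Qed.

Lemma fsum_set_type (I : choiceType) (A : set I) (F : I -> C) :
  \sum_(x \in A) F x = \sum_(x \in [set: set_type A]) F (set_val x).
Proof.
apply: reindex_fsbig; split.
- by move=> x _; exact: set_valP.
- by move=> x y _ _; exact: val_inj.
- by move=> x Ax; exists (SigSub (mem_set Ax)).
Qed.

(** The convolution runs over cosets integral at (rep d) r; translation by [rep d] turns it into a
    sum over the index set of the matrix product. *)
Lemma ker_mul f1 f2 c d : Ac f1 -> Ac f2 ->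
  ker (Ac_mul f1 f2) c d = \sum_(e \in [set: T]) ker f1 c e * ker f2 e d.
Proof.
move=> A1 A2; have [cp cr _] := repP c; have [dp dr _] := repP d; have dU := GL2p_unit dp.
rewrite {1}/ker Ac_mulE.
pose F (k : M2Q) := tm f1 f2 (rep c *m invmx (rep d)) (actZ (rep d) r) (mobius (rep d) z) (k *m invmx (rep d)).
have Finv k s : Gamma1 k -> GL2p s -> F (k *m s) = F s.
  move=> kG sp; rewrite /F -mulmxA tm_inv//; apply: GL2pM => //; exact: GL2pV.
have := fsum_translate dp dr Finv.
under [RHS]eq_fsbigr do rewrite /F mulmxK//.
move=> <-; rewrite fsum_set_type; apply: eq_fsbigr => e _.
have [ep er _] := repP e.
rewrite /F -/(rep e) /tm /ker.
rewrite -actZ_comp ?mulmxKV// -mobius_comp ?mulmxKV//; last by apply: GL2pM => //; exact: GL2pV.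
by rewrite invmxM ?unitmx_inv ?GL2p_unit// invmxK mulmxA mulmxKV.
Qed.

Lemma ker_star f c d : Ac f -> ker (Ac_star f) c d = (ker f d c)^*.
Proof.
move=> A; have [cp cr _] := repP c; have [dp dr _] := repP d; have dU := GL2p_unit dp.
rewrite /ker Ac_starE; last exact: ker_Y.
rewrite -actZ_comp ?mulmxKV// -mobius_comp ?mulmxKV//; last by apply: GL2pM => //; exact: GL2pV.
by rewrite invmxM ?unitmx_inv ?GL2p_unit// invmxK.
Qed.

Lemma expiD (x y : R) : expi (x + y) = expi x * expi y.
Proof. by rewrite /expi cosD sinD; apply/eqP; rewrite eq_complex /=; apply/andP; split; apply/eqP => //; ring. Qed.

Lemma expi0 : expi 0 = 1 :> C.
Proof. by rewrite /expi cos0 sin0. Qed.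

Lemma cmod_expi (x : R) : cmod (expi x) = 1.
Proof.
apply/eqP; rewrite -(@eqrXn2 _ 2)// ?cmod_ge0// cmod_sqr /= expr1n cos2Dsin2//.
Qed.

(** As the determinant is multiplicative, the evolution conjugates the matrix by the diagonal one
    with entries det(rep c)^(it). *)
Lemma ker_evol t f c d : ker (Ac_evol t f) c d =
  expi (t * ln (ratr (\det (rep c)))) * ker f c d * expi (- (t * ln (ratr (\det (rep d))))).
Proof.
have [cp cr _] := repP c; have [dp dr _] := repP d.
rewrite mulrAC -expiD /ker /Ac_evol; congr (expi _ * _).
rewrite det_mulmx det_inv fmorph_div /= ln_div ?posrE ?ltr0q//.
by rewrite mulrBr.
Qed.
End kernel.

(** * Extension by density *)

Section cstar_norm.
Variables (R : realType) (A : cstarAlg R).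
Local Notation C := R[i].
Local Open Scope complex_scope.
Implicit Types a b : A.

Definition nrm a : R := complex.Re `|a|.

Lemma nrmE a : `|a| = (nrm a)%:C.
Proof. by rewrite /nrm RRe_real// ger0_real. Qed.

Lemma nrm_ge0 a : 0 <= nrm a.
Proof. by have := normr_ge0 a; rewrite nrmE -[X in X <= _]/(0%:C) lecR. Qed.

Lemma nrmD a b : nrm (a + b) <= nrm a + nrm b.
Proof. by rewrite -lecR rmorphD /= -!nrmE ler_normD. Qed.

Lemma nrmZ k a : nrm (k *: a) = cmod k * nrm a.
Proof. by apply: complexI; rewrite rmorphM /= -nrmE -cmodE -nrmE normrZ. Qed.

Lemma nrmN a : nrm (- a) = nrm a.
Proof. by rewrite /nrm normrN. Qed.

Lemma nrm0 : nrm 0 = 0.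
Proof. by rewrite /nrm normr0. Qed.

Lemma nrmBC a b : nrm (a - b) = nrm (b - a).
Proof. by rewrite -nrmN opprB. Qed.

Lemma nrmM a b : nrm (cmul a b) <= nrm a * nrm b.
Proof. by rewrite -lecR rmorphM /= -!nrmE cnormM. Qed.

(** By the C*-identity the squared norm of b is at most the product of the norms of [cstar b] and b;
    the involution gives the reverse inequality. *)
Lemma nrm_star a : nrm (cstar a) = nrm a.
Proof.
have h b : nrm b <= nrm (cstar b).
  have [->|b0] := eqVneq (nrm b) 0; first exact: nrm_ge0.
  have bp : 0 < nrm b by rewrite lt_def b0 nrm_ge0.
  have := nrmM (cstar b) b.
  have -> : nrm (cmul (cstar b) b) = nrm b * nrm b.
    by apply: complexI; rewrite -nrmE cstar_norm nrmE expr2 rmorphM.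
  by rewrite ler_pM2r.
by apply/eqP; rewrite eq_le h andbT -{2}[a]cstarK h.
Qed.

Lemma cstarB a b : cstar (a - b) = cstar a - cstar b.
Proof. by rewrite cstarD -scaleN1r cstarZ rmorphN rmorph1 scaleN1r. Qed.

Lemma cmulBl a b c : cmul (a - b) c = cmul a c - cmul b c.
Proof. by rewrite cmulDl -[- b]scaleN1r cmulZl scaleN1r. Qed.

Lemma cmulBr a b c : cmul a (b - c) = cmul a b - cmul a c.
Proof. by rewrite cmulDr -[- c]scaleN1r cmulZr scaleN1r. Qed.

Lemma nrm_dense (D : set A) a e : closure D = [set: A] -> 0 < e -> exists2 b, D b & nrm (a - b) < e.
Proof.
move=> DA e0; have : closure D a by rewrite DA.
have e0' : 0 < e%:C by rewrite -[X in X < _]/(0%:C) ltcR.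
move=> /(_ _ (nbhsx_ballx a _ e0')) [b [Db]].
by rewrite -ball_normE /= nrmE ltcR; exists b.
Qed.
End cstar_norm.

(** The intervals of radius d i around phi i meet pairwise, hence have a common point, the supremum
    of their left ends. This stands in for a limit along approximations. *)
Lemma lipschitz_extension (R : realType) (I : Type) (D : set I) (phi d : I -> R) :
  D !=set0 -> (forall i j, D i -> D j -> `|phi i - phi j| <= d i + d j) ->
  exists w, forall i, D i -> `|w - phi i| <= d i.
Proof.
move=> [i0 Di0] h; pose E := [set phi i - d i | i in D].
have ubE i : D i -> ubound E (phi i + d i).
  by move=> Di _ [j Dj <-]; have := h _ _ Di Dj; rewrite ler_norml => /andP[h1 h2]; lra.
have E0 : E !=set0 by exists (phi i0 - d i0), i0.
have supE : has_sup E by split => //; exists (phi i0 + d i0); exact: ubE.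
exists (sup E) => i Di.
have h1 : phi i - d i <= sup E by apply: sup_ubound; [exact: supE.2|exists i].
have h2 : sup E <= phi i + d i by apply: ge_sup => //; exact: ubE.
by rewrite ler_norml; apply/andP; split; lra.
Qed.

(** The form in which density is used: an error linear in e suffices. The restriction e <= 1 serves
    products, where the norm of an approximation is bounded by that of its limit plus 1. *)
Lemma cmod_small_eqM (R : realType) (x y : R[i]) (K : R) :
  (forall e, 0 < e -> e <= 1 -> cmod (x - y) <= K * e) -> x = y.
Proof.
move=> h; apply: cmod_small_eq => e e0.
have K0 : 0 <= K by have := h 1 ltr01 (lexx _); rewrite mulr1; apply: le_trans; exact: cmod_ge0.
pose e' := Num.min 1 (e / (K + 1)).
have e'0 : 0 < e' by rewrite lt_min ltr01 divr_gt0//; lra.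
have e'1 : e' <= 1 by rewrite ge_min lexx.
apply: le_trans (h _ e'0 e'1) _.
have : e' <= e / (K + 1) by rewrite ge_min lexx orbT.
rewrite ler_pdivlMr; last by lra.
by nra.
Qed.

(** * Extension of a matrix representation from A_c to A *)

Section extension.
Variables (R : realType) (A : cstarAlg R) (iota : gl2_fun R -> A) (hA : is_completion iota).
Variables (V : choiceType) (M : gl2_fun R -> V -> V -> R[i]).
Local Notation C := R[i].
Local Open Scope complex_scope.
Implicit Types (f : gl2_fun R) (a b : A) (xi eta : V -> C) (v w : V).

(** M is kept abstract because the matrix used in the end is indexed by V and not by the cosets. *)
Definition kop f xi v : C := \sum_(w \in [set: V]) M f v w * xi w.

Hypotheses
  (Mrow : forall f v, Ac f -> exists F : {fset V}, forall w, w \notin F -> M f v w = 0)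
  (Mcol : forall f w, Ac f -> exists F : {fset V}, forall v, v \notin F -> M f v w = 0)
  (Madd : forall f1 f2 v w, M (Ac_add f1 f2) v w = M f1 v w + M f2 v w)
  (Mscale : forall k f v w, M (Ac_scale k f) v w = k * M f v w)
  (Mmul : forall f1 f2 v w, Ac f1 -> Ac f2 ->
     M (Ac_mul f1 f2) v w = \sum_(u \in [set: V]) M f1 v u * M f2 u w)
  (Mstar : forall f v w, Ac f -> M (Ac_star f) v w = (M f w v)^*)
  (Mbound : forall f xi, Ac f -> l2 xi -> l2 (kop f xi) /\ hn (kop f xi) <= nrm (iota f) * hn xi).

Lemma kopE f v (F : {fset V}) : (forall w, w \notin F -> M f v w = 0) ->
  forall xi, kop f xi v = \sum_(w <- F) M f v w * xi w.
Proof. by move=> hF xi; apply: fsbigTE => w /hF ->; rewrite mul0r. Qed.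

Lemma kopDr f xi eta : Ac f -> kop f (fun x => xi x + eta x) = (fun x => kop f xi x + kop f eta x).
Proof.
move=> Af; apply/funext => v; have [F hF] := Mrow v Af.
by rewrite !(kopE hF) -big_split /=; apply: eq_bigr => w _; rewrite mulrDr.
Qed.

Lemma kopZr f k xi : Ac f -> kop f (fun x => k * xi x) = (fun x => k * kop f xi x).
Proof.
move=> Af; apply/funext => v; have [F hF] := Mrow v Af.
by rewrite !(kopE hF) mulr_sumr; apply: eq_bigr => w _; rewrite mulrCA.
Qed.

Lemma kopDl f1 f2 xi v : Ac f1 -> Ac f2 -> kop (Ac_add f1 f2) xi v = kop f1 xi v + kop f2 xi v.
Proof.
move=> A1 A2; have [F1 h1] := Mrow v A1; have [F2 h2] := Mrow v A2.
have h1' w : w \notin (F1 `|` F2)%fset -> M f1 v w = 0 by rewrite inE negb_or => /andP[/h1].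
have h2' w : w \notin (F1 `|` F2)%fset -> M f2 v w = 0 by rewrite inE negb_or => /andP[_ /h2].
have h3 w : w \notin (F1 `|` F2)%fset -> M (Ac_add f1 f2) v w = 0.
  by move=> wF; rewrite Madd h1'// h2'// addr0.
rewrite (kopE h1') (kopE h2') (kopE h3) -big_split /=.
by apply: eq_bigr => w _; rewrite Madd mulrDl.
Qed.

Lemma kopZl k f xi v : Ac f -> kop (Ac_scale k f) xi v = k * kop f xi v.
Proof.
move=> Af; have [F hF] := Mrow v Af.
have h' w : w \notin F -> M (Ac_scale k f) v w = 0 by move=> wF; rewrite Mscale hF// mulr0.
by rewrite (kopE hF) (kopE h') mulr_sumr; apply: eq_bigr => w _; rewrite Mscale mulrA.
Qed.

Lemma rows_bounded f (F : {fset V}) : Ac f ->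
  exists G : {fset V}, forall u w, u \in F -> w \notin G -> M f u w = 0.
Proof.
move=> Af; have /choice[H hH] u := Mrow u Af.
exists (\bigcup_(u <- F) H u)%fset => u w uF; apply: contraNeq => Mw.
apply/bigfcupP; exists u; rewrite ?uF//.
by apply: contraT => /hH /eqP; rewrite (negbTE Mw).
Qed.

Lemma kopM f1 f2 xi v : Ac f1 -> Ac f2 -> kop (Ac_mul f1 f2) xi v = kop f1 (kop f2 xi) v.
Proof.
move=> A1 A2; have [F hF] := Mrow v A1; have [G hG] := rows_bounded F A2.
have ME w : M (Ac_mul f1 f2) v w = \sum_(u <- F) M f1 v u * M f2 u w.
  by rewrite Mmul//; apply: fsbigTE => u /hF ->; rewrite mul0r.
have hG' w : w \notin G -> M (Ac_mul f1 f2) v w = 0.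
  by move=> wG; rewrite ME big_seq big1// => u uF; rewrite hG ?mulr0.
rewrite (kopE hG') (kopE hF).
under eq_bigr do rewrite ME mulr_suml.
rewrite exchange_big /=; apply: eq_big_seq => u uF.
rewrite (kopE (fun w => @hG u w uF)) mulr_sumr.
by apply: eq_bigr => w _; rewrite mulrA.
Qed.

(** Finitely many columns involve only finitely many rows, so both inner products are the same
    finite double sum. *)
Lemma kop_star_fin f xi eta (F : {fset V}) : Ac f ->
  l2dot (kop f (cut F xi)) eta = l2dot (cut F xi) (kop (Ac_star f) eta).
Proof.
move=> Af; have /choice[H hH] w := Mcol w Af.
pose G := (\bigcup_(u <- F) H u)%fset.
have hG v w : w \in F -> v \notin G -> M f v w = 0.
  move=> wF; apply: contraNeq => Mw; apply/bigfcupP; exists w; rewrite ?wF//.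
  by apply: contraT => /hH /eqP; rewrite (negbTE Mw).
have kE v : kop f (cut F xi) v = \sum_(w <- F) M f v w * xi w.
  rewrite /kop (@fsbigTE _ _ _ _ F); last by move=> w wF; rewrite /cut (negbTE wF) mulr0.
  by apply: eq_big_seq => w wF; rewrite /cut wF.
have sE w : w \in F -> kop (Ac_star f) eta w = \sum_(v <- G) (M f v w)^* * eta v.
  move=> wF; rewrite (@kopE _ _ G); last by move=> v vG; rewrite Mstar// hG// rmorph0.
  by apply: eq_bigr => v _; rewrite Mstar.
rewrite /l2dot (@csum_fin _ _ G); last first.
  by move=> v vG; rewrite kE big_seq big1 ?mul0r// => w wF; rewrite hG// mul0r.
rewrite (@csum_fin _ _ F); last by move=> v vF; rewrite /cut (negbTE vF) mul0r.
under eq_bigr do rewrite kE mulr_suml.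
rewrite exchange_big /=; apply: eq_big_seq => w wF.
rewrite sE// /cut wF rmorph_sum mulr_sumr; apply: eq_bigr => v _.
transitivity (xi w * (((M f v w)^*)^* * (eta v)^*)); last by rewrite -rmorphM.
by rewrite conjCK; ring.
Qed.

Lemma l2_cut F xi : l2 xi -> l2 (cut F xi).
Proof.
move=> h; have [] // := @l2_hn _ _ (cut F xi) (hn xi) (hn_ge0 _).
move=> G; apply: le_trans (fn_le_hn G h); apply: fnorm_le => x _.
apply/andP; split; first exact: cmod_ge0.
by rewrite /cut; case: (x \in F); [exact: lexx|rewrite cmod0; exact: cmod_ge0].
Qed.

(** Cutting xi to a finite set leaves a tail of norm at most e, which contributes a multiple of e on
    either side. *)
Lemma kop_star f xi eta : Ac f -> l2 xi -> l2 eta ->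
  l2dot (kop f xi) eta = l2dot xi (kop (Ac_star f) eta).
Proof.
move=> Af hxi heta; have Asf := Ac_starP Af.
have [sl2 _] := Mbound Asf heta.
apply: (@cmod_small_eqM _ _ _ (nrm (iota f) * hn eta + hn (kop (Ac_star f) eta))) => e e0 _.
have [F [hF1 hF2]] := hn_tail hxi e0.
have hc := l2_cut F hxi; have [kc _] := Mbound Af hc; have [kt ktn] := Mbound Af hF1.
have xiE : xi = (fun x => cut F xi x + (xi x - cut F xi x)) by apply/funext => x; rewrite addrC subrK.
rewrite [in kop f xi]xiE kopDr// l2dotDl// kop_star_fin//.
rewrite [in X in _ - X]xiE l2dotDl// opprD addrACA subrr add0r.
apply: le_trans (cmodD _ _) _; rewrite cmodN mulrDl lerD//.
  apply: le_trans (l2dot_le kt heta) _.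
  rewrite mulrAC; apply: ler_wpM2r; first exact: hn_ge0.
  by apply: le_trans ktn _; rewrite ler_wpM2l// nrm_ge0.
apply: le_trans (l2dot_le hF1 sl2) _.
by rewrite mulrC ler_wpM2l// hn_ge0.
Qed.

Definition Ac_sub f1 f2 := Ac_add f1 (Ac_scale (-1) f2).

Lemma Ac_subP f1 f2 : Ac f1 -> Ac f2 -> Ac (Ac_sub f1 f2).
Proof. by move=> A1 A2; apply: Ac_addP => //; exact: Ac_scaleP. Qed.

Lemma iotaB f1 f2 : Ac f1 -> Ac f2 -> iota (Ac_sub f1 f2) = iota f1 - iota f2.
Proof.
by move=> A1 A2; rewrite (Defs.iotaD hA)//; [rewrite (Defs.iotaZ hA)// scaleN1r|exact: Ac_scaleP].
Qed.

Lemma kop_sub f1 f2 xi v : Ac f1 -> Ac f2 -> kop (Ac_sub f1 f2) xi v = kop f1 xi v - kop f2 xi v.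
Proof.
by move=> A1 A2; rewrite kopDl//; [rewrite kopZl// mulN1r|exact: Ac_scaleP].
Qed.

Lemma kop_sub_le f1 f2 xi : Ac f1 -> Ac f2 -> l2 xi ->
  l2 (fun v => kop f1 xi v - kop f2 xi v) /\
  hn (fun v => kop f1 xi v - kop f2 xi v) <= nrm (iota f1 - iota f2) * hn xi.
Proof.
move=> A1 A2 hxi; rewrite -iotaB//.
have -> : (fun v => kop f1 xi v - kop f2 xi v) = kop (Ac_sub f1 f2) xi.
  by apply/funext => v; rewrite kop_sub.
by apply: Mbound => //; exact: Ac_subP.
Qed.

Lemma Ac_approx a e : 0 < e -> exists2 f, Ac f & nrm (a - iota f) <= e.
Proof.
move=> e0; have [_ [f Af <-] h] := nrm_dense a (iota_dense hA) e0.
by exists f => //; exact: ltW.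
Qed.

(* The limit of the values [kop f xi v] as [iota f] tends to [a]. *)
Definition ext_op a : op R V := fun xi v =>
  xget 0 [set w | forall f, Ac f -> cmod (w - kop f xi v) <= 2 * nrm (a - iota f) * hn xi].

(** The real and the imaginary part come from two uses of [lipschitz_extension], whence the factor
    2. *)
Lemma ext_opP a f xi v : Ac f -> l2 xi -> cmod (ext_op a xi v - kop f xi v) <= 2 * nrm (a - iota f) * hn xi.
Proof.
move=> Af hxi.
have Ac0 : (@Ac R : set _) !=set0 by exists f.
have lip i j : Ac i -> Ac j -> cmod (kop i xi v - kop j xi v) <= nrm (a - iota i) * hn xi + nrm (a - iota j) * hn xi.
  move=> Ai Aj; have [h1 h2] := kop_sub_le Ai Aj hxi.
  apply: le_trans (cmod_le_hn v h1) _; apply: le_trans h2 _.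
  rewrite -mulrDl ler_wpM2r ?hn_ge0// nrmBC.
  have -> : iota j - iota i = (a - iota i) - (a - iota j) by rewrite opprB [RHS]addrC addrA subrK.
  by apply: le_trans (nrmD _ _) _; rewrite nrmN.
have ReB (x y : C) : complex.Re (x - y) = complex.Re x - complex.Re y by case: x; case: y.
have ImB (x y : C) : complex.Im (x - y) = complex.Im x - complex.Im y by case: x; case: y.
have [|x hx] := @lipschitz_extension R _ (@Ac R) (fun i => complex.Re (kop i xi v)) (fun i => nrm (a - iota i) * hn xi) Ac0.
  by move=> i j Ai Aj; rewrite -ReB; apply: le_trans (Re_le_cmod _) (lip _ _ Ai Aj).
have [|y hy] := @lipschitz_extension R _ (@Ac R) (fun i => complex.Im (kop i xi v)) (fun i => nrm (a - iota i) * hn xi) Ac0.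
  by move=> i j Ai Aj; rewrite -ImB; apply: le_trans (Im_le_cmod _) (lip _ _ Ai Aj).
have := @xgetPex _ 0 [set w | forall f, Ac f -> cmod (w - kop f xi v) <= 2 * nrm (a - iota f) * hn xi].
apply => //; exists (x +i* y) => g Ag; apply: le_trans (cmod_le_ReIm _) _.
rewrite ReB ImB /= -mulrA mulr2n mulrDl mul1r lerD//.
  exact: hx.
exact: hy.
Qed.

(** The pointwise estimate does not sum over V. On a finite set F a second approximation g is
    inserted, so close to a that its pointwise error summed over F is negligible; between g and f
    the operator bound holds, without the factor 2. *)
Lemma ext_op_hn a f xi : Ac f -> l2 xi ->
  l2 (fun v => ext_op a xi v - kop f xi v) /\
  hn (fun v => ext_op a xi v - kop f xi v) <= nrm (a - iota f) * hn xi.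
Proof.
move=> Af hxi; apply: l2_hn; first by rewrite mulr_ge0 ?nrm_ge0 ?hn_ge0.
move=> F; apply/ler_addgt0Pr => e e0.
have K0 : 0 <= #|` F|%:R * (2 * hn xi) + hn xi by rewrite addr_ge0 ?mulr_ge0 ?hn_ge0.
(* K collects the coefficients of the error of g in the estimate; dividing by K + 1 covers K = 0. *)
set K := _ + hn xi in K0.
have [g Ag hg] := Ac_approx a (divr_gt0 e0 (ltr_pwDr ltr01 K0)).
have eK : e / (K + 1) * K <= e.
  by rewrite mulrAC ler_pdivrMr ?ltr_pwDr// ler_wpM2l ?(ltW e0)// lerDl.
have -> : (fun v => ext_op a xi v - kop f xi v) = (fun v => (ext_op a xi v - kop g xi v) + (kop g xi v - kop f xi v)).
  by apply/funext => v; rewrite addrA subrK.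
apply: le_trans (fnD _ _ _) _.
have [h1 h2] := kop_sub_le Ag Af hxi.
have h3 : fn F (fun v => ext_op a xi v - kop g xi v) <= #|` F|%:R * (2 * (e / (K + 1)) * hn xi).
  apply: fn_unif; first by rewrite !mulr_ge0 ?hn_ge0 ?invr_ge0 ?(ltW e0)// addr_ge0.
  move=> v _; apply: le_trans (ext_opP _ _ Ag hxi) _.
  by rewrite ler_wpM2r ?hn_ge0// ler_wpM2l.
have h4 : fn F (fun v => kop g xi v - kop f xi v) <= (e / (K + 1) + nrm (a - iota f)) * hn xi.
  apply: le_trans (fn_le_hn F h1) _; apply: le_trans h2 _.
  rewrite ler_wpM2r ?hn_ge0//.
  have -> : iota g - iota f = - (a - iota g) + (a - iota f) by rewrite opprB addrA subrK.
  by apply: le_trans (nrmD _ _) _; rewrite nrmN lerD.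
apply: le_trans (lerD h3 h4) _; move: (e / (K + 1)) eK => e' eK.
have -> : #|` F|%:R * (2 * e' * hn xi) + (e' + nrm (a - iota f)) * hn xi = nrm (a - iota f) * hn xi + e' * K.
  by rewrite /K; ring.
by rewrite lerD2l.
Qed.

Lemma ext_op_l2 a xi : l2 xi -> l2 (ext_op a xi).
Proof.
move=> hxi; have [f Af _] := Ac_approx a ltr01.
have [h1 _] := ext_op_hn a Af hxi; have [h2 _] := Mbound Af hxi.
have := (l2D h1 h2).1; congr l2; apply/funext => v; exact: subrK.
Qed.

Lemma ext_op_bound a : exists K : R, forall xi, l2 xi -> hn (ext_op a xi) <= K * hn xi.
Proof.
have [f Af _] := Ac_approx a ltr01; exists (nrm (a - iota f) + nrm (iota f)) => xi hxi.
have [h1 h1'] := ext_op_hn a Af hxi; have [h2 h2'] := Mbound Af hxi.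
have := (l2D h1 h2).2; rewrite (_ : (fun x => _) = ext_op a xi); last first.
  by apply/funext => v; exact: subrK.
by move=> h; apply: le_trans h _; rewrite mulrDl lerD.
Qed.

Lemma ext_op_iota f xi : Ac f -> l2 xi -> ext_op (iota f) xi = kop f xi.
Proof.
move=> Af hxi; apply/funext => v; apply: (@cmod_small_eqM _ _ _ 0) => e _ _.
by rewrite mul0r; have := ext_opP (iota f) v Af hxi; rewrite subrr nrm0 mulr0 mul0r.
Qed.

(** Here x' and y' are the two sides of an identity on A_c, where it is known; x and y are the sides
    to be compared over A. *)
Lemma cmod_triangle4 (x y x' y' : C) : x' = y' -> cmod (x - y) <= cmod (x - x') + cmod (y - y').
Proof.
move=> e; have -> : x - y = (x - x') - (y - y') by rewrite e; ring.
by apply: le_trans (cmodD _ _) _; rewrite cmodN.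
Qed.

Lemma ext_opDr a xi eta : l2 xi -> l2 eta ->
  ext_op a (fun x => xi x + eta x) = (fun x => ext_op a xi x + ext_op a eta x).
Proof.
move=> h1 h2; apply/funext => v; have [h3 _] := l2D h1 h2.
apply: (@cmod_small_eqM _ _ _ (2 * hn (fun x => xi x + eta x) + (2 * hn xi + 2 * hn eta))) => e e0 _.
have [f Af hf] := Ac_approx a e0.
have E := congr1 (fun u => u v) (kopDr xi eta Af).
apply: le_trans (cmod_triangle4 _ _ E) _.
have := ext_opP a v Af h3; have := ext_opP a v Af h1; have := ext_opP a v Af h2.
rewrite opprD addrACA /=.
have := cmodD (ext_op a xi v - kop f xi v) (ext_op a eta v - kop f eta v).
have := ler_wpM2r (hn_ge0 xi) hf; have := ler_wpM2r (hn_ge0 eta) hf.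
have := ler_wpM2r (hn_ge0 (fun x => xi x + eta x)) hf; lra.
Qed.

Lemma ext_opZr a k xi : l2 xi -> ext_op a (fun x => k * xi x) = (fun x => k * ext_op a xi x).
Proof.
move=> h1; apply/funext => v; have [h3 _] := l2Z k h1.
apply: (@cmod_small_eqM _ _ _ (2 * hn (fun x => k * xi x) + cmod k * (2 * hn xi))) => e e0 _.
have [f Af hf] := Ac_approx a e0.
have E := congr1 (fun u => u v) (kopZr k xi Af).
apply: le_trans (cmod_triangle4 _ _ E) _; rewrite /= -mulrBr cmodM mulrDl lerD//.
  apply: le_trans (ext_opP a v Af h3) _; rewrite mulrAC ler_wpM2l//.
  by rewrite mulr_ge0 ?hn_ge0.
rewrite -mulrA ler_wpM2l ?cmod_ge0//.
by apply: le_trans (ext_opP a v Af h1) _; rewrite mulrAC ler_wpM2l// mulr_ge0 ?hn_ge0.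
Qed.

Lemma ext_opDl a b xi : l2 xi -> ext_op (a + b) xi = (fun x => ext_op a xi x + ext_op b xi x).
Proof.
move=> h1; apply/funext => v.
apply: (@cmod_small_eqM _ _ _ (8 * hn xi)) => e e0 _.
have [f Af hf] := Ac_approx a e0; have [g Ag hg] := Ac_approx b e0.
apply: le_trans (cmod_triangle4 _ _ (kopDl xi v Af Ag)) _.
rewrite opprD addrACA; have := cmodD (ext_op a xi v - kop f xi v) (ext_op b xi v - kop g xi v).
have := ext_opP (a + b) v (Ac_addP Af Ag) h1; have := ext_opP a v Af h1; have := ext_opP b v Ag h1.
rewrite (Defs.iotaD hA)// opprD.
have := ler_wpM2r (hn_ge0 xi) (nrmD (a - iota f) (b - iota g)); rewrite [a - iota f + _]addrACA mulrDl.
have := ler_wpM2r (hn_ge0 xi) hf; have := ler_wpM2r (hn_ge0 xi) hg; lra.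
Qed.

Lemma ext_opZl k a xi : l2 xi -> ext_op (k *: a) xi = (fun x => k * ext_op a xi x).
Proof.
move=> h1; apply/funext => v.
apply: (@cmod_small_eqM _ _ _ (4 * cmod k * hn xi)) => e e0 _.
have [f Af hf] := Ac_approx a e0.
apply: le_trans (cmod_triangle4 _ _ (kopZl k xi v Af)) _.
rewrite -mulrBr cmodM.
have := ext_opP (k *: a) v (Ac_scaleP k Af) h1.
rewrite (Defs.iotaZ hA)// -scalerBr nrmZ.
have := ler_wpM2l (cmod_ge0 k) (ext_opP a v Af h1).
have : cmod k * nrm (a - iota f) * hn xi <= cmod k * e * hn xi.
  by rewrite ler_wpM2r ?hn_ge0// ler_wpM2l ?cmod_ge0.
lra.
Qed.

(** With f and g close to a and b, a b - f g = (a - f) b + f (b - g), and the norm of f is at most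
    that of a plus 1, so the error is linear in e. *)
Lemma ext_opM a b xi : l2 xi -> ext_op (cmul a b) xi = ext_op a (ext_op b xi).
Proof.
move=> h1; apply/funext => v; have h2 := ext_op_l2 b h1.
apply: (@cmod_small_eqM _ _ _ (2 * (nrm b + (nrm a + 1)) * hn xi + (2 * hn (ext_op b xi) + (nrm a + 1) * hn xi))) => e e0 e1.
have [f Af hf] := Ac_approx a e0; have [g Ag hg] := Ac_approx b e0.
have [h3 h3'] := ext_op_hn b Ag h1.
apply: le_trans (cmod_triangle4 _ _ (kopM xi v Af Ag)) _; rewrite mulrDl; apply: lerD.
  apply: le_trans (ext_opP _ v (Ac_mulP Af Ag) h1) _; rewrite (Defs.iotaM hA)//.
  rewrite -!mulrA ler_wpM2l// mulrCA [leLHS]mulrC ler_wpM2l ?hn_ge0//.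
  have -> : cmul a b - cmul (iota f) (iota g) = cmul (a - iota f) b + cmul (iota f) (b - iota g).
    by rewrite cmulBl cmulBr addrA subrK.
  apply: le_trans (nrmD _ _) _; rewrite mulrDl lerD//; apply: le_trans (nrmM _ _) _.
    by rewrite mulrC ler_wpM2l ?nrm_ge0.
  apply: ler_pM; rewrite ?nrm_ge0//.
  have -> : iota f = - (a - iota f) + a by rewrite opprB subrK.
  by apply: le_trans (nrmD _ _) _; rewrite nrmN addrC lerD2l (le_trans hf).
have -> : ext_op a (ext_op b xi) v - kop f (kop g xi) v =
  (ext_op a (ext_op b xi) v - kop f (ext_op b xi) v) + kop f (fun x => ext_op b xi x - kop g xi x) v.
  have -> : (fun x => ext_op b xi x - kop g xi x) = (fun x => ext_op b xi x + -1 * kop g xi x).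
    by apply/funext => x; rewrite mulN1r.
  by rewrite kopDr// kopZr// mulN1r addrA subrK.
apply: le_trans (cmodD _ _) _; rewrite mulrDl lerD//.
  apply: le_trans (ext_opP a v Af h2) _; rewrite mulrAC ler_wpM2l// mulr_ge0 ?hn_ge0//.
have [h4 h4'] := Mbound Af h3; apply: le_trans (cmod_le_hn v h4) _; apply: le_trans h4' _.
rewrite -mulrA; apply: ler_pM; rewrite ?nrm_ge0 ?hn_ge0//.
  have -> : iota f = - (a - iota f) + a by rewrite opprB subrK.
  by apply: le_trans (nrmD _ _) _; rewrite nrmN addrC lerD2l (le_trans hf).
by apply: le_trans h3' _; rewrite mulrC ler_wpM2l ?hn_ge0.
Qed.

Lemma ext_op_star a xi eta : l2 xi -> l2 eta ->
  l2dot (ext_op a xi) eta = l2dot xi (ext_op (cstar a) eta).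
Proof.
move=> h1 h2.
apply: (@cmod_small_eqM _ _ _ (2 * (hn xi * hn eta))) => e e0 _.
have [f Af hf] := Ac_approx a e0; have Asf := Ac_starP Af.
apply: le_trans (cmod_triangle4 _ _ (kop_star Af h1 h2)) _.
have hsf : nrm (cstar a - iota (Ac_star f)) <= e by rewrite (Defs.iota_star hA)// -cstarB nrm_star.
have [k1 _] := Mbound Af h1; have [k2 _] := Mbound Asf h2.
have [d1 d1'] := ext_op_hn a Af h1; have [d2 d2'] := ext_op_hn (cstar a) Asf h2.
have e1 : (fun v => ext_op a xi v - kop f xi v + kop f xi v) = ext_op a xi.
  by apply/funext => v; exact: subrK.
have := l2dotDl d1 k1 h2; rewrite e1 => ->; rewrite addrK.
have e2 : (fun v => ext_op (cstar a) eta v - kop (Ac_star f) eta v + kop (Ac_star f) eta v) = ext_op (cstar a) eta.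
  by apply/funext => v; exact: subrK.
have := l2dotDr h1 d2 k2; rewrite e2 => ->; rewrite addrK.
rewrite -mulrA mulr2n mulrDl mul1r; apply: lerD.
  apply: le_trans (l2dot_le d1 h2) _; rewrite mulrAC; apply: ler_wpM2r; first exact: hn_ge0.
  by apply: le_trans d1' _; rewrite mulrC ler_wpM2l ?hn_ge0.
apply: le_trans (l2dot_le h1 d2) _; rewrite -mulrA; apply: ler_wpM2l; first exact: hn_ge0.
by apply: le_trans d2' _; rewrite mulrC ler_wpM2l ?hn_ge0.
Qed.

Lemma ext_op_repr : star_representation ext_op.
Proof.
split.
- move=> a; split.
  + by move=> xi; exact: ext_op_l2.
  + by move=> xi eta; exact: ext_opDr.
  + by move=> k xi; exact: ext_opZr.
  + have [K hK] := ext_op_bound a; exists K => xi hxi.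
    by rewrite !l2normE -?EFinM ?lee_fin ?hK//; exact: ext_op_l2.
- by move=> a b xi; exact: ext_opDl.
- by move=> k a xi; exact: ext_opZl.
- by move=> a b xi; exact: ext_opM.
- by move=> a xi eta; exact: ext_op_star.
Qed.

Lemma l2_unimodular (u xi : V -> C) : (forall v, cmod (u v) <= 1) -> l2 xi ->
  l2 (fun v => u v * xi v) /\ hn (fun v => u v * xi v) <= hn xi.
Proof.
move=> hu hxi; apply: l2_hn (hn_ge0 _) _ => F; apply: le_trans (fn_le_hn F hxi).
apply: fnorm_le => v _; apply/andP; split; first exact: cmod_ge0.
by rewrite cmodM ler_piMl ?cmod_ge0.
Qed.

(** As s is isometric, f close to a gives S f equally close to s a; multiplication by functions of
    modulus at most 1 does not enlarge the errors. *)
Lemma ext_op_intertwine (s : A -> A) (S : gl2_fun R -> gl2_fun R) (u u' : V -> C) :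
  (forall a b, s (a - b) = s a - s b) -> (forall a, nrm (s a) = nrm a) ->
  (forall f, Ac f -> Ac (S f) /\ s (iota f) = iota (S f)) ->
  (forall v, cmod (u v) <= 1) -> (forall v, cmod (u' v) <= 1) ->
  (forall f xi v, Ac f -> kop (S f) xi v = u v * kop f (fun w => u' w * xi w) v) ->
  forall a xi, l2 xi -> ext_op (s a) xi = (fun v => u v * ext_op a (fun w => u' w * xi w) v).
Proof.
move=> sB sn sS hu hu' kS a xi hxi; apply/funext => v.
have [l2u hnu] := l2_unimodular hu' hxi.
apply: (@cmod_small_eqM _ _ _ (4 * hn xi)) => e e0 _.
have [f Af hf] := Ac_approx a e0; have [ASf sf] := sS f Af.
apply: le_trans (cmod_triangle4 _ _ (kS f xi v Af)) _.
have -> : 4 * hn xi * e = 2 * e * hn xi + 2 * e * hn xi by ring.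
apply: lerD.
  apply: le_trans (ext_opP (s a) v ASf hxi) _.
  by rewrite -sf -sB sn ler_wpM2r ?hn_ge0// ler_wpM2l.
rewrite -mulrBr cmodM; apply: le_trans (_ : cmod (ext_op a (fun w => u' w * xi w) v - kop f (fun w => u' w * xi w) v) <= _).
  by rewrite ler_piMl ?cmod_ge0.
apply: le_trans (ext_opP a v Af l2u) _.
apply: ler_pM => //; rewrite ?mulr_ge0 ?nrm_ge0 ?hn_ge0//.
by rewrite ler_wpM2l.
Qed.
End extension.

(** * A nonzero element of A_c *)

Section height.
Variable R : realType.
Local Notation C := R[i].
Local Open Scope complex_scope.
Implicit Types (z w : C) (c g : 'M[rat]_2).

Definition orbit_im z : set R := [set complex.Im (mobius c z) | c in [set c : M2Q | Gamma1 c]].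

(** A continuous function on the upper half-plane, invariant under Gamma1, whose sublevel sets are
    compact modulo Gamma1: this is what a bump function needs. *)
Definition height z : R := sup (orbit_im z).

Lemma Gamma1_im c z : Gamma1 c -> complex.Im (mobius c z) = complex.Im z / cmod (mden c z) ^+ 2.
Proof. by move=> /Gamma1_det dc; rewrite Im_mobius dc rmorph1 mul1r. Qed.

Lemma mden_ge c z : uhp z -> `|ratr (c 1 0)| * complex.Im z <= cmod (mden c z).
Proof.
move=> z0; apply: le_trans (Im_le_cmod _); rewrite /mden Im_affine [leRHS]normrM.
by rewrite (gtr0_norm z0).
Qed.

Lemma cmod_mden_gt0 c z : GL2p c -> uhp z -> 0 < cmod (mden c z).
Proof. by move=> cp z0; rewrite lt_def cmod_ge0 cmod_eq0 mden_neq0. Qed.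

(** The lower row (c, d) is integral and nonzero: if c is nonzero, then |Im (c z + d)| >= Im z, and
    otherwise |c z + d| = |d| >= 1. *)
Lemma mden_unit_ge c z : Gamma1 c -> uhp z -> Num.min 1 (complex.Im z) <= cmod (mden c z).
Proof.
move=> cG z0; have [G dG cE] := cG.
have [c0|c0] := eqVneq (G 1 0) 0; last first.
  rewrite ge_min; apply/orP; right; apply: le_trans (mden_ge c z0).
  rewrite ler_peMl ?(ltW z0)// cE mxE ratr_int -intr_norm ler1z.
  by rewrite -gtz0_ge1 normr_gt0.
have d0 : G 1 1 != 0 by apply/eqP => d0; move: dG; rewrite det2 c0 d0 !mulr0 subr0.
rewrite ge_min; apply/orP; left; apply: le_trans (Re_le_cmod _).
rewrite /mden Re_affine cE !mxE c0 rmorph0 mul0r add0r ratr_int -intr_norm ler1z.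
by rewrite -gtz0_ge1 normr_gt0.
Qed.

Lemma has_sup_orbit z : uhp z -> has_sup (orbit_im z).
Proof.
move=> z0; split.
  by exists (complex.Im z); exists 1%:M; [exact: Gamma1_1|rewrite mobius1].
have m0 : 0 < Num.min 1 (complex.Im z) by rewrite lt_min ltr01.
exists (complex.Im z / Num.min 1 (complex.Im z) ^+ 2) => _ [c cG <-].
rewrite Gamma1_im// ler_wpM2l ?(ltW z0)// lef_pV2 ?posrE ?exprn_gt0 ?cmod_mden_gt0//; last exact: Gamma1_GL2p.
by rewrite ler_pXn2r ?nnegrE ?cmod_ge0 ?(ltW m0)// mden_unit_ge.
Qed.

Lemma im_le_height c z : uhp z -> Gamma1 c -> complex.Im (mobius c z) <= height z.
Proof. by move=> z0 cG; apply: sup_ubound; [exact: (has_sup_orbit z0).2|exists c]. Qed.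

Lemma height_gt0 z : uhp z -> 0 < height z.
Proof. by move=> z0; apply: lt_le_trans (im_le_height z0 Gamma1_1); rewrite mobius1. Qed.

Lemma height_inv c z : uhp z -> Gamma1 c -> height (mobius c z) = height z.
Proof.
move=> z0 cG; congr sup; have cp := Gamma1_GL2p cG.
apply/seteqP; split => [_ [k kG <-]|_ [k kG <-]].
  by exists (k *m c); [exact: Gamma1M|rewrite mobius_comp//; exact: Gamma1_GL2p].
exists (k *m invmx c); first by apply: Gamma1M => //; exact: Gamma1V.
have kcp : GL2p (k *m invmx c) by apply: GL2pM; [exact: Gamma1_GL2p|exact: GL2pV].
by rewrite -mobius_comp ?mulmxKV ?GL2p_unit.
Qed.

(** Since |c| Im z <= |c z + d|, the relative error is t whatever the row (c, d); this uniformity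
    lets the estimate pass to the supremum. *)
Lemma mden_near c z w t : uhp z -> cmod (w - z) <= t * complex.Im z ->
  cmod (mden c w - mden c z) <= t * cmod (mden c z).
Proof.
move=> z0 wz.
have -> : mden c w - mden c z = ratr (c 1 0) * (w - z) by rewrite /mden; ring.
rewrite cmodM ratr_complex cmod_real; apply: le_trans (ler_wpM2l (normr_ge0 _) wz) _.
have t0 : 0 <= t by rewrite -(pmulr_lge0 _ z0) (le_trans _ wz)// cmod_ge0.
by rewrite mulrCA ler_wpM2l// mden_ge.
Qed.

Lemma im_near z w t : cmod (w - z) <= t * complex.Im z ->
  (1 - t) * complex.Im z <= complex.Im w <= (1 + t) * complex.Im z.
Proof.
move=> wz; have := le_trans (Im_le_cmod (w - z)) wz.
have -> : complex.Im (w - z) = complex.Im w - complex.Im z by case: w {wz} => ? ?; case: z.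
by rewrite ler_norml => /andP[h1 h2]; apply/andP; split; lra.
Qed.

Lemma im_mobius_near c z w t : Gamma1 c -> uhp z -> uhp w -> 0 < t -> t <= 4^-1 ->
  cmod (w - z) <= t * complex.Im z ->
  complex.Im (mobius c w) <= (1 + 8 * t) * complex.Im (mobius c z) /\
  complex.Im (mobius c z) <= (1 + 8 * t) * complex.Im (mobius c w).
Proof.
move=> cG z0 w0 t0 t4 wz; have cp := Gamma1_GL2p cG.
have /andP[i1 i2] := im_near wz.
have dwz := mden_near c z0 wz.
have D0 := cmod_mden_gt0 cp z0; have E0 := cmod_mden_gt0 cp w0.
have e1 : cmod (mden c w) <= (1 + t) * cmod (mden c z).
  have := cmodD (mden c w - mden c z) (mden c z); rewrite subrK; lra.
have e2 : (1 - t) * cmod (mden c z) <= cmod (mden c w).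
  have := cmodD (mden c w) (- (mden c w - mden c z)); rewrite cmodN opprB [mden c w + _]addrC subrK; lra.
have z0' : 0 < complex.Im z := z0; have w0' : 0 < complex.Im w := w0.
rewrite !Gamma1_im//; move: D0 E0 e1 e2 i1 i2 z0' w0' {dwz wz}.
move: (cmod _) (cmod _) (complex.Im z) (complex.Im w) => E D x y D0 E0 e1 e2 i1 i2 x0 y0.
have sq1 : ((1 - t) * D) ^+ 2 <= E ^+ 2 by rewrite ler_pXn2r// nnegrE; nra.
have sq2 : E ^+ 2 <= ((1 + t) * D) ^+ 2 by rewrite ler_pXn2r// nnegrE; nra.
rewrite !mulrA !ler_pdivrMr ?exprn_gt0// ![_ / _ * _]mulrAC !ler_pdivlMr ?exprn_gt0//.
have D2 : 0 < D ^+ 2 by rewrite exprn_gt0.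
(* These two inequalities, valid for t <= 1/4, determine the constant 8. *)
have c1 : 1 + t <= (1 + 8 * t) * (1 - t) ^+ 2 by nra.
have c2 : (1 + t) ^+ 2 <= (1 + 8 * t) * (1 - t) by nra.
split.
  apply: le_trans (_ : (1 + t) * x * D ^+ 2 <= _); first by rewrite ler_wpM2r// ltW.
  apply: le_trans (_ : (1 + 8 * t) * x * ((1 - t) * D) ^+ 2 <= _); last first.
    by rewrite ler_wpM2l// mulr_ge0// ?(ltW x0)//; lra.
  have -> : (1 + 8 * t) * x * ((1 - t) * D) ^+ 2 = (1 + 8 * t) * (1 - t) ^+ 2 * (x * D ^+ 2) by ring.
  by rewrite -mulrA ler_wpM2r// mulr_ge0// ltW.
apply: le_trans (_ : x * ((1 + t) * D) ^+ 2 <= _); first by rewrite ler_wpM2l// ltW.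
apply: le_trans (_ : (1 + 8 * t) * ((1 - t) * x) * D ^+ 2 <= _); last first.
  by rewrite ler_wpM2r ?(ltW D2)// ler_wpM2l//; lra.
have -> : (1 + 8 * t) * ((1 - t) * x) * D ^+ 2 = (1 + 8 * t) * (1 - t) * (x * D ^+ 2) by ring.
have -> : x * ((1 + t) * D) ^+ 2 = (1 + t) ^+ 2 * (x * D ^+ 2) by ring.
by rewrite ler_wpM2r// mulr_ge0// ltW.
Qed.

(** The constant is 24 = 8 x 3: one direction bounds the difference by 8 t height w, and height w <=
    (1 + 8 t) height z <= 3 height z. *)
Lemma height_near z w t : uhp z -> uhp w -> 0 < t -> t <= 4^-1 ->
  cmod (w - z) <= t * complex.Im z -> `|height w - height z| <= 24 * t * height z.
Proof.
move=> z0 w0 t0 t4 wz.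
have h1 : height w <= (1 + 8 * t) * height z.
  apply: ge_sup => [|_ [c cG <-]]; first exact: (has_sup_orbit w0).1.
  have [h _] := im_mobius_near cG z0 w0 t0 t4 wz; apply: le_trans h _.
  by rewrite ler_wpM2l ?im_le_height//; lra.
have h2 : height z <= (1 + 8 * t) * height w.
  apply: ge_sup => [|_ [c cG <-]]; first exact: (has_sup_orbit z0).1.
  have [_ h] := im_mobius_near cG z0 w0 t0 t4 wz; apply: le_trans h _.
  by rewrite ler_wpM2l ?im_le_height//; lra.
have := height_gt0 z0; have := height_gt0 w0; move: h1 h2.
move: (height z) (height w) => x y h1 h2 y0 x0.
rewrite ler_norml; apply/andP; split; nra.
Qed.
End height.

(** * Fundamental domain and bump functions *)

Section bump.
Variable R : realType.
Local Notation C := R[i].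
Local Open Scope complex_scope.
Implicit Types (z w : C) (c g : 'M[rat]_2).

Lemma cmod_ball_nbhs z (d : R) : 0 < d -> nbhs z [set w | cmod (w - z) < d].
Proof.
move=> d0; have d0' : 0 < d%:C by rewrite -[X in X < _]/(0%:C) ltcR.
apply: filterS (nbhsx_ballx z _ d0') => w.
by rewrite -ball_normE /= distrC cmodE ltcR.
Qed.

Lemma rect_continuous : continuous (fun p : R * R => p.1 +i* p.2 : C).
Proof.
move=> [x y]; apply/cvgrPdist_lt => e e0.
have eE : e = (complex.Re e)%:C by rewrite RRe_real// ger0_real// ltW.
have re0 : 0 < complex.Re e by move: e0; rewrite eE -[X in X < _]/(0%:C) ltcR.
have e2 : 0 < complex.Re e / 2 by rewrite divr_gt0.
exists (ball x (complex.Re e / 2), ball y (complex.Re e / 2)) => /=.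
  by split; exact: nbhsx_ballx.
move=> [x' y'] /= []; rewrite -!ball_normE /= => hx hy.
rewrite cmodE [X in _ < X]eE ltcR; apply: le_lt_trans (cmod_le_ReIm _) _ => /=.
by move: hx hy; lra.
Qed.

Lemma rect_compact (a b a' b' : R) :
  compact [set z : C | a <= complex.Re z <= b /\ a' <= complex.Im z <= b'].
Proof.
have -> : [set z : C | a <= complex.Re z <= b /\ a' <= complex.Im z <= b'] =
   (fun p : R * R => p.1 +i* p.2) @` (`[a, b]%classic `*` `[a', b']%classic).
  apply/seteqP; split => [[x y] /= [h1 h2]|_ [[x y] /= [h1 h2] <-]] /=.
    by exists (x, y) => //=; split; rewrite /= in_itv.
  by move: h1 h2; rewrite !in_itv /=.
apply: continuous_compact; first by apply: continuous_subspaceT; exact: rect_continuous.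
by apply: compact_setX; exact: segment_compact.
Qed.

Lemma Gamma1_mx2 (a b c d : int) : a * d - b * c = 1 -> Gamma1 (mx2 a%:~R b%:~R c%:~R d%:~R : 'M[rat]_2).
Proof. by move=> e; exists (mx2 a b c d); rewrite ?det_mx2// mx2_map. Qed.

(** The supremum is only approached, so the classical argument is run with slack. A point w of the
    orbit with Im w above 9/10 of the height is translated to |Re w| <= 1/2. Inversion cannot lift
    it above the height, so |w|^2 > 9/10, and (Im w)^2 > 13/20 > (4/5)^2. *)
Lemma reduction z : uhp z -> exists2 c, Gamma1 c &
  - 2^-1 <= complex.Re (mobius c z) <= 2^-1 /\ 4 / 5 <= complex.Im (mobius c z).
Proof.
move=> z0; have h0 := height_gt0 z0.
have [_ [k kG <-] hk] := sup_adherent (divr_gt0 h0 (ltr0n _ 10)) (has_sup_orbit z0).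
rewrite -/(height z) in hk; have kp := Gamma1_GL2p kG.
have wz := uhp_mobius kp z0; move: hk; set w := mobius k z => hk.
pose n : int := - Num.floor (complex.Re w + 2^-1).
have tG : Gamma1 (mx2 1%:~R n%:~R 0%:~R 1%:~R : 'M[rat]_2) by apply: Gamma1_mx2; rewrite mulr0 mulr1 subr0.
set t := mx2 _ _ _ _ in tG; have tp := Gamma1_GL2p tG.
exists (t *m k); first exact: Gamma1M.
rewrite mobius_comp// -/w; have tw := uhp_mobius tp wz.
have twE : mobius t w = w + n%:~R.
  by rewrite mobiusE /mnum /mden !mxE /= !rmorph0 !rmorph1 mul0r add0r divr1 mul1r ratr_int.
have Ren : complex.Re (w + n%:~R) = complex.Re w + n%:~R.
  by rewrite -[n%:~R](ratr_int _ n) ratr_complex; case: (w) => ? ? /=; rewrite ratr_int.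
have Imn : complex.Im (w + n%:~R) = complex.Im w.
  by rewrite -[n%:~R](ratr_int _ n) ratr_complex; case: (w) => ? ? /=; rewrite addr0.
have hre : - 2^-1 <= complex.Re (mobius t w) <= 2^-1.
  rewrite twE Ren /n rmorphN /=.
  have := floor_le_tmp (complex.Re w + 2^-1); have := floorD1_gt (complex.Re w + 2^-1).
  by rewrite intrD; move=> ? ?; apply/andP; split; lra.
split => //.
have sG : Gamma1 (mx2 0%:~R (-1)%:~R 1%:~R 0%:~R : 'M[rat]_2) by apply: Gamma1_mx2; rewrite mulr0 sub0r mulr1 opprK.
set s := mx2 _ _ _ _ in sG; have sp := Gamma1_GL2p sG.
have : complex.Im (mobius s (mobius t w)) <= height z.
  rewrite -!mobius_comp//; last exact: GL2pM.
  by apply: im_le_height => //; apply: Gamma1M => //; exact: Gamma1M.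
rewrite Gamma1_im//.
have -> : mden s (mobius t w) = mobius t w.
  by rewrite /mden !mxE /= rmorph1 rmorph0 mul1r addr0.
have i1 : complex.Im (mobius t w) = complex.Im w by rewrite twE.
have i0 : 0 < complex.Im (mobius t w) := tw.
rewrite cmod_sqr ler_pdivrMr; last by rewrite ltr_wpDl ?sqr_ge0// exprn_gt0.
move: hre i0; rewrite i1; move: hk; move: (complex.Re (mobius t w)) (complex.Im w) (height z) h0.
move=> x y h h0 hk /andP[x1 x2] y0 hh.
have hy : h * (9 / 10) < y by lra.
have hs : y < (y / (9 / 10)) * (x ^+ 2 + y ^+ 2).
  apply: le_lt_trans hh _; rewrite ltr_pM2r; last by nra.
  by rewrite ltr_pdivlMr//; lra.
have hq : 9 / 10 < x ^+ 2 + y ^+ 2.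
  by move: hs; rewrite -mulrA -[X in X < _]mulr1 ltr_pM2l// mulrC ltr_pdivlMr ?mul1r//; lra.
have xq : x ^+ 2 <= 4^-1 by nra.
rewrite leNgt; apply/negP; move: y0 hq xq; clear => y0 hq xq yl; nra.
Qed.

Definition bump_value (B : R) z : R := Num.max 0 (B - height z).

Definition bump (B : R) : gl2_fun R := fun g r z =>
  if `[< Gamma1 g /\ uhp z >] then (bump_value B z)%:C else 0.

Lemma bump_value_near B z w t : uhp z -> uhp w -> 0 < t -> t <= 4^-1 ->
  cmod (w - z) <= t * complex.Im z -> `|bump_value B w - bump_value B z| <= 24 * t * height z.
Proof.
move=> z0 w0 t0 t4 wz; apply: le_trans (height_near z0 w0 t0 t4 wz).
rewrite /bump_value; move: (height w) (height z) => x y.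
have := ler_norm (x - y); have := ler_norm (- (x - y)); rewrite normrN; move: `|x - y| => n h1 h2.
by have [h|h] := leP 0 (B - x); have [h'|h'] := leP 0 (B - y); rewrite ler_norml; apply/andP; split; lra.
Qed.

Lemma bumpP B : Ac (bump B).
Proof.
apply: Ac_build.
- move=> g r z nY; rewrite /bump; case: asboolP => // -[gG z0].
  by exfalso; apply: nY; split => //=; [exact: Gamma1_GL2p|exact: integral_Gamma1].
- move=> g r z Yg; have [/= gp gr z0] := Yg.
  have [gG|ngG] := pselect (Gamma1 g); last first.
    have bE z' : bump B g r z' = 0 by rewrite /bump; case: asboolP => // -[].
    rewrite bE; apply: (@ccvg_near _ _ _ _ _ (fun=> 0)); last exact: ccvg_cst.
    by near=> q; rewrite /bump; case: asboolP => // -[].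
  have bE z' : uhp z' -> forall r', bump B g r' z' = (bump_value B z')%:C.
    by move=> hz r'; rewrite /bump; case: asboolP => // -[].
  rewrite (bE _ z0); apply/cvgrPdist_lt => e e0.
  have eE : e = (complex.Re e)%:C by rewrite RRe_real// ger0_real// ltW.
  have re0 : 0 < complex.Re e by move: e0; rewrite eE -[X in X < _]/(0%:C) ltcR.
  (* The 25, against the 24 of [bump_value_near], makes the final inequality strict. *)
  pose t := Num.min 4^-1 (complex.Re e / (25 * height z)).
  have h0 := height_gt0 z0.
  have t0 : 0 < t by rewrite lt_min invr_gt0 ltr0n divr_gt0// mulr_gt0.
  have t4 : t <= 4^-1 by rewrite ge_min lexx.
  have te : 24 * t * height z < complex.Re e.
    have : t <= complex.Re e / (25 * height z) by rewrite ge_min lexx orbT.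
    by rewrite ler_pdivlMr ?mulr_gt0//; nra.
  exists (setT, [set w | cmod (w - z) < t * complex.Im z]) => /=.
    by split; [exact: filterT|apply: cmod_ball_nbhs; rewrite mulr_gt0].
  move=> [r' z'] /= [_ hz'] [_ _ z0'].
  rewrite (bE _ z0') -rmorphB cmodE [X in _ < X]eE ltcR cmod_real distrC.
  by apply: le_lt_trans te; apply: bump_value_near => //; exact: ltW.
- move=> c g r z cG _; rewrite /bump.
  suff -> : (Gamma1 (c *m g) /\ uhp z) = (Gamma1 g /\ uhp z) by [].
  apply/propext; split => -[h1 h2]; split => //; last exact: Gamma1M.
  by rewrite -[g]mul1mx -(mulVmx (Gamma1_unit cG)) -mulmxA; apply: Gamma1M => //; exact: Gamma1V.
- move=> c g r z cG [_ _ cz]; have z0 := uhp_mobiusV (Gamma1_GL2p cG) cz.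
  rewrite /bump /bump_value height_inv//.
  suff -> : (Gamma1 (g *m c) /\ uhp z) = (Gamma1 g /\ uhp (mobius c z)) by [].
  apply/propext; split => -[h1 h2]; split => //; last exact: Gamma1M.
  by rewrite -[g](mulmxK (Gamma1_unit cG)); apply: Gamma1M => //; exact: Gamma1V.
(* The variable rho is unrestricted, which calls for compactness of all of M2(Zhat); for z, a height
   below B bounds the imaginary part of the reduced point. *)
exists 1%N, 1, (setT `*` [set z : C | - 2^-1 <= complex.Re z <= 2^-1 /\ 4 / 5 <= complex.Im z <= B]); split => //.
- by apply: compact_setX; [exact: compact_mxZ|exact: rect_compact].
- by move=> [r z] /= [_ [_ /andP[h _]]]; rewrite /uhp /=; lra.
move=> g r z; rewrite /bump; case: asboolP => [[gG z0]|_]; last by rewrite eqxx.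
have [c cG [hre him]] := reduction z0 => b0.
have hB : height z < B.
  rewrite ltNge; apply/negP => hB; move: b0; rewrite /bump_value.
  by rewrite (max_idPl _) ?subr_le0// eqxx.
have cp := Gamma1_GL2p cG.
split.
  have [G dG gE] := gG; split; first exact: Gamma1_GL2p.
    by rewrite (Gamma1_det gG).
  by exists G; rewrite scale1r.
have Yc : Y (c : M2Q, r, z) by split => //=; exact: integral_Gamma1.
have [e1 e2] := act_inv Yc.
exists (invmx c), (actZ c r, mobius c z); split => //.
  exact: Gamma1V.
split => //=; split => //; apply/andP; split => //.
by apply: le_trans (im_le_height z0 cG) (ltW hB).
Unshelve. all: by end_near.
Qed.

Lemma bump_neq0 z r : uhp z -> bump (height z + 1) 1%:M r z != 0.
Proof.
move=> z0; rewrite /bump; case: asboolP => [_|]; last by move=> h; exfalso; apply: h; split => //; exact: Gamma1_1.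
rewrite /bump_value addrC addKr (max_idPr _) ?ler01//.
exact: oner_neq0.
Qed.
End bump.

(** * Transfer to the big picture *)

Section transfer.
Variables (R : realType) (T V : choiceType) (j : T -> V).
Hypothesis j_inj : injective j.
Local Notation C := R[i].
Implicit Types (k : T -> T -> C) (xi : V -> C) (u : T -> C) (c d : T) (v w : V).

Definition jinv v : option T :=
  match pselect (exists c, j c = v) with left h => Some (projT1 (cid h)) | right _ => None end.

Lemma jinvK c : jinv (j c) = Some c.
Proof.
rewrite /jinv; case: pselect => [h|]; last by move=> h; exfalso; apply: h; exists c.
by congr Some; apply: j_inj; exact: (projT2 (cid h)).
Qed.

Lemma jinvP v c : jinv v = Some c -> j c = v.
Proof. by rewrite /jinv; case: pselect => // h [<-]; exact: (projT2 (cid h)). Qed.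

Definition push u : V -> C := fun v => if jinv v is Some c then u c else 0.

Definition push2 k : V -> V -> C := fun v w => push (fun c => push (k c) w) v.

Lemma push_some u v c : jinv v = Some c -> push u v = u c.
Proof. by rewrite /push => ->. Qed.

Lemma push_none u v : jinv v = None -> push u v = 0.
Proof. by rewrite /push => ->. Qed.

Lemma push_j u c : push u (j c) = u c.
Proof. by rewrite /push jinvK. Qed.

Lemma push2_j k c d : push2 k (j c) (j d) = k c d.
Proof. by rewrite /push2 !push_j. Qed.

Lemma push_out (F : {fset T}) u : (forall c, c \notin F -> u c = 0) ->
  forall v, v \notin (j @` F)%fset -> push u v = 0.
Proof.
move=> hF v; rewrite /push; case E : (jinv v) => [c|] // vF; apply: hF.
by apply: contra vF => cF; rewrite -(jinvP E) in_imfset.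
Qed.

Lemma fsum_push (F : {fset T}) u : (forall c, c \notin F -> u c = 0) ->
  \sum_(v \in [set: V]) push u v = \sum_(c \in [set: T]) u c.
Proof.
move=> hF; rewrite (@fsbigTE _ _ _ _ (j @` F)%fset _ (push_out hF)) (@fsbigTE _ _ _ _ F _ hF) big_imfset /=; last by move=> x y _ _ /j_inj.
by apply: eq_bigr => c _; rewrite push_j.
Qed.

Lemma pushM u (xi : V -> C) v : push u v * xi v = push (fun c => u c * xi (j c)) v.
Proof. by rewrite /push; case E : (jinv v) => [c|]; rewrite ?mul0r// (jinvP E). Qed.

Lemma l2_comp xi : l2 xi -> l2 (xi \o j) /\ hn (xi \o j) <= hn xi.
Proof.
move=> h; apply: l2_hn (hn_ge0 _) _ => F; apply: le_trans (fn_le_hn (j @` F)%fset h).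
rewrite -(ler_pXn2r (n := 2))// ?nnegrE ?fn_ge0// !fn_sqr big_imfset //=.
by move=> x y _ _ /j_inj.
Qed.

Lemma l2_push u : l2 u -> l2 (push u) /\ hn (push u) <= hn u.
Proof.
move=> h; apply: l2_hn (hn_ge0 _) _ => F.
pose G := [fset c in pmap jinv F]%fset.
apply: le_trans (fn_le_hn G h).
rewrite -(ler_pXn2r (n := 2))// ?nnegrE ?fn_ge0// !fn_sqr.
have jG c : c \in G = (j c \in F).
  rewrite !inE /= mem_pmap; apply/mapP/idP => [[v vF /esym/jinvP ->]//|cF].
  by exists (j c) => //; rewrite jinvK.
have e : \sum_(c <- G) cmod (u c) ^+ 2 = \sum_(v <- (j @` G)%fset) cmod (push u v) ^+ 2.
  rewrite [RHS]big_imfset /=; last by move=> x y _ _ /j_inj.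
  by apply: eq_bigr => c _; rewrite push_j.
rewrite e (@big_fset_sub _ _ (j @` G)%fset F); last first.
  by apply/fsubsetP => _ /imfsetP[c /= cG ->]; rewrite -jG.
rewrite gerDl big_seq big1// => v; rewrite inE => /andP[vG vF].
rewrite /push; case E : (jinv v) => [c|]; last by rewrite cmod0 expr0n.
by move: vG; rewrite -(jinvP E) in_imfset// jG (jinvP E) vF.
Qed.

End transfer.

(** * The matrix of pi_y carried to V *)

Section assembly.
Variables (R : realType) (r : 'M[Zhat]_2) (z : R[i]).
Hypothesis z0 : uhp z.
Variables (A : cstarAlg R) (iota : gl2_fun R -> A).
Hypothesis hA : is_completion iota.
Variables (V : choiceType) (j : set_type (Yquot r) -> V).
Hypothesis j_inj : injective j.
Local Notation C := R[i].
Local Notation T := (set_type (Yquot r)).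
Local Open Scope complex_scope.
Implicit Types (f : gl2_fun R) (xi : V -> C) (v w : V).

Definition Vker f : V -> V -> C := push2 j (ker z f).

Lemma Vker_row f v : Ac f -> exists F : {fset V}, forall w, w \notin F -> Vker f v w = 0.
Proof.
move=> Af; rewrite /Vker /push2 {1}/push; case E : (jinv j v) => [c|]; last first.
  by exists fset0.
have [F hF] := ker_row z c Af; exists (j @` F)%fset => w wF.
exact: (push_out hF).
Qed.

Lemma Vker_col f w : Ac f -> exists F : {fset V}, forall v, v \notin F -> Vker f v w = 0.
Proof.
move=> Af; rewrite /Vker /push2; case E : (jinv j w) => [d|]; last first.
  by exists fset0 => v _; rewrite /push; case: (jinv j v) => // c; rewrite E.
have [F hF] := ker_col z d Af; exists (j @` F)%fset => v vF.
apply: (push_out _ vF) => c cF; rewrite /push E; exact: hF.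
Qed.

Lemma kop_Vker f xi : Ac f -> kop Vker f xi = push j (pi_y r z f (xi \o j)).
Proof.
move=> Af; apply/funext => v; rewrite /kop /Vker /push2.
case E : (jinv j v) => [c|]; last first.
  by rewrite (push_none _ E) fsbig1// => w _; rewrite (push_none _ E) mul0r.
have [F hF] := ker_row z c Af; rewrite (push_some _ E).
have h d : d \notin F -> ker z f c d * xi (j d) = 0 by move=> /hF ->; rewrite mul0r.
transitivity (\sum_(w \in [set: V]) push j (fun d => ker z f c d * xi (j d)) w); last first.
  exact: (fsum_push j_inj h).
by apply: eq_fsbigr => w _; rewrite (push_some _ E) pushM.
Qed.

Lemma Vker_add f1 f2 v w : Vker (Ac_add f1 f2) v w = Vker f1 v w + Vker f2 v w.
Proof.
by rewrite /Vker /push2 /push; case: (jinv j v) => [c|]; case: (jinv j w) => [d|]; rewrite ?addr0// ker_add.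
Qed.

Lemma Vker_scale k f v w : Vker (Ac_scale k f) v w = k * Vker f v w.
Proof.
by rewrite /Vker /push2 /push; case: (jinv j v) => [c|]; case: (jinv j w) => [d|]; rewrite ?mulr0// ker_scale.
Qed.

Lemma Vker_star f v w : Ac f -> Vker (Ac_star f) v w = (Vker f w v)^*.
Proof.
move=> Af; rewrite /Vker /push2 /push.
by case: (jinv j v) => [c|]; case: (jinv j w) => [d|]; rewrite ?ker_star// rmorph0.
Qed.

Lemma Vker_mul f1 f2 v w : Ac f1 -> Ac f2 ->
  Vker (Ac_mul f1 f2) v w = \sum_(u \in [set: V]) Vker f1 v u * Vker f2 u w.
Proof.
move=> A1 A2; rewrite /Vker /push2.
case Ev : (jinv j v) => [c|]; last first.
  by rewrite (push_none _ Ev) fsbig1// => u _; rewrite (push_none _ Ev) mul0r.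
rewrite (push_some _ Ev).
case Ew : (jinv j w) => [d|]; last first.
  rewrite (push_none _ Ew) fsbig1// => u _; rewrite [X in _ * X](_ : _ = 0) ?mulr0//.
  by rewrite {1}/push; case: (jinv j u) => // e; rewrite (push_none _ Ew).
rewrite (push_some _ Ew) ker_mul//; have [F hF] := ker_row z c A1.
have h e : e \notin F -> ker z f1 c e * ker z f2 e d = 0 by move=> /hF ->; rewrite mul0r.
transitivity (\sum_(u \in [set: V]) push j (fun e => ker z f1 c e * ker z f2 e d) u).
  by symmetry; exact: (fsum_push j_inj h).
apply: eq_fsbigr => u _; rewrite (push_some _ Ev).
case Eu : (jinv j u) => [e|]; last by rewrite !(push_none _ Eu) mul0r.
by rewrite !(push_some _ Eu) (push_some _ Ew).
Qed.

(** The norm of A controls pi_y(f) on the unit ball, through a supremum of operator norms. A vector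
    of positive norm is scaled into the ball; a vector of norm 0 vanishes. *)
Lemma pi_y_bound f (u : T -> C) : Ac f -> l2 u ->
  l2 (pi_y r z f u) /\ hn (pi_y r z f u) <= nrm (iota f) * hn u.
Proof.
move=> Af hu; have n0 := nrm_ge0 (iota f).
have piE : pi_y r z f = kop (ker z) f by [].
have unit_bound (u' : T -> C) : (l2norm u' <= 1)%E -> (l2norm (pi_y r z f u') <= (nrm (iota f))%:E)%E.
  move=> u1; rewrite (iota_norm hA Af).
  apply: (@le_trans _ _ (opnorm (pi_y r z f))).
    by apply: ereal_sup_ubound; exists u'.
  by apply: ereal_sup_ubound; exists (r, z).
apply: l2_hn; first by rewrite mulr_ge0 ?hn_ge0.
move=> F; have [h0|h0] := eqVneq (hn u) 0.
  have uE : u = fun=> 0.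
    apply/funext => c; apply/eqP; rewrite -cmod_eq0 eq_le cmod_ge0 andbT.
    by rewrite -h0; exact: cmod_le_hn.
  have -> : pi_y r z f u = fun=> 0.
    by apply/funext => c; rewrite uE pi_yE fsbig1// => d _; rewrite mulr0.
  rewrite h0 mulr0 /fn /fnorm big1 ?sqrtr0// => c _; by rewrite cmod0 expr0n.
have hp : 0 < hn u by rewrite lt_def h0 hn_ge0.
have cp : cmod ((hn u)^-1)%:C = (hn u)^-1 by rewrite cmod_real ger0_norm// invr_ge0 ltW.
have [l2u' hu'] := l2Z ((hn u)^-1)%:C hu.
pose u1 x := ((hn u)^-1)%:C * u x.
rewrite -/u1 in l2u' hu'.
have : (l2norm u1 <= 1)%E.
  by rewrite l2normE// lee_fin; apply: le_trans hu' _; rewrite cp mulVf.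
move=> /unit_bound; rewrite piE (kopZr (fun f c => @ker_row R r z f c) _ _ Af) => /(l2norm_leP _ n0)/(_ F).
by rewrite fnZ cp mulrC ler_pdivrMr.
Qed.

Lemma Vker_bound f xi : Ac f -> l2 xi ->
  l2 (kop Vker f xi) /\ hn (kop Vker f xi) <= nrm (iota f) * hn xi.
Proof.
move=> Af hxi; rewrite kop_Vker//.
have [h1 h1'] := l2_comp j_inj hxi; have [h2 h2'] := pi_y_bound Af h1.
have [h3 h3'] := l2_push j_inj h2; split => //.
by apply: le_trans h3' _; apply: le_trans h2' _; rewrite ler_wpM2l ?nrm_ge0.
Qed.

Variable (lam : V -> R) (cst : R).
Hypothesis hlam : forall c, lam (j c) = cst + ln (ratr (\det (rep c))).

(** Off the image of j both sides vanish; on it the phases of [cst] cancel and leave the conjugation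
    of [ker_evol]. *)
Lemma kop_evol t f xi v : Ac f ->
  kop Vker (Ac_evol t f) xi v = expi (t * lam v) * kop Vker f (fun w => expi (- t * lam w) * xi w) v.
Proof.
move=> Af; have Ae := Ac_evolP t Af; rewrite !kop_Vker//.
rewrite /push; case E : (jinv j v) => [c|]; last by rewrite mulr0.
have [F hF] := ker_row z c Af; have [F' hF'] := ker_row z c Ae.
rewrite !pi_yE (@fsbigTE _ _ _ _ (F `|` F')%fset); last first.
  by move=> d; rewrite inE negb_or => /andP[_ /hF' ->]; rewrite mul0r.
rewrite (@fsbigTE _ _ _ _ (F `|` F')%fset); last first.
  by move=> d; rewrite inE negb_or => /andP[/hF -> _]; rewrite mul0r.
rewrite mulr_sumr; apply: eq_bigr => d _ /=.
rewrite ker_evol// -(jinvP E) !hlam.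
rewrite mulrDr expiD [- t * _]mulrDr expiD mulNr mulNr.
have e1 : expi (t * cst) * expi (- (t * cst)) = 1 :> C by rewrite -expiD subrr expi0.
move: (expi (t * cst)) (expi (- (t * cst))) e1 => a b ab.
move: (expi _) (expi _) (ker _ _ _ _) (xi _) => p q k x.
by transitivity (a * b * (q * k * p * x)); [rewrite ab mul1r|ring].
Qed.
End assembly.

Lemma l2_delta (R : realType) (T : choiceType) (v : T) : l2 (delta R v).
Proof.
apply: (l2_hn ler01 _).1 => F.
rewrite -(ler_pXn2r (n := 2))// ?nnegrE ?fn_ge0// fn_sqr expr1n.
rewrite (eq_bigr (fun x => (x == v)%:R)); last first.
  by move=> x _; rewrite /delta; case: eqP => _; rewrite ?cmod1 ?cmod0 ?expr1n ?expr0n.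
have -> : \sum_(x <- F) (x == v)%:R = (count (pred1 v) F)%:R :> R.
  by rewrite -sum1_count natr_sum [RHS]big_mkcond; apply: eq_bigr => x _ /=; case: eqP.
by rewrite count_uniq_mem ?fset_uniq// lern1 leq_b1.
Qed.

Theorem theorem4p1 (R : realType)
    (Lambda1 : set R[i]) (phi1 : 'cV[rat]_2 -> set R[i])
    (rho1 : 'M[Zhat]_2) (z1 : R[i])
    (inv1 : invertible_Qlattice Lambda1 phi1)
    (hz1 : uhp z1) (rep1 : represents rho1 z1 Lambda1 phi1)
    (A : cstarAlg R) (iota : gl2_fun R -> A) (sigma : R -> A -> A)
    (hA : is_GL2_system iota sigma) :
  exists pi : A -> op R (set_type (PL Lambda1)),
    [/\ star_representation pi,
        exists a xi, l2 xi /\ pi a xi <> (fun=> 0)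
      & forall (t : R) (a : A) xi, l2 xi ->
          pi (sigma t a) xi =
          exp_it (ham Lambda1) t (pi a (exp_it (ham Lambda1) (- t) xi))].
Proof.
have [[Llat _ _ _] _ _] := inv1; have [k k0 [LE _]] := rep1; have [hc hs] := hA.
rewrite std_lat scale_lat mulr1 in LE; subst Lambda1.
have uv := indep_uhp k0 hz1.
have [j [j_inj hj]] := coset_embedding Llat uv.
pose lam (v : set_type (PL (lat k (k * z1)))) : R := dist1 (proj_class (lat k (k * z1))) (set_val v).
(* The additive constant is ln 2: a coset of determinant n is placed at hyperdistance 2 n. *)
have hlam c : lam (j c) = ln 2 + ln (ratr (\det (rep c))).
  have [n [n0 dn dE]] := hj c; rewrite /lam dE -/(rep c) in dn *.
  by rewrite dn ratr_nat natrM lnM// posrE ltr0n.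
have expE t xi : exp_it (ham (lat k (k * z1))) t xi = fun v => expi (t * lam v) * xi v.
  by apply/funext => v; rewrite /exp_it /ham /delta eqxx mulr1.
have Mrow (f : gl2_fun R) v : Ac f -> exists F : {fset set_type (PL (lat k (k * z1)))}, forall w, w \notin F -> Vker z1 j f v w = 0.
  exact: Vker_row.
have Madd (f1 f2 : gl2_fun R) v w : Vker z1 j (Ac_add f1 f2) v w = Vker z1 j f1 v w + Vker z1 j f2 v w.
  exact: Vker_add.
have Mscale q (f : gl2_fun R) v w : Vker z1 j (Ac_scale q f) v w = q * Vker z1 j f v w.
  exact: Vker_scale.
have Mbound (f : gl2_fun R) xi : Ac f -> l2 xi ->
    l2 (kop (Vker z1 j) f xi) /\ hn (kop (Vker z1 j) f xi) <= nrm (iota f) * hn xi.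
  exact: Vker_bound.
exists (ext_op iota (Vker z1 j)); split.
- apply: (ext_op_repr hc) => //.
  + by move=> f v; exact: Vker_col.
  + by move=> f1 f2 v w; exact: Vker_mul.
  + by move=> f v w; exact: Vker_star.
(* Nonvanishing is seen on the diagonal entry at the coset of the identity. Its chosen
   representative is some gamma in Gamma1, so [f0] is evaluated over gamma z1, where invariance of
   the height keeps the bump nonzero. *)
- have [c0 c0E] : exists c0 : set_type (Yquot 1%:M), set_val c0 = Gcoset (1%:M : 'M[rat]_2).
    have Y1 : Yquot 1%:M (Gcoset (1%:M : 'M[rat]_2)).
      exists (1%:M : 'M[rat]_2) => //; split; first exact: (Gamma1_GL2p Gamma1_1).
      exact: (integral_Gamma1 _ Gamma1_1).
    by exists (SigSub (mem_set Y1)).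
  have [gp _ gE] := repP c0.
  have gG : Gamma1 (rep c0).
    have : Gcoset (rep c0) (rep c0) by exists (1%:M : 'M[rat]_2); [exact: Gamma1_1|rewrite mul1mx].
    by rewrite -gE c0E => -[h hG]; rewrite mulmx1 => <-.
  pose f0 := bump (height z1 + 1); pose xi := delta R (j c0).
  have Af0 : Ac f0 by exact: bumpP.
  have lxi : l2 xi by exact: l2_delta.
  exists (iota f0), xi; split => // /(congr1 (fun h => h (j c0))).
  rewrite (ext_op_iota hc)//.
  rewrite /kop (@fsbigTE _ _ _ _ [fset j c0]%fset); last first.
    by move=> w; rewrite inE /xi /delta => /negbTE ->; rewrite mulr0.
  rewrite big_seq_fset1 /xi /delta eqxx mulr1 /Vker push2_j// /ker mulmxV ?GL2p_unit//.
  apply/eqP; rewrite /f0 -(height_inv hz1 gG); apply: bump_neq0.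
  exact: uhp_mobius.
move=> t a xi hxi; rewrite !expE; have [_ sD sZ _ _ sn] := (evol_aut hs t).
have := @ext_op_intertwine _ _ _ hc _ _ Mrow Madd Mscale Mbound (sigma t) (Ac_evol t)
  (fun v => expi (t * lam v)) (fun v => expi (- t * lam v)).
apply => //.
- by move=> b b'; rewrite sD -[- b']scaleN1r sZ scaleN1r.
- by move=> b; rewrite /nrm sn.
- by move=> f Af; split; [exact: Ac_evolP|exact: evol_iota].
- by move=> v; rewrite cmod_expi.
- by move=> v; rewrite cmod_expi.
by move=> f eta v Af; apply: (kop_evol _ j_inj hlam).
Qed.
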